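(* Let $n\ge 3$, let $p$ be an integer with $2\le p<n$, and let $D$ be a bounded $p$-convex domain in $\mathbb{R}^n$ with $\mathscr{C}^r$ boundary $bD$ for some real number $r>2$. Let $\delta(\mathbf{x})=\mathrm{dist}(\mathbf{x},D)-\mathrm{dist}(\mathbf{x},\mathbb{R}^n\setminus D)$ for $\mathbf{x}\in\mathbb{R}^n$. Then for every $t<0$ sufficiently close to $0$ the domain $D_t=\{\mathbf{x}\in D:\delta(\mathbf{x})<t\}$ is $p$-convex, and it is strongly $p$-convex if $bD$ does not contain any $p$-flat points.
   Context: Let $\nu_1(\mathbf{x})\le\cdots\le\nu_{n-1}(\mathbf{x})$ denote the principal interior curvatures of the boundary of a domain at a boundary point $\mathbf{x}$, i.e. the eigenvalues of the second fundamental form of the boundary with respect to the inner unit normal (with the sign such that they are nonnegative for convex domains). The boundary is $p$-convex if $\nu_1(\mathbf{x})+\cdots+\nu_p(\mathbf{x})\ge 0$ at every boundary point $\mathbf{x}$, and strongly $p$-convex if $\nu_1(\mathbf{x})+\cdots+\nu_p(\mathbf{x})>0$ at every boundary point; a domain is called strongly $p$-convex if its boundary is. A boundary point $\mathbf{x}$ is $p$-flat if $\nu_i(\mathbf{x})=0$ for all $i=1,\ldots,p$. A $\mathscr{C}^2$ function $\rho$ is strongly $p$-plurisubharmonic if the trace of the restriction of its Hessian $\mathrm{Hess}_\rho(\mathbf{x})$ to $\Lambda$ is positive for every point $\mathbf{x}$ and every $p$-dimensional linear subspace $\Lambda\subset\mathbb{R}^n$. A domain $D\subset\mathbb{R}^n$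 is $p$-convex if it admits a strongly $p$-plurisubharmonic exhaustion function $\rho:D\to\mathbb{R}$ (all sets $\{\mathbf{x}\in D:\rho(\mathbf{x})\le c\}$, $c\in\mathbb{R}$, are compact). For bounded domains with smooth boundary the paper uses the known fact (Harvey–Lawson) that $D$ is $p$-convex if and only if $bD$ is $p$-convex. For noninteger $r=k+\alpha$ with $k$ an integer and $0<\alpha<1$, $\mathscr{C}^r$ means the Hölder class $\mathscr{C}^{k,\alpha}$. *)

(* Defs.v *)
From HB Require Import structures.
From mathcomp Require Import all_boot all_order all_algebra.
From mathcomp Require Import all_classical all_reals all_analysis.

Set Implicit Arguments.
Unset Strict Implicit.
Unset Printing Implicit Defensive.

Import Order.TTheory GRing.Theory Num.Theory.
Import numFieldNormedType.Exports.

Local Open Scope classical_set_scope.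
Local Open Scope ring_scope.

(* The library norm on 'rV[R]_n is the sup norm. It induces the usual topology,
   bounded sets and directional derivatives, but lengths, distances and
   orthogonality have to be taken with respect to the Euclidean structure
   [dot], [enorm]. *)

Section Euclidean.
Context {R : realType} {n : nat}.
Implicit Types (x y u v : 'rV[R]_n) (A D : set 'rV[R]_n).

Definition dot u v : R := \sum_(i < n) u 0 i * v 0 i.

Definition enorm u : R := Num.sqrt (dot u u).

Definition orthonormal_tuple k (b : k.-tuple 'rV[R]_n) : Prop :=
  forall i j : 'I_k, dot (tnth b i) (tnth b j) = (i == j)%:R.

(* [inf] is the intended infimum only for A nonempty. *)
Definition dist_to x A : R := inf [set enorm (x - y) | y in A].

Definition signed_dist D x : R := dist_to x D - dist_to x (~` D).

Definition sublevel_domain D (t : R) : set 'rV[R]_n :=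
  [set x | D x /\ signed_dist D x < t].

Definition bd A : set 'rV[R]_n := closure A `\` interior A.

Definition is_domain D : Prop := [/\ open D, connected D & D !=set0].

End Euclidean.

Section Differentiability.
Context {R : realType} {n : nat}.
Implicit Types (f : 'rV[R]_n -> R) (x : 'rV[R]_n) (U : set 'rV[R]_n).

Definition ebase (i : 'I_n) : 'rV[R]_n := delta_mx 0 i.

(* The last index of [s] is differentiated first. *)
Definition partials (s : seq 'I_n) f : 'rV[R]_n -> R :=
  foldr (fun i g => fun x => 'D_(ebase i) g x) f s.

Definition grad f x : 'rV[R]_n := \row_i partials [:: i] f x.

Definition hessian f x : 'M[R]_n := \matrix_(i, j) partials [:: i; j] f x.

Definition class_C (k : nat) U f : Prop :=
  forall s : seq 'I_n, (size s <= k)%N -> forall x, U x ->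
    {for x, continuous (partials s f)} /\
    ((size s < k)%N -> forall i, derivable (partials s f) x (ebase i)).

Definition hoelder_on (alpha : R) U f : Prop :=
  exists C : R, forall x y, U x -> U y ->
    `|f x - f y| <= C * enorm (x - y) `^ alpha.

Definition class_Cr (r : R) U f : Prop :=
  let k := Num.truncn r in
  let alpha := r - k%:R in
  class_C k U f /\
  (0 < alpha ->
     forall s : seq 'I_n, size s = k -> hoelder_on alpha U (partials s f)).

End Differentiability.

Section Boundary.
Context {R : realType} {n : nat}.
Implicit Types (D U : set 'rV[R]_n) (phi : 'rV[R]_n -> R) (x : 'rV[R]_n).

Definition local_defining_function (r : R) D x U phi : Prop :=
  [/\ open U, U x, class_Cr r U phi,
      forall y, U y -> (D y <-> phi y < 0) &
      forall y, U y -> grad phi y != 0].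

Definition has_Cr_boundary (r : R) D : Prop :=
  forall x, bd D x -> exists U phi, local_defining_function r D x U phi.

(* On the boundary of D = {phi < 0} this is the inner unit normal; off the
   boundary it is a C^1 extension of it. *)
Definition inner_normal phi x : 'rV[R]_n :=
  - (enorm (grad phi x))^-1 *: grad phi x.

(* II(v, w) = - <D_v N, w> with N the inner unit normal, for tangent v, w;
   it is positive semidefinite when D is convex. *)
Definition second_fundamental_form phi x (v w : 'rV[R]_n) : R :=
  - dot ('D_v (inner_normal phi) x) w.

(* [nu] lists in increasing order, with multiplicity, the eigenvalues of the
   second fundamental form of bd D at x. The form is represented by its matrix
   in an orthonormal basis [b] of the tangent space. Since [nu] depends neither
   on the defining function nor on [b], it is determined by D and x. *)
Definition principal_curvatures D x (nu : n.-1.-tuple R) : Prop :=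
  sorted <=%R nu /\
  exists U phi (b : n.-1.-tuple 'rV[R]_n),
    [/\ local_defining_function 2 D x U phi,
        orthonormal_tuple b,
        forall i, dot (tnth b i) (inner_normal phi x) = 0 &
        char_poly (\matrix_(i, j)
            second_fundamental_form phi x (tnth b i) (tnth b j))
          = \prod_(a <- nu) ('X - a%:P)].

Definition p_flat (p : nat) D x : Prop :=
  exists nu, principal_curvatures D x nu /\
    forall i, (i < p)%N -> nu`_i = 0.

Definition strongly_p_convex (p : nat) D : Prop :=
  has_Cr_boundary 2 D /\
  forall x, bd D x -> exists nu, principal_curvatures D x nu /\
    0 < \sum_(i < p) nu`_i.

End Boundary.

Section PConvex.
Context {R : realType} {n : nat}.
Implicit Types (D : set 'rV[R]_n) (rho : 'rV[R]_n -> R).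

(* The trace of a quadratic form on a subspace of dimension p is the sum of its
   values on any orthonormal basis of the subspace. *)
Definition strongly_p_psh (p : nat) D rho : Prop :=
  class_C 2 D rho /\
  forall x, D x -> forall L : {vspace 'rV[R]_n}, (\dim L)%VS = p ->
    forall b : p.-tuple 'rV[R]_n, basis_of L b -> orthonormal_tuple b ->
      0 < \sum_(i < p) dot (tnth b i *m hessian rho x) (tnth b i).

Definition exhaustion D rho : Prop :=
  forall c : R, compact [set x | D x /\ rho x <= c].

Definition p_convex_domain (p : nat) D : Prop :=
  is_domain D /\ exists rho, strongly_p_psh p D rho /\ exhaustion D rho.

End PConvex.

(* Main.v *)
Require Import Defs.
From mathcomp Require Import all_boot all_order all_algebra.
From mathcomp Require Import all_classical all_reals all_analysis.
From mathcomp Require Import ring lra.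
Import Order.TTheory GRing.Theory Num.Theory.
Import numFieldNormedType.Exports.
Local Open Scope classical_set_scope.
Local Open Scope ring_scope.

Set Implicit Arguments.
Unset Strict Implicit.
Unset Printing Implicit Defensive.

(* Let d be the distance to the complement of D, and H its Hessian.

   Near the boundary the foot point y of x solves y = x - d(x) N(y), where N is
   the inner normal. This equation makes y Lipschitz in x, and differentiating
   it shows, without the inverse function theorem, that d is C^2 near the
   boundary, that grad d = N(y), and that the principal curvatures of the level
   set of depth s are k = nu / (1 - s nu), with nu those of bD at y.

   Kontinuitaetssatz: if the trace of H on some p-plane tangent to a level set
   were positive, a p-dimensional paraboloid with negative trace could be swept
   along the normal so that its vertex reaches bD while its edge stays in a
   compact subset of D; the maximum principle on the swept region contradicts
   the existence of a strongly p-plurisubharmonic exhaustion function. So the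
   level sets of d near bD are p-convex.

   Hence G(d) + |x|^2, with G decreasing, convex, infinite at s and zero beyond
   s + m for a small m, is a strongly p-plurisubharmonic exhaustion function of
   {d > s}: the term G'' |grad d|^2 compensates the planes which are not tangent
   to the level sets. Finally, k_1 + ... + k_p increases strictly with depth
   unless nu_1 = ... = nu_p = 0, and it is nonnegative at depth s / 2, so it is
   positive at depth s if bD has no p-flat points. *)

(** Two obstacles shape the details. First, convexity is tested only inside D, where the distance is
    known to be C^2, and no curvature sum of bD itself is ever estimated. The strict inequality at
    depth s is therefore obtained by comparison with depth s / 2 on the same normal, which involves
    no limit at the boundary; the curvatures of bD serve only to recognise a p-flat foot point. Both
    depths must refer to one defining function and one derivative of its normal at the common foot
    point, and this is built into [collar_point].

    Second, traces are taken on orthonormal frames, but lifting a frame to the paraboloid or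
    projecting it to a tangent space destroys orthonormality. In both cases the Gram matrix is I + k
    c c^T with k = 1 or k = -1. Its inverse square root is explicit, and the resulting change of the
    trace is of order |c|^2: small on a small cap, and of the size of the term with G'' in the
    exhaustion function. *)

Section EuclideanGeometry.
Context {R : realType} {n : nat}.
Implicit Types (x y z u v w : 'rV[R]_n) (a b : R) (M : 'M[R]_n).

(** * Euclidean inner product and norm, and their comparison with the sup norm *)

Lemma dotC u v : dot u v = dot v u.
Proof. by apply: eq_bigr => i _; rewrite mulrC. Qed.

Lemma dotDl u v w : dot (u + v) w = dot u w + dot v w.
Proof. by rewrite /dot -big_split; apply: eq_bigr => i _; rewrite mxE mulrDl. Qed.

Lemma dotZl a u v : dot (a *: u) v = a * dot u v.
Proof. by rewrite /dot big_distrr; apply: eq_bigr => i _ /=; rewrite mxE mulrA. Qed.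

Lemma dotDr u v w : dot u (v + w) = dot u v + dot u w.
Proof. by rewrite dotC dotDl !(dotC _ u). Qed.

Lemma dotZr a u v : dot u (a *: v) = a * dot u v.
Proof. by rewrite dotC dotZl dotC. Qed.

Lemma dotNl u v : dot (- u) v = - dot u v.
Proof. by rewrite -scaleN1r dotZl mulN1r. Qed.

Lemma dotNr u v : dot u (- v) = - dot u v.
Proof. by rewrite dotC dotNl dotC. Qed.

Lemma dotBl u v w : dot (u - v) w = dot u w - dot v w.
Proof. by rewrite dotDl dotNl. Qed.

Lemma dotBr u v w : dot u (v - w) = dot u v - dot u w.
Proof. by rewrite dotDr dotNr. Qed.

Lemma dot0l u : dot 0 u = 0.
Proof. by rewrite -(scale0r 0) dotZl mul0r. Qed.

Lemma dot0r u : dot u 0 = 0.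
Proof. by rewrite dotC dot0l. Qed.

Lemma dot_suml (I : Type) (r : seq I) (P : pred I) (F : I -> 'rV[R]_n) u :
  dot (\sum_(i <- r | P i) F i) u = \sum_(i <- r | P i) dot (F i) u.
Proof.
by elim/big_rec2: _ => [|i y x _ <-]; rewrite ?dot0l// dotDl.
Qed.

Lemma dot_sumr (I : Type) (r : seq I) (P : pred I) (F : I -> 'rV[R]_n) u :
  dot u (\sum_(i <- r | P i) F i) = \sum_(i <- r | P i) dot u (F i).
Proof. by rewrite dotC dot_suml; apply: eq_bigr => i _; rewrite dotC. Qed.

Lemma dot_ge0 u : 0 <= dot u u.
Proof. by apply: sumr_ge0 => i _; rewrite -expr2 sqr_ge0. Qed.

Lemma dot_eq0 u : dot u u = 0 -> u = 0.
Proof.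
move=> /psumr_eq0P H; apply/rowP => i; rewrite mxE; apply/eqP.
by rewrite -sqrf_eq0 expr2 H// => j _; rewrite -expr2 sqr_ge0.
Qed.

Lemma dot_mx u v : dot u v = (u *m v^T) 0 0.
Proof. by rewrite mxE; apply: eq_bigr => i _; rewrite mxE. Qed.

Lemma dot_mulmx_tr M u v : dot (u *m M) v = dot u (v *m M^T).
Proof. by rewrite !dot_mx trmx_mul trmxK mulmxA. Qed.

Lemma enorm_ge0 u : 0 <= enorm u.
Proof. exact: sqrtr_ge0. Qed.

Lemma sqr_enorm u : enorm u ^+ 2 = dot u u.
Proof. by rewrite sqr_sqrtr// dot_ge0. Qed.

Lemma enorm0 : enorm (0 : 'rV[R]_n) = 0.
Proof. by rewrite /enorm dot0l sqrtr0. Qed.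

Lemma enorm_eq0 u : enorm u = 0 -> u = 0.
Proof. by move=> u0; apply: dot_eq0; rewrite -sqr_enorm u0 expr0n. Qed.

Lemma enorm_gt0 u : (0 < enorm u) = (u != 0).
Proof.
rewrite lt_neqAle enorm_ge0 andbT eq_sym; congr (~~ _).
by apply/eqP/eqP => [/enorm_eq0|->]//; exact: enorm0.
Qed.

Lemma enormZ a u : enorm (a *: u) = `|a| * enorm u.
Proof.
by rewrite /enorm dotZl dotZr mulrA -expr2 sqrtrM ?sqr_ge0// sqrtr_sqr.
Qed.

Lemma enormN u : enorm (- u) = enorm u.
Proof. by rewrite -scaleN1r enormZ normrN1 mul1r. Qed.

Lemma enormC u v : enorm (u - v) = enorm (v - u).
Proof. by rewrite -enormN opprB. Qed.

(** Cauchy-Schwarz: the square of |v| u - |u| v expands to 2 |u| |v| (|u| |v| - u.v). *)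
Lemma dot_le_enorm u v : dot u v <= enorm u * enorm v.
Proof.
have [->|u0] := eqVneq u 0; first by rewrite dot0l enorm0 mul0r.
have eu0 : 0 < enorm u by rewrite enorm_gt0.
have [->|v0] := eqVneq v 0; first by rewrite dot0r enorm0 mulr0.
have ev0 : 0 < enorm v by rewrite enorm_gt0.
have := dot_ge0 ((enorm v) *: u - (enorm u) *: v).
rewrite dotBl !dotBr !dotZl !dotZr (dotC v u) -!sqr_enorm => H.
have {}H : 0 <= 2 * (enorm u * enorm v) * (enorm u * enorm v - dot u v) by nra.
by rewrite pmulr_rge0 ?subr_ge0// in H; rewrite !mulr_gt0.
Qed.

Lemma norm_dot_le u v : `|dot u v| <= enorm u * enorm v.
Proof.
rewrite ler_norml dot_le_enorm andbT lerNl -dotNl -(enormN u).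
exact: dot_le_enorm.
Qed.

Lemma ler_enormD u v : enorm (u + v) <= enorm u + enorm v.
Proof.
rewrite -(@ler_pXn2r _ 2)// ?nnegrE ?addr_ge0 ?enorm_ge0//.
rewrite sqr_enorm dotDl !dotDr (dotC v u) sqrrD !sqr_enorm.
by have := dot_le_enorm u v; lra.
Qed.

Lemma ler_enormB u v : enorm (u - v) <= enorm u + enorm v.
Proof. by rewrite -(enormN v); exact: ler_enormD. Qed.

Lemma ler_enorm_dist u v : `|enorm u - enorm v| <= enorm (u - v).
Proof.
rewrite ler_norml; apply/andP; split.
  by have := ler_enormD (v - u) u; rewrite subrK enormC; lra.
by have := ler_enormD (u - v) v; rewrite subrK; lra.
Qed.

Lemma enorm_triangle x y z : enorm (x - z) <= enorm (x - y) + enorm (y - z).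
Proof. by rewrite -[x - z](subrKA y); exact: ler_enormD. Qed.

Lemma ler_enorm_sum (I : Type) (r : seq I) (P : pred I) (F : I -> 'rV[R]_n) :
  enorm (\sum_(i <- r | P i) F i) <= \sum_(i <- r | P i) enorm (F i).
Proof.
elim/big_rec2: _ => [|i y x _ le]; first by rewrite enorm0.
by apply: le_trans (ler_enormD _ _) _; rewrite lerD2l.
Qed.

Lemma coord_le_norm u i : `|u 0 i| <= `|u|.
Proof.
rewrite [leRHS]/Num.Def.normr /= mx_normrE.
by apply/bigmax_geP; right => /=; exists (0, i).
Qed.

Lemma norm_le_enorm u : `|u| <= enorm u.
Proof.
rewrite [leLHS]/Num.Def.normr /= mx_normrE; apply/bigmax_leP; split.
  exact: enorm_ge0.
move=> [i j] _ /=; rewrite (ord1 i) -sqrtr_sqr ler_sqrt ?dot_ge0//.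
rewrite /dot (bigD1 j)//= -expr2 lerDl sumr_ge0// => k _.
by rewrite -expr2 sqr_ge0.
Qed.

Lemma enorm_le_sum u : enorm u <= \sum_(i < n) `|u 0 i|.
Proof.
rewrite {1}[u]row_sum_delta; apply: le_trans (ler_enorm_sum _ _ _) _.
apply: ler_sum => i _; rewrite enormZ /enorm /dot (bigD1 i)//=.
rewrite !mxE !eqxx mulr1 big1 ?addr0 ?sqrtr1 ?mulr1// => j /negPf ji.
by rewrite !mxE ji andbF mulr0.
Qed.

Lemma enorm_le_norm u : enorm u <= n%:R * `|u|.
Proof.
apply: le_trans (enorm_le_sum u) _.
have -> : n%:R * `|u| = \sum_(i < n) `|u| by rewrite sumr_const card_ord mulr_natl.
by apply: ler_sum => i _; exact: coord_le_norm.
Qed.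

Lemma nbhs_enormP x (P : set 'rV[R]_n) :
  nbhs x P <-> exists2 e, 0 < e & forall z, enorm (z - x) < e -> P z.
Proof.
rewrite -nbhs_nbhs_norm; split=> [[e/= e0 eP]|[e e0 eP]].
  exists e => // z ez; apply: eP => /=; rewrite distrC.
  exact: le_lt_trans (norm_le_enorm _) _.
(* The dimension may be 0 here, hence the division by n + 1. *)
exists (e / n.+1%:R); first by rewrite /= divr_gt0.
move=> z /=; rewrite distrC => zx; apply: eP.
apply: le_lt_trans (enorm_le_norm _) _.
rewrite ltr_pdivlMr// mulrC in zx; apply: le_lt_trans zx.
by rewrite ler_wpM2r// ler_nat.
Qed.

Lemma enorm_near x e : 0 < e -> \forall z \near x, enorm (z - x) < e.
Proof. by move=> e0; apply/nbhs_enormP; exists e. Qed.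

Lemma open_enormP (U : set 'rV[R]_n) x : open U -> U x ->
  exists2 e, 0 < e & forall z, enorm (z - x) < e -> U z.
Proof. by move=> oU Ux; apply/nbhs_enormP; exact: open_nbhs_nbhs. Qed.

Lemma enorm_openP (U : set 'rV[R]_n) :
  (forall x, U x -> exists2 e, 0 < e & forall z, enorm (z - x) < e -> U z) ->
  open U.
Proof.
by move=> H; rewrite openE => x /H /nbhs_enormP.
Qed.

Lemma cvg_enorm (T : Type) (F : set_system T) (f : T -> 'rV[R]_n) x :
  Filter F -> f @ F --> x <->
  (forall e, 0 < e -> \forall t \near F, enorm (f t - x) < e).
Proof.
move=> FF; split=> [fx e e0|H]; first by apply: (fx [set z | enorm (z - x) < e]); exact: enorm_near.
by move=> P /nbhs_enormP[e e0 eP]; apply: filterS (H e e0) => t /eP.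
Qed.

Lemma continuous_enorm : continuous (@enorm R n).
Proof.
move=> x; apply/(@cvgrPdist_lt _ _ _ (nbhs x)) => e e0; near=> z.
rewrite distrC; apply: le_lt_trans (ler_enorm_dist _ _) _.
by near: z; exact: enorm_near.
Unshelve. all: by end_near. Qed.

Lemma closureP_enorm (A : set 'rV[R]_n) x : closure A x <->
  forall e, 0 < e -> exists2 z, A z & enorm (z - x) < e.
Proof.
split=> [cx e e0|H B /nbhs_enormP[e e0 eB]].
  by have [z [Az ez]] := cx _ (enorm_near x e0); exists z.
by have [z Az ez] := H e e0; exists z; split => //; exact: eB.
Qed.

Lemma bounded_enormP (A : set 'rV[R]_n) :
  bounded_set A <-> exists K : R, forall x, A x -> enorm x <= K.
Proof.
split=> [[K [_ HK]]|[K HK]].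
  exists (n%:R * (K + 1)) => x Ax; apply: le_trans (enorm_le_norm _) _.
  by rewrite ler_wpM2l//; apply: HK => //; rewrite ltrDl.
exists K; split; first exact: num_real.
move=> N KN x Ax; apply: le_trans (norm_le_enorm x) _.
by apply: le_trans (HK _ Ax) (ltW KN).
Qed.

Lemma mulmx_enorm_bound M : exists2 C, 0 <= C &
  forall u, enorm (u *m M) <= C * enorm u.
Proof.
exists (\sum_i enorm (row i M)); first by apply: sumr_ge0 => i _; exact: enorm_ge0.
move=> u; rewrite mulmx_sum_row; apply: le_trans (ler_enorm_sum _ _ _) _.
rewrite mulrC big_distrr; apply: ler_sum => i _ /=; rewrite enormZ.
rewrite ler_wpM2r ?enorm_ge0//.
exact: le_trans (coord_le_norm u i) (norm_le_enorm u).
Qed.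

End EuclideanGeometry.

(** * Strict derivatives of scalar and vector functions *)

Section StrictDifferentiability.
Context {R : realType} {n : nat}.
Implicit Types (x y z u v w : 'rV[R]_n) (M : 'M[R]_n).

(* Strict derivatives: on an open set their existence everywhere amounts to C^1,
   and they pass through the implicit equation of the foot point. *)
Definition sdiff (f : 'rV[R]_n -> R) x (g : 'rV[R]_n) : Prop :=
  forall e, 0 < e -> \forall p \near (x, x),
    `|f p.1 - f p.2 - dot g (p.1 - p.2)| <= e * enorm (p.1 - p.2).

Definition vdiff (f : 'rV[R]_n -> 'rV[R]_n) x (A : 'M[R]_n) : Prop :=
  forall e, 0 < e -> \forall p \near (x, x),
    enorm (f p.1 - f p.2 - (p.1 - p.2) *m A) <= e * enorm (p.1 - p.2).

Lemma near_pairP x (Q : 'rV[R]_n * 'rV[R]_n -> Prop) :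
  (\forall p \near (x, x), Q p) <->
  exists2 r, 0 < r & forall z w, enorm (z - x) < r -> enorm (w - x) < r -> Q (z, w).
Proof.
split=> [[[/= A B] [/nbhs_enormP[a a0 Aa] /nbhs_enormP[b b0 Bb]] AB]|[r r0 Hr]].
  exists (Order.min a b); first by rewrite lt_min a0.
  move=> z w; rewrite !lt_min => /andP[za _] /andP[_ wb].
  by apply: (AB (z, w)); split => /=; [exact: Aa|exact: Bb].
exists ([set z | enorm (z - x) < r], [set z | enorm (z - x) < r]) => /=.
  by split; exact: enorm_near.
by move=> [z w] [/= zr wr]; exact: Hr.
Qed.

Lemma near_pair x (P : 'rV[R]_n -> Prop) : (\forall z \near x, P z) ->
  \forall p \near (x, x), P p.1 /\ P p.2.
Proof.
move=> /nbhs_enormP[r r0 rP]; apply/near_pairP; exists r => // z w zr wr.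
by split; exact: rP.
Qed.

Lemma near_pair_comp (f : 'rV[R]_n -> 'rV[R]_n) x (Q : 'rV[R]_n * 'rV[R]_n -> Prop) :
  {for x, continuous f} -> (\forall p \near (f x, f x), Q p) ->
  \forall p \near (x, x), Q (f p.1, f p.2).
Proof.
move=> cf /near_pairP[r r0 rQ].
have : \forall z \near x, enorm (f z - f x) < r.
  by apply: (cf [set y | enorm (y - f x) < r]); exact: enorm_near.
by move=> /near_pair; apply: filterS => p [] ? ?; exact: rQ.
Qed.

Lemma sdiff_lip f x g : sdiff f x g -> \forall p \near (x, x),
  `|f p.1 - f p.2| <= (1 + enorm g) * enorm (p.1 - p.2).
Proof.
move=> /(_ 1 ltr01); apply: filterS => p H.
have := norm_dot_le g (p.1 - p.2).
by move: H; rewrite !ler_norml => /andP[? ?] /andP[? ?]; apply/andP; split; lra.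
Qed.

Lemma vdiff_lip f x A : vdiff f x A -> exists2 C, 0 < C & \forall p \near (x, x),
  enorm (f p.1 - f p.2) <= C * enorm (p.1 - p.2).
Proof.
have [C C0 HC] := mulmx_enorm_bound A.
exists (1 + C); first by rewrite ltr_pwDl.
move: H => /(_ 1 ltr01); apply: filterS => p H.
rewrite -[X in enorm X](subrK ((p.1 - p.2) *m A)).
apply: le_trans (ler_enormD _ _) _; rewrite mulrDl; exact: lerD.
Qed.

Lemma near_pair_at x (Q : 'rV[R]_n * 'rV[R]_n -> Prop) :
  (\forall p \near (x, x), Q p) -> \forall z \near x, Q (z, x).
Proof.
move=> /near_pairP[r r0 rQ]; apply/nbhs_enormP; exists r => // z zr.
by apply: rQ => //; rewrite subrr enorm0.
Qed.

Lemma sdiff_continuous f x g : sdiff f x g -> {for x, continuous f}.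
Proof.
move=> /sdiff_lip/near_pair_at H; apply/(@cvgrPdist_lt _ _ _ (nbhs x)) => e e0.
have C0 : 0 < 1 + enorm g by rewrite ltr_pwDl// enorm_ge0.
near=> z; rewrite distrC.
apply: (@le_lt_trans _ _ ((1 + enorm g) * enorm (z - x))).
  by near: z; exact: H.
rewrite mulrC -ltr_pdivlMr//; near: z; apply: enorm_near.
exact: divr_gt0.
Unshelve. all: by end_near. Qed.

Lemma vdiff_continuous f x A : vdiff f x A -> {for x, continuous f}.
Proof.
move=> /vdiff_lip[C C0 /near_pair_at H]; apply/(@cvg_enorm _ _ _ (nbhs x)) => e e0.
near=> z; apply: (@le_lt_trans _ _ (C * enorm (z - x))).
  by near: z; exact: H.
rewrite mulrC -ltr_pdivlMr//; near: z; apply: enorm_near.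
exact: divr_gt0.
Unshelve. all: by end_near. Qed.

Lemma near_line x v (P : 'rV[R]_n -> Prop) :
  (\forall z \near x, P z) -> \forall h \near (0 : R), P (h *: v + x).
Proof.
move=> /nbhs_enormP[r r0 rP].
have v0 : 0 < 1 + enorm v by rewrite ltr_pwDl// enorm_ge0.
near=> h; apply: rP; rewrite addrK enormZ.
apply: (@le_lt_trans _ _ (`|h| * (1 + enorm v))).
  by rewrite ler_wpM2l// lerDr.
rewrite -ltr_pdivlMr//; near: h.
have := @nbhs0_lt _ R (r / (1 + enorm v)); apply; exact: divr_gt0.
Unshelve. all: by end_near. Qed.

Lemma sdiff_is_derive f x g v : sdiff f x g -> is_derive x v f (dot g v).
Proof.
move=> H.
suff Hc : (fun h => h^-1 *: (f (h *: v + x) - f x)) @ 0^' --> dot g v.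
  by apply: DeriveDef; [apply/cvg_ex; exists (dot g v)|exact: cvg_lim].
apply/cvgrPdist_le => e e0.
have v0 : 0 < 1 + enorm v by rewrite ltr_pwDl// enorm_ge0.
have := H _ (divr_gt0 e0 v0) => /near_pair_at/(near_line v)/= Hn.
near=> h.
have h0 : h != 0 by near: h; exact: nbhs_dnbhs_neq.
have : `|f (h *: v + x) - f x - dot g (h *: v + x - x)| <=
    e / (1 + enorm v) * enorm (h *: v + x - x).
  near: h; exact: (nbhs_dnbhs Hn).
rewrite addrK dotZr enormZ => le1.
have -> : dot g v - h^-1 *: (f (h *: v + x) - f x) =
    - (h^-1 * (f (h *: v + x) - f x - h * dot g v)).
  by rewrite -[h^-1 *: _]/(h^-1 * _) [in RHS]mulrBr mulrA mulVf// mul1r opprB.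
rewrite normrN normrM normfV ler_pdivrMl ?normr_gt0// [leRHS]mulrC.
apply: le_trans le1 _; rewrite -!mulrA ler_pM2l//.
by rewrite ler_pdivrMl// [leLHS]mulrC ler_wpM2r// lerDr.
Unshelve. all: by end_near. Qed.

Lemma vdiff_coord f x A j : vdiff f x A ->
  sdiff (fun z => f z 0 j) x (\row_i A i j).
Proof.
move=> H e /H; apply: filterS => p; apply: le_trans.
apply: le_trans (le_trans (coord_le_norm _ j) (norm_le_enorm _)).
rewrite le_eqVlt; apply/orP; left; apply/eqP; rewrite !mxE; congr (`|_ - _|).
by apply: eq_bigr => i _; rewrite !mxE mulrC.
Qed.

Lemma coord_vdiff (f : 'rV[R]_n -> 'rV[R]_n) x (A : 'M[R]_n) :
  (forall j, sdiff (fun z => f z 0 j) x (\row_i A i j)) -> vdiff f x A.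
Proof.
move=> H e e0.
have e1 : 0 < e / n.+1%:R by rewrite divr_gt0.
have : \forall p \near (x, x), forall j, `|f p.1 0 j - f p.2 0 j -
    dot (\row_i A i j) (p.1 - p.2)| <= e / n.+1%:R * enorm (p.1 - p.2).
  apply: (@filter_forall _ _ _ (nbhs (x, x)) (nbhs_filter _)) => j.
  exact: H.
apply: filterS => p Hp; apply: le_trans (enorm_le_sum _) _.
apply: (@le_trans _ _ (\sum_(j < n) e / n.+1%:R * enorm (p.1 - p.2))).
  apply: ler_sum => j _; apply: le_trans (Hp j).
  rewrite le_eqVlt; apply/orP; left; apply/eqP; rewrite !mxE; congr (`|_ - _|).
  by apply: eq_bigr => i _; rewrite !mxE mulrC.
rewrite sumr_const card_ord -[leLHS]mulr_natl mulrA ler_wpM2r ?enorm_ge0//.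
by rewrite mulrCA ler_piMr ?(ltW e0)// ler_pdivrMr// mul1r ler_nat.
Qed.

Lemma vdiff_is_derive f x A v : vdiff f x A -> is_derive x v f (v *m A).
Proof.
move=> H.
suff Hc : (fun h => h^-1 *: (f (h *: v + x) - f x)) @ 0^' --> v *m A.
  by apply: DeriveDef; [apply/cvg_ex; exists (v *m A)|exact: cvg_lim].
apply/cvg_enorm => e e0.
have v0 : 0 < 1 + enorm v by rewrite ltr_pwDl// enorm_ge0.
have := H _ (divr_gt0 e0 v0) => /near_pair_at/(near_line v)/= Hn.
near=> h.
have h0 : h != 0 by near: h; exact: nbhs_dnbhs_neq.
have : enorm (f (h *: v + x) - f x - (h *: v + x - x) *m A) <=
    e / (1 + enorm v) * enorm (h *: v + x - x).
  near: h; exact: (nbhs_dnbhs Hn).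
rewrite addrK enormZ -scalemxAl => le1.
have -> : h^-1 *: (f (h *: v + x) - f x) - v *m A =
    h^-1 *: (f (h *: v + x) - f x - h *: (v *m A)).
  by rewrite [in RHS]scalerBr scalerA mulVf// scale1r.
rewrite enormZ normfV ltr_pdivrMl ?normr_gt0// [ltRHS]mulrC.
apply: le_lt_trans le1 _; rewrite -!mulrA ltr_pM2l//.
by rewrite ltr_pdivrMl// [ltLHS]mulrC ltr_pM2r ?normr_gt0// ltrDr.
Unshelve. all: by end_near. Qed.

Lemma sdiff_derive f x g v : sdiff f x g -> 'D_v f x = dot g v.
Proof. by move=> /(sdiff_is_derive v) H; rewrite derive_val. Qed.

Lemma vdiff_derive f x A v : vdiff f x A -> 'D_v f x = v *m A.
Proof. by move=> /(vdiff_is_derive v) H; rewrite derive_val. Qed.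

End StrictDifferentiability.

(** * Mean value theorems; continuous partial derivatives give strict derivatives *)

Section MeanValue.
Context {R : realType} {n : nat}.
Implicit Types (x y z u v w : 'rV[R]_n) (M : 'M[R]_n).

Lemma is_derive_line (f : 'rV[R]_n -> R) x v (t d : R) :
  is_derive (t *: v + x) v f d -> is_derive t 1 (fun s : R => f (s *: v + x)) d.
Proof.
move=> [H1 H2].
have E : (fun h : R => h^-1 *: (((fun s : R => f (s *: v + x)) \o shift t) (h *: 1)
    - f (t *: v + x))) =
  (fun h : R => h^-1 *: ((f \o shift (t *: v + x)) (h *: v) - f (t *: v + x))).
  apply/funext => h /=; congr (_ *: (f _ - _)).
  by rewrite scalerDl [h *: 1]mulr1 addrA.
by apply: DeriveDef; [rewrite /derivable E|rewrite /derive E].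
Qed.

(** One form for both signs of a; callers only have to control |t|. *)
Lemma MVT_abs (F dF : R -> R) (a : R) :
  (forall t : R, `|t| <= `|a| -> is_derive t 1 F (dF t)) ->
  exists2 c, `|c| <= `|a| & F a - F 0 = dF c * a.
Proof.
move=> H.
have aux (lo hi : R) : lo <= hi -> (forall t, lo <= t <= hi -> `|t| <= `|a|) ->
    exists2 c, `|c| <= `|a| & F hi - F lo = dF c * (hi - lo).
  move=> lh Hlh; have [||c /[!in_itv]/= cin ->] := @MVT_segment _ F dF lo hi lh.
  - by move=> t /[!in_itv]/= /andP[lt th]; apply: H; apply: Hlh; rewrite !ltW.
  - apply: derivable_within_continuous => t /[!in_itv]/= tin.
    by have [] := H t (Hlh t tin).
  by exists c => //; exact: Hlh.
have [a0|a0] := leP 0 a.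
  have [t|c cin Ec] := aux 0 a a0; first by move=> /andP[? ?]; rewrite !ger0_norm.
  by exists c => //; rewrite Ec subr0.
have [t|c cin Ec] := aux a 0 (ltW a0).
  by move=> /andP[? ?]; rewrite !ler0_norm ?lerN2 ?(ltW a0).
by exists c => //; rewrite -opprB Ec; ring.
Qed.

Lemma segment_MVT (f : 'rV[R]_n -> R) (g : 'rV[R]_n -> 'rV[R]_n) x v :
  (forall t : R, 0 <= t <= 1 -> sdiff f (x + t *: v) (g (x + t *: v))) ->
  exists2 c : R, 0 <= c <= 1 & f (x + v) - f x = dot (g (x + c *: v)) v.
Proof.
move=> H.
have K (t : R) : 0 <= t <= 1 ->
    is_derive t 1 (fun s : R => f (s *: v + x)) (dot (g (x + t *: v)) v).
  by move=> t01; apply: is_derive_line; rewrite addrC; exact/sdiff_is_derive/H.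
have [||c cin] := @MVT_segment _ (fun s : R => f (s *: v + x))
  (fun t => dot (g (x + t *: v)) v) 0 1 ler01.
- by move=> t /[!in_itv]/= /andP[? ?]; apply: K; rewrite !ltW.
- apply: derivable_within_continuous => t /[!in_itv]/= tin.
  by have [] := K t tin.
rewrite in_itv /= in cin.
move=> Ec; exists c => //; move: Ec.
by rewrite /= subr0 mulr1 scale1r scale0r add0r (addrC v).
Qed.

(** From w to z one coordinate changes at a time. Each increment is a mean value of one partial
    derivative, which near x differs from its value at x by at most e / (n + 1). *)
Lemma C1_sdiff (f : 'rV[R]_n -> R) x :
  (forall i, \forall z \near x, derivable f z (ebase i)) ->
  (forall i, {for x, continuous (fun z => 'D_(ebase i) f z)}) ->
  sdiff f x (\row_i 'D_(ebase i) f x).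
Proof.
move=> Hd Hc e e0.
have e1 : 0 < e / n.+1%:R by rewrite divr_gt0.
have : \forall z \near x, forall i, derivable f z (ebase i) /\
    `|'D_(ebase i) f z - 'D_(ebase i) f x| <= e / n.+1%:R.
  apply: (@filter_forall _ _ _ (nbhs x) (nbhs_filter _)) => i.
  apply: filterI; first exact: Hd.
  have /(@cvgrPdist_le _ _ _ (nbhs x))/(_ _ e1) := Hc i.
  by apply: filterS => z; rewrite distrC.
move=> /nbhs_enormP[r r0 Hr]; apply/near_pairP.
(* With this radius rho, the intermediate points are within n rho of x and one further coordinate
   step is shorter than 2 rho, so everything stays within r. *)
exists (r / (n.+1%:R + 2)); first by rewrite divr_gt0// addr_gt0.
move=> z w zx wx /=.
pose s k : 'rV[R]_n := \row_i (if (i < k)%N then z 0 i else w 0 i).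
have s0 : s 0%N = w by apply/rowP => i; rewrite mxE.
have sn : s n = z by apply/rowP => i; rewrite mxE ltn_ord.
pose a (k : 'I_n) := z 0 k - w 0 k.
have aE k : a k = (z - w) 0 k by rewrite !mxE.
have ale k : `|a k| <= enorm (z - w).
  by rewrite aE; exact: le_trans (coord_le_norm _ _) (norm_le_enorm _).
have sS (k : 'I_n) : s k.+1 = a k *: ebase k + s k.
  apply/rowP => i; rewrite !mxE eqxx /= ltnS leq_eqVlt (inj_eq val_inj).
  have [->|ik] /= := eqVneq i k; first by rewrite ltnn mulr1 subrK.
  by rewrite mulr0 add0r.
have zw : enorm (z - w) < 2 * (r / (n.+1%:R + 2)).
  apply: le_lt_trans (enorm_triangle _ x _) _.
  by rewrite mulr2n mulrDl mul1r (enormC x) ltrD.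
have sx k : enorm (s k - x) <= n%:R * (r / (n.+1%:R + 2)).
  apply: le_trans (enorm_le_sum _) _.
  have -> : n%:R * (r / (n.+1%:R + 2)) = \sum_(i < n) (r / (n.+1%:R + 2)).
    by rewrite sumr_const card_ord mulr_natl.
  apply: ler_sum => i _; rewrite !mxE.
  have C y : enorm (y - x) < r / (n.+1%:R + 2) -> `|y 0 i - x 0 i| <= r / (n.+1%:R + 2).
    move=> /ltW; apply: le_trans.
    have -> : y 0 i - x 0 i = (y - x) 0 i by rewrite !mxE.
    exact: le_trans (coord_le_norm _ _) (norm_le_enorm _).
  by case: ifP => _; exact: C.
have enebase (k : 'I_n) : enorm (ebase k : 'rV[R]_n) = 1.
  rewrite /enorm /dot (bigD1 k)//= !mxE !eqxx mulr1 big1 ?addr0 ?sqrtr1// => j jk.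
  by rewrite !mxE (negPf jk) andbF mulr0.
have step (k : 'I_n) : `|f (s k.+1) - f (s k) - 'D_(ebase k) f x * a k| <=
    e / n.+1%:R * enorm (z - w).
  have close (t : R) : `|t| <= `|a k| -> enorm (t *: ebase k + s k - x) < r.
    move=> ta; rewrite -addrA; apply: le_lt_trans (ler_enormD _ _) _.
    rewrite enormZ enebase mulr1.
    have -> : r = 2 * (r / (n.+1%:R + 2)) + (n.+1%:R * (r / (n.+1%:R + 2))).
      by rewrite -mulrDl [2 + _]addrC mulrCA mulfV ?mulr1// gt_eqF// addr_gt0.
    apply: ltr_leD; first exact: le_lt_trans (le_trans ta (ale k)) zw.
    apply: le_trans (sx k) _; rewrite ler_wpM2r ?ler_nat// divr_ge0// ?ltW//.
  have [|c ca] := @MVT_abs (fun t : R => f (t *: ebase k + s k))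
     (fun t => 'D_(ebase k) f (t *: ebase k + s k)) (a k).
    move=> t ta; apply: is_derive_line; apply: derivableP.
    by have [] := Hr _ (close t ta) k.
  rewrite scale0r add0r -sS => ->; rewrite -mulrBl normrM.
  by apply: ler_pM => //; have [] := Hr _ (close c ca) k.
have -> : f z - f w = \sum_(k < n) (f (s k.+1) - f (s k)).
  by rewrite -(big_mkord xpredT (fun k => f (s k.+1) - f (s k))) telescope_sumr// s0 sn.
have -> : dot (\row_i 'D_(ebase i) f x) (z - w) = \sum_(k < n) 'D_(ebase k) f x * a k.
  by apply: eq_bigr => i _; rewrite mxE aE.
rewrite -sumrB; apply: le_trans (ler_norm_sum _ _ _) _.
apply: (@le_trans _ _ (\sum_(j < n) e / n.+1%:R * enorm (z - w))).
  exact: ler_sum.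
rewrite sumr_const card_ord -[leLHS]mulr_natl mulrA ler_wpM2r ?enorm_ge0//.
by rewrite mulrCA ler_piMr ?(ltW e0)// ler_pdivrMr// mul1r ler_nat.
Qed.

End MeanValue.

(** * Product, sum and chain rules; differentiability of the unit normal *)

Section DiffRules.
Context {R : realType} {n : nat}.
Implicit Types (x y z u v w : 'rV[R]_n).

Lemma sdiffM (f h : 'rV[R]_n -> R) x gf gh : sdiff f x gf -> sdiff h x gh ->
  sdiff (fun z => f z * h z) x (f x *: gh + h x *: gf).
Proof.
move=> Hf Hh e e0.
(* K adds up the coefficients of the four error terms below; the bound d <= 1 gives |f| <= |f x| + 1
   and |h| <= |h x| + 1 near x. *)
pose K := `|f x| + `|h x| + 2 + enorm gf + enorm gh.
have K0 : 0 < K.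
  by rewrite /K; have := enorm_ge0 gf; have := enorm_ge0 gh;
     have := normr_ge0 (f x); have := normr_ge0 (h x); lra.
pose d := Order.min 1 (e / K).
have d0 : 0 < d by rewrite lt_min ltr01 divr_gt0.
have cf : \forall p \near (x, x), `|f p.1 - f x| <= d /\ `|f p.2 - f x| <= d.
  apply: (@near_pair _ _ x (fun z => `|f z - f x| <= d)).
  have /(@cvgrPdist_le _ _ _ (nbhs x))/(_ _ d0) := sdiff_continuous Hf.
  by apply: filterS => z; rewrite distrC.
have ch : \forall p \near (x, x), `|h p.1 - h x| <= d /\ `|h p.2 - h x| <= d.
  apply: (@near_pair _ _ x (fun z => `|h z - h x| <= d)).
  have /(@cvgrPdist_le _ _ _ (nbhs x))/(_ _ d0) := sdiff_continuous Hh.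
  by apply: filterS => z; rewrite distrC.
apply: filterS2 (filterI cf ch) (filterI (Hf d d0) (Hh d d0)).
move=> p [[f1 f2] [h1 h2]] [ef eh].
have -> : f p.1 * h p.1 - f p.2 * h p.2 - dot (f x *: gh + h x *: gf) (p.1 - p.2) =
   f p.1 * (h p.1 - h p.2 - dot gh (p.1 - p.2)) + (f p.1 - f x) * dot gh (p.1 - p.2)
   + h p.2 * (f p.1 - f p.2 - dot gf (p.1 - p.2)) + (h p.2 - h x) * dot gf (p.1 - p.2).
  by rewrite dotDl !dotZl; ring.
have D := enorm_ge0 (p.1 - p.2).
have fx1 : `|f p.1| <= `|f x| + 1.
  rewrite -[f p.1](subrK (f x)) addrC; apply: le_trans (ler_normD _ _) _.
  by rewrite lerD2l; apply: le_trans f1 _; rewrite ge_min lexx.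
have hx1 : `|h p.2| <= `|h x| + 1.
  rewrite -[h p.2](subrK (h x)) addrC; apply: le_trans (ler_normD _ _) _.
  by rewrite lerD2l; apply: le_trans h2 _; rewrite ge_min lexx.
apply: (@le_trans _ _ ((`|f x| + 1) * (d * enorm (p.1 - p.2)) +
   d * (enorm gh * enorm (p.1 - p.2)) + (`|h x| + 1) * (d * enorm (p.1 - p.2)) +
   d * (enorm gf * enorm (p.1 - p.2)))).
  have M (a b c c' : R) : `|a| <= c -> `|b| <= c' -> `|a * b| <= c * c'.
    by move=> ? ?; rewrite normrM; exact: ler_pM.
  apply: le_trans (ler_normD _ _) _; apply: lerD; last exact: M (norm_dot_le _ _).
  apply: le_trans (ler_normD _ _) _; apply: lerD; last exact: M.
  apply: le_trans (ler_normD _ _) _; apply: lerD; last exact: M (norm_dot_le _ _).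
  exact: M.
have -> : (`|f x| + 1) * (d * enorm (p.1 - p.2)) +
   d * (enorm gh * enorm (p.1 - p.2)) + (`|h x| + 1) * (d * enorm (p.1 - p.2)) +
   d * (enorm gf * enorm (p.1 - p.2)) = d * K * enorm (p.1 - p.2).
  by rewrite /K; ring.
rewrite ler_wpM2r// -ler_pdivlMr//.
by rewrite /d ge_min lexx orbT.
Qed.

Lemma sdiff_sum (I : Type) (r : seq I) (f : I -> 'rV[R]_n -> R) x (g : I -> 'rV[R]_n) :
  (forall i, sdiff (f i) x (g i)) ->
  sdiff (fun z => \sum_(i <- r) f i z) x (\sum_(i <- r) g i).
Proof.
move=> H; elim: r => [|i r IH] e e0.
  near=> p; rewrite !big_nil dot0l !subr0 normr0.
  by rewrite mulr_ge0 ?enorm_ge0 ?(ltW e0).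
have e2 : 0 < e / 2 by rewrite divr_gt0.
apply: filterS2 (H i _ e2) (IH _ e2) => p H1 H2.
rewrite !big_cons dotDl [X in _ <= X * _](splitr e) mulrDl.
apply: le_trans (lerD H1 H2); apply: le_trans (ler_normD _ _).
by rewrite le_eqVlt; apply/orP; left; apply/eqP; congr (`|_|); ring.
Unshelve. all: by end_near. Qed.

Lemma sdiff_comp (Phi dPhi : R -> R) (f : 'rV[R]_n -> R) x g :
  (\forall t \near f x, is_derive (t : R) 1 Phi (dPhi t)) ->
  {for f x, continuous dPhi} -> sdiff f x g ->
  sdiff (fun z => Phi (f z)) x (dPhi (f x) *: g).
Proof.
move=> HP cP Hf e e0.
pose K := 2 + enorm g + `|dPhi (f x)|.
have K0 : 0 < K.
  by rewrite /K; have := enorm_ge0 g; have := normr_ge0 (dPhi (f x)); lra.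
have d0 : 0 < e / K by rewrite divr_gt0.
have [r r0 Hr] : exists2 r, 0 < r & forall t, `|t - f x| < r ->
    is_derive t 1 Phi (dPhi t) /\ `|dPhi t - dPhi (f x)| <= e / K.
  have /(@cvgrPdist_le _ _ _ (nbhs (f x)))/(_ _ d0) cP' := cP.
  have /nbhs_ballP[r/= r0 Hr] : nbhs (f x) [set t | is_derive (t : R) 1 Phi (dPhi t) /\
      `|dPhi (f x) - dPhi t| <= e / K] by exact: filterI HP cP'.
  exists r => // t tr; have tr' : `|f x - t| < r by rewrite distrC.
  by have [? ?] := Hr t tr'; split => //; rewrite distrC.
(* If both values are within r / 3 of f x, their difference is below 2 r / 3 and the intermediate
   point of the mean value theorem stays within r. *)
have r3 : 0 < r / 3 by rewrite divr_gt0.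
have cf : \forall p \near (x, x), `|f p.1 - f x| < r / 3 /\ `|f p.2 - f x| < r / 3.
  apply: (@near_pair _ _ x (fun z => `|f z - f x| < r / 3)).
  have /(@cvgrPdist_lt _ _ _ (nbhs x))/(_ _ r3) := sdiff_continuous Hf.
  by apply: filterS => z; rewrite distrC.
apply: filterS2 (filterI cf (sdiff_lip Hf)) (Hf _ d0).
move=> p [[f1 f2] lip] ef.
have T t : `|t| <= `|f p.1 - f p.2| -> `|t + f p.2 - f x| < r.
  move=> ta; rewrite -addrA; apply: le_lt_trans (ler_normD _ _) _.
  have : `|f p.1 - f p.2| < r / 3 + r / 3.
    rewrite -[_ - _](subrKA (f x)); apply: le_lt_trans (ler_normD _ _) _.
    by rewrite ltrD// distrC.
  lra.
have [|c ca Ec] := @MVT_abs R (fun t => Phi (t + f p.2)) (fun t => dPhi (t + f p.2))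
    (f p.1 - f p.2).
  move=> t /T{}T.
  have [D _] := Hr _ T; have [D1 D2] := D.
  have E : (fun h : R => h^-1 *: (((fun t : R => Phi (t + f p.2)) \o shift t) (h *: 1)
    - Phi (t + f p.2))) =
    (fun h : R => h^-1 *: ((Phi \o shift (t + f p.2)) (h *: 1) - Phi (t + f p.2))).
    by apply/funext => h /=; rewrite addrA.
  by apply: DeriveDef; [rewrite /derivable E|rewrite /derive E].
move: Ec; rewrite /= add0r subrK => ->.
have [_ dc] := Hr _ (T _ ca).
have -> : dPhi (c + f p.2) * (f p.1 - f p.2) - dot (dPhi (f x) *: g) (p.1 - p.2) =
  (dPhi (c + f p.2) - dPhi (f x)) * (f p.1 - f p.2) +
  dPhi (f x) * (f p.1 - f p.2 - dot g (p.1 - p.2)) by rewrite dotZl; ring.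
apply: le_trans (ler_normD _ _) _; rewrite !normrM.
have D := enorm_ge0 (p.1 - p.2).
apply: (@le_trans _ _ (e / K * ((1 + enorm g) * enorm (p.1 - p.2)) +
   `|dPhi (f x)| * (e / K * enorm (p.1 - p.2)))).
  apply: lerD; last by rewrite ler_wpM2l.
  exact: ler_pM.
have -> : e / K * ((1 + enorm g) * enorm (p.1 - p.2)) +
   `|dPhi (f x)| * (e / K * enorm (p.1 - p.2)) = e / K * (K - 1) * enorm (p.1 - p.2).
  by rewrite /K; ring.
rewrite ler_wpM2r// mulrAC ler_pdivrMr// ler_pM2l//; lra.
Qed.

Lemma coord_vdiff_ex (f : 'rV[R]_n -> 'rV[R]_n) x :
  (forall j, exists g, sdiff (fun z => f z 0 j) x g) -> exists A, vdiff f x A.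
Proof.
move=> H; pose G j := projT1 (cid (H j)).
exists (\matrix_(i, j) G j 0 i); apply: coord_vdiff => j.
have -> : \row_i (\matrix_(i, j) G j 0 i) i j = G j.
  by apply/rowP => i; rewrite !mxE.
by rewrite /G; case: (cid (H j)).
Qed.

(** Each coordinate is [Phi] of the squared norm of g times a coordinate of g, with Phi(t) = - 1 /
    sqrt t smooth near the positive number |g x|^2. Applied to a gradient, this makes [inner_normal]
    C^1. *)
Lemma vdiff_normalize (g : 'rV[R]_n -> 'rV[R]_n) x A : g x != 0 -> vdiff g x A ->
  exists B, vdiff (fun z => - (enorm (g z))^-1 *: g z) x B.
Proof.
move=> gx0 Hg; apply: coord_vdiff_ex => j.
pose q z := dot (g z) (g z).
have [G HG] : exists G, sdiff q x G.
  eexists; rewrite /q /dot; apply: sdiff_sum => i; apply: sdiffM; exact: vdiff_coord Hg.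
have q0 : 0 < q x by rewrite /q -sqr_enorm exprn_gt0// enorm_gt0.
pose Phi (t : R) := - (Num.sqrt t)^-1.
have [dPhi [HP cP]] : exists dPhi : R -> R,
    (\forall t \near q x, is_derive (t : R) 1 Phi (dPhi t)) /\ {for q x, continuous dPhi}.
  exists (fun t => - (- (Num.sqrt t) ^- 2 * (2 * Num.sqrt t)^-1)); split.
    near=> t.
    have t0 : 0 < t by near: t; exact: lt_nbhsr.
    have st0 : Num.sqrt t != 0 by rewrite gt_eqF// sqrtr_gt0.
    apply: is_deriveN; apply: is_deriveV => //; exact: is_derive1_sqrt.
  have cs : {for q x, continuous (@Num.sqrt R)} by exact: sqrt_continuous.
  have s0 : Num.sqrt (q x) != 0 by rewrite gt_eqF// sqrtr_gt0.
  apply: cvgN; apply: cvgM.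
    apply: cvgN; apply: cvgV; first by rewrite expf_neq0.
    exact: (@cvgM _ _ _ _ (@Num.sqrt R) (@Num.sqrt R)).
  apply: cvgV; first by rewrite mulf_neq0// pnatr_eq0.
  by apply: cvgM => //; exact: cvg_cst.
eexists; have -> : (fun z => (- (enorm (g z))^-1 *: g z) 0 j) =
    (fun z => Phi (q z) * g z 0 j).
  by apply/funext => z; rewrite !mxE mulNr.
apply: sdiffM; last exact: vdiff_coord Hg.
exact: sdiff_comp HP cP HG.
Unshelve. all: by end_near. Qed.

End DiffRules.

(** * Second-order Taylor expansion and symmetry of the Hessian *)

Section SecondOrder.
Context {R : realType} {n : nat}.
Implicit Types (x y z u v w : 'rV[R]_n).

(** By strictness at x, [A x] approximates the increments of f based at a nearby z; so does [A z].
    Comparing the two on h v for a small h bounds their difference. *)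
Lemma vdiff_derivative_continuous (f : 'rV[R]_n -> 'rV[R]_n) A x :
  (\forall z \near x, vdiff f z (A z)) -> forall e, 0 < e ->
  \forall z \near x, forall v, enorm (v *m A z - v *m A x) <= e * enorm v.
Proof.
move=> HA e e0; have Ax := nbhs_singleton HA.
have e2 : 0 < e / 2 by rewrite divr_gt0.
have /near_pairP[r r0 Hr] := Ax _ e2.
have Hr' : \forall z \near x, enorm (z - x) < r by exact: enorm_near.
apply: filterS2 HA Hr' => z Az zr v.
have /near_pairP[s s0 Hs] := Az _ e2.
have nz : \forall y \near z, enorm (y - x) < r /\ enorm (y - z) < s.
  apply: filterI; last exact: enorm_near.
  apply/nbhs_enormP; exists (r - enorm (z - x)); first by rewrite subr_gt0.
  move=> y yz; apply: le_lt_trans (enorm_triangle _ z _) _; lra.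
have /nbhs_dnbhs nh := near_line v nz.
near (0 : R)^' => h.
have h0 : h != 0 by near: h; exact: nbhs_dnbhs_neq.
have [hr hs] : enorm (h *: v + z - x) < r /\ enorm (h *: v + z - z) < s.
  by near: h; exact: nh.
have H1 := Hr _ _ hr zr.
have H2 := Hs _ z hs; rewrite subrr enorm0 in H2; have {}H2 := H2 s0.
move: H1 H2; rewrite /= addrK -!scalemxAl enormZ => H1 H2.
have : enorm (h *: (v *m A z - v *m A x)) <= e * (`|h| * enorm v).
  have -> : h *: (v *m A z - v *m A x) =
    (f (h *: v + z) - f z - h *: (v *m A x)) - (f (h *: v + z) - f z - h *: (v *m A z)).
    by rewrite scalerBr opprB [RHS]addrC subrKA.
  apply: le_trans (ler_enormB _ _) _; rewrite [X in _ <= X * _](splitr e) mulrDl.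
  exact: lerD.
by rewrite enormZ mulrCA ler_pM2l// normr_gt0.
Unshelve. all: by end_near. Qed.

Lemma is_derive_parabola (a b t : R) :
  is_derive t 1 (fun s : R => s * a + s * s * b) (a + 2 * t * b).
Proof.
have -> : (fun s : R => s * a + s * s * b) = id * cst a + id * id * cst b by apply/funext.
have I := is_derive_id t (1 : R).
have C c := @is_derive_cst R R R c t 1.
have M := is_deriveM (is_deriveM I I) (C b).
have -> : a + 2 * t * b = (t *: 0 + a *: 1) + (t * t *: 0 + b *: (t *: 1 + t *: 1)).
  by rewrite !scaler0 !add0r -![_ *: _]/(_ * _); ring.
exact: (is_deriveD (is_deriveM I (C a)) M).
Qed.

(** The mean value theorem is applied along the segment to f minus its quadratic Taylor polynomial,
    whose derivative is the first-order error of g. *)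
Lemma sdiff_taylor2 (f : 'rV[R]_n -> R) g H x :
  (\forall z \near x, sdiff f z (g z)) -> vdiff g x H -> forall e, 0 < e ->
  \forall z \near x, `|f z - f x - dot (g x) (z - x) -
     dot ((z - x) *m H) (z - x) / 2| <= e * enorm (z - x) ^+ 2.
Proof.
move=> Hf Hg e e0.
have /nbhs_enormP[r r0 Hr] : \forall z \near x, sdiff f z (g z) /\
    enorm (g z - g x - (z - x) *m H) <= e * enorm (z - x).
  by apply: filterI => //; exact: near_pair_at (Hg e e0).
apply/nbhs_enormP; exists r => // z zr.
set v := z - x.
have close t : `|t| <= `|1 : R| -> enorm (t *: v + x - x) < r.
  rewrite normr1 => t1; rewrite addrK enormZ; apply: le_lt_trans zr.
  by rewrite ler_piMl ?enorm_ge0.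
have [|c c1] := @MVT_abs R (fun t => f (t *: v + x) - (t * dot (g x) v +
    t * t * (dot (v *m H) v / 2)))
  (fun t => dot (g (t *: v + x)) v - (dot (g x) v + 2 * t * (dot (v *m H) v / 2))) 1.
  move=> t /close/Hr[Hd _]; apply: is_deriveB.
    by apply: is_derive_line; exact: sdiff_is_derive.
  exact: is_derive_parabola.
rewrite /= scale0r add0r !mul0r addr0 subr0 scale1r !mul1r mulr1 subrK => E.
have -> : f z - f x - dot (g x) v - dot (v *m H) v / 2 =
    dot (g (c *: v + x) - g x - c *: (v *m H)) v.
  by rewrite !dotBl dotZl; move: E; lra.
apply: le_trans (norm_dot_le _ _) _; rewrite expr2 mulrA ler_wpM2r ?enorm_ge0//.
have [_] := Hr _ (close _ c1); rewrite /= addrK -scalemxAl => /le_trans; apply.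
rewrite enormZ ler_pM2l// ler_piMl ?enorm_ge0//.
by rewrite normr1 in c1.
Qed.

(** The second difference of f over the parallelogram with sides s u and s v, evaluated in either
    order by the mean value theorem, is s^2 times either side of the equality, up to a small
    multiple of s^2. *)
Lemma hessian_symmetric (f : 'rV[R]_n -> R) g H x :
  (\forall z \near x, sdiff f z (g z)) -> vdiff g x H ->
  forall u v, dot (u *m H) v = dot (v *m H) u.
Proof.
move=> Hf Hg.
suff le u v e : 0 < e -> `|dot (u *m H) v - dot (v *m H) u| <= e.
  move=> u v; apply/eqP; rewrite -subr_eq0 -normr_le0.
  by apply/ler_addgt0Pr => e e0; rewrite add0r; exact: le.
move=> e0.
pose K := 1 + 2 * enorm u * enorm v.
have K0 : 0 < K.
  by rewrite /K; have := mulr_ge0 (enorm_ge0 u) (enorm_ge0 v); lra.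
have eK : 0 < e / K by rewrite divr_gt0.
have /nbhs_enormP[r1 r10 Hr1] := Hf; have /near_pairP[r2 r20 Hr2] := Hg _ eK.
pose r := Order.min r1 r2.
have r0 : 0 < r by rewrite lt_min r10.
pose s := r / (1 + enorm u + enorm v).
have uv0 : 0 < 1 + enorm u + enorm v.
  by have := enorm_ge0 u; have := enorm_ge0 v; lra.
have s0 : 0 < s by rewrite divr_gt0.
have close (a b : R) : `|a| <= 1 -> `|b| <= 1 ->
    enorm (a *: (s *: u) + (x + b *: (s *: v)) - x) < r.
  move=> a1 b1.
  rewrite addrA addrAC addrK; apply: le_lt_trans (ler_enormD _ _) _.
  rewrite !enormZ !(ger0_norm (ltW s0)).
  apply: (@le_lt_trans _ _ (s * enorm u + s * enorm v)).
    by apply: lerD; rewrite ler_piMl// mulr_ge0 ?enorm_ge0 ?(ltW s0).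
  rewrite -mulrDr /s mulrAC ltr_pdivrMr// ltr_pM2l//.
  by rewrite -addrA ltrDr.
have Q (w w' : 'rV[R]_n) :
    (forall a b : R, `|a| <= 1 -> `|b| <= 1 ->
      enorm (a *: (s *: w) + (x + b *: (s *: w')) - x) < r) ->
    `|f (s *: w + (x + s *: w')) - f (s *: w + x) - f (x + s *: w') + f x -
      s ^+ 2 * dot (w' *m H) w| <= e / K * s ^+ 2 * (enorm w * enorm w').
  move=> cl.
  have n1 : `|1 : R| <= 1 by rewrite normr1.
  have n0 : `|0 : R| <= 1 by rewrite normr0.
  have cl1 a : `|a| <= 1 -> enorm (a *: (s *: w) + (x + s *: w') - x) < r.
    by move=> a1; have := cl a 1 a1 n1; rewrite scale1r.
  have cl0 a : `|a| <= 1 -> enorm (a *: (s *: w) + x - x) < r.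
    by move=> a1; have := cl a 0 a1 n0; rewrite scale0r addr0.
  have rr1 y : enorm (y - x) < r -> enorm (y - x) < r1.
    by move=> /lt_le_trans; apply; rewrite ge_min lexx.
  have rr2 y : enorm (y - x) < r -> enorm (y - x) < r2.
    by move=> /lt_le_trans; apply; rewrite ge_min lexx orbT.
  pose F (a : R) := f (a *: (s *: w) + (x + s *: w')) - f (a *: (s *: w) + x).
  have [|c] := @MVT_abs R F (fun a => dot (g (a *: (s *: w) + (x + s *: w'))) (s *: w)
     - dot (g (a *: (s *: w) + x)) (s *: w)) 1.
    move=> t; rewrite normr1 => t1; apply: is_deriveB; apply: is_derive_line;
      apply: sdiff_is_derive; apply: Hr1; apply: rr1; [exact: cl1|exact: cl0].
  rewrite normr1 => c1.
  rewrite /F !scale1r !scale0r !add0r mulr1 -dotBl => E.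
  have -> : f (s *: w + (x + s *: w')) - f (s *: w + x) - f (x + s *: w') + f x -
      s ^+ 2 * dot (w' *m H) w =
     dot (g (c *: (s *: w) + (x + s *: w')) - g (c *: (s *: w) + x) - (s *: w') *m H)
        (s *: w).
    by rewrite [RHS]dotBl -E -scalemxAl dotZl dotZr; ring.
  apply: le_trans (norm_dot_le _ _) _.
  have := Hr2 _ _ (rr2 _ (cl1 c c1)) (rr2 _ (cl0 c c1)); rewrite [fst _]/= [snd _]/=.
  have -> : c *: (s *: w) + (x + s *: w') - (c *: (s *: w) + x) = s *: w'.
    by rewrite opprD addrACA subrr add0r addrAC subrr add0r.
  move=> /= H2.
  rewrite [enorm (s *: w)]enormZ (ger0_norm (ltW s0)).
  apply: (@le_trans _ _ (e / K * enorm (s *: w') * (s * enorm w))).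
    by rewrite ler_wpM2r// mulr_ge0 ?enorm_ge0 ?(ltW s0).
  by rewrite enormZ (ger0_norm (ltW s0)) le_eqVlt; apply/orP; left; apply/eqP; ring.
have Quv := Q u v close.
have Qvu : `|f (s *: u + (x + s *: v)) - f (s *: u + x) - f (x + s *: v) + f x -
      s ^+ 2 * dot (u *m H) v| <= e / K * s ^+ 2 * (enorm u * enorm v).
  have E (y y' : 'rV[R]_n) : y' + (x + y) = y + (x + y').
    by rewrite addrCA [RHS]addrCA (addrC y).
  have cl a b : `|a| <= 1 -> `|b| <= 1 -> enorm (a *: (s *: v) + (x + b *: (s *: u)) - x) < r.
    by move=> a1 b1; rewrite E; exact: close.
  have := Q v u cl; rewrite (mulrC (enorm v)) E (addrC (s *: v) x) (addrC x (s *: u)).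
  by rewrite (addrAC (f _) (- f (x + s *: v))).
have s2 : 0 < s ^+ 2 by rewrite exprn_gt0.
rewrite -(ler_pM2l s2).
have -> : s ^+ 2 * `|dot (u *m H) v - dot (v *m H) u| =
   `|s ^+ 2 * dot (u *m H) v - s ^+ 2 * dot (v *m H) u|.
  by rewrite -mulrBr normrM (ger0_norm (ltW s2)).
set X := (X in `|X - s ^+ 2 * dot (u *m H) v|) in Qvu.
rewrite -/X in Quv.
apply: (@le_trans _ _ (2 * (e / K * s ^+ 2 * (enorm u * enorm v)))).
  rewrite (_ : _ - _ = (X - s ^+ 2 * dot (v *m H) u) - (X - s ^+ 2 * dot (u *m H) v)).
    by apply: le_trans (ler_normB _ _) _; rewrite mulr2n mulrDl mul1r lerD.
  ring.
have -> : 2 * (e / K * s ^+ 2 * (enorm u * enorm v)) =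
   s ^+ 2 * (e / K * (2 * enorm u * enorm v)) by ring.
rewrite ler_pM2l// mulrAC ler_pdivrMr// ler_pM2l// /K; lra.
Qed.

End SecondOrder.

(** * Passage between [class_C 2] and strict derivatives *)

Section ClassC.
Context {R : realType} {n : nat}.
Implicit Types (f : 'rV[R]_n -> R) (x y z u v w : 'rV[R]_n) (U : set 'rV[R]_n).

Lemma near_eq_continuous (T S : topologicalType) (f g : T -> S) (x : T) :
  (\forall z \near x, f z = g z) -> {for x, continuous g} -> {for x, continuous f}.
Proof.
move=> fg cg; rewrite /prop_for /continuous_at (nbhs_singleton fg).
by apply: cvg_trans cg; apply: near_eq_cvg; apply: filterS fg => z ->.
Qed.

Lemma class_C_le (j k : nat) U f : (j <= k)%N -> class_C k U f -> class_C j U f.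
Proof.
move=> jk H s sj x Ux; have [c d] := H s (leq_trans sj jk) x Ux.
by split=> // sj' i; apply: d; exact: leq_trans sj' jk.
Qed.

Lemma class_C2_diff f U : open U -> class_C 2 U f -> forall x, U x ->
  sdiff f x (grad f x) /\ vdiff (grad f) x (hessian f x).
Proof.
move=> oU H x Ux.
have nU : \forall z \near x, U z by exact: open_nbhs_nbhs.
split.
  have -> : grad f x = \row_i 'D_(ebase i) f x by apply/rowP => i; rewrite !mxE.
  apply: C1_sdiff => i; last by have [] := H [:: i] isT x Ux.
  by apply: filterS nU => z Uz; have [_] := H [::] isT z Uz; apply.
apply: coord_vdiff => j.
have -> : (fun z => grad f z 0 j) = partials [:: j] f.
  by apply/funext => z; rewrite mxE.
have -> : \row_i hessian f x i j = \row_i 'D_(ebase i) (partials [:: j] f) x.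
  by apply/rowP => i; rewrite !mxE.
apply: C1_sdiff => i; last by have [] := H [:: i; j] isT x Ux.
by apply: filterS nU => z Uz; have [_] := H [:: j] isT z Uz; apply.
Qed.

Lemma mx_coord_derivative_continuous (f : 'rV[R]_n -> 'rV[R]_n) A x i j :
  (\forall z \near x, vdiff f z (A z)) -> {for x, continuous (fun z => A z i j)}.
Proof.
move=> H; apply/(@cvgrPdist_le _ _ _ (nbhs x)) => e e0.
apply: filterS (vdiff_derivative_continuous H e0) => z /(_ (ebase i)).
have -> : enorm (ebase i : 'rV[R]_n) = 1.
  rewrite /enorm /dot (bigD1 i)//= !mxE !eqxx mulr1 big1 ?addr0 ?sqrtr1// => k ki.
  by rewrite !mxE (negPf ki) andbF mulr0.
rewrite mulr1 distrC -!rowE; apply: le_trans.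
have -> : A z i j - A x i j = (row i (A z) - row i (A x)) 0 j by rewrite !mxE.
exact: le_trans (coord_le_norm _ _) (norm_le_enorm _).
Qed.

Lemma dot_ebase u i : dot u (ebase i) = u 0 i.
Proof.
rewrite /dot (bigD1 i)//= mxE !eqxx mulr1 big1 ?addr0// => k ki.
by rewrite mxE (negPf ki) andbF mulr0.
Qed.

(** Converse of [class_C2_diff]: it returns results of the strict calculus in terms of [grad],
    [hessian] and [class_C]. *)
Lemma diff_class_C2 f g H U : open U ->
  (forall x, U x -> sdiff f x (g x) /\ vdiff g x (H x)) ->
  class_C 2 U f /\ forall x, U x -> grad f x = g x /\ hessian f x = H x.
Proof.
move=> oU HU.
have nU x : U x -> \forall z \near x, U z by move=> ?; exact: open_nbhs_nbhs.
have p1 i x : U x -> partials [:: i] f x = g x 0 i.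
  by move=> /HU[/sdiff_derive E _]; rewrite /= E dot_ebase.
have p1n i x : U x -> \forall z \near x, partials [:: i] f z = g z 0 i.
  by move=> /nU; apply: filterS => z; exact: p1.
have dg j x : U x -> sdiff (fun z => g z 0 j) x (\row_i H x i j).
  by move=> /HU[_ /vdiff_coord]; apply.
have p2 i j x : U x -> partials [:: i; j] f x = H x i j.
  move=> Ux; rewrite /= (near_eq_derive _ (p1n j x Ux)).
  by rewrite (sdiff_derive _ (dg j x Ux)) dot_ebase mxE.
split.
  move=> [|i [|j [|]]]//= _ x Ux.
  - split; first by have [/sdiff_continuous] := HU x Ux.
    by move=> _ i; have [/sdiff_is_derive -/(_ (ebase i)) []] := HU x Ux.
  - split; first by apply: near_eq_continuous (p1n i x Ux) _; exact: sdiff_continuous (dg i x Ux).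
    move=> _ j; apply: (near_eq_derivable (f := fun z => g z 0 i)).
      by apply: filterS (p1n i x Ux) => z /= ->.
    by have /(_ (ebase j)) [] := sdiff_is_derive _ (dg i x Ux).
  - split=> //; apply: (@near_eq_continuous _ _ _ (fun z => H z i j)).
      by apply: filterS (nU x Ux) => z; exact: p2.
    apply: (@mx_coord_derivative_continuous g).
    by apply: filterS (nU x Ux) => z /HU[].
move=> x Ux; split.
  by apply/rowP => i; rewrite mxE p1.
by apply/matrixP => i j; rewrite mxE p2.
Qed.

End ClassC.

(** * Distance to a set, nearest points and the normal direction at them *)

Section Distance.
Context {R : realType} {n : nat}.
Implicit Types (x y z u v w : 'rV[R]_n) (A D U : set 'rV[R]_n).

Lemma dist_to_le x y A : A y -> dist_to x A <= enorm (x - y).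
Proof.
move=> Ay; apply: ge_inf; last by exists y.
by exists 0 => _ [z _ <-]; exact: enorm_ge0.
Qed.

Lemma dist_to_ge x A c : A !=set0 -> (forall y, A y -> c <= enorm (x - y)) ->
  c <= dist_to x A.
Proof.
move=> [y Ay] H; apply: lb_le_inf; first by exists (enorm (x - y)); exists y.
by move=> _ [z Az <-]; exact: H.
Qed.

Lemma dist_to_ge0 x A : A !=set0 -> 0 <= dist_to x A.
Proof. by move=> A0; apply: dist_to_ge => // y _; exact: enorm_ge0. Qed.

Lemma dist_to_mem x A : A x -> dist_to x A = 0.
Proof.
move=> Ax; apply/eqP; rewrite eq_le dist_to_ge0 ?andbT; last by exists x.
by have := dist_to_le x Ax; rewrite subrr enorm0.
Qed.

Lemma dist_to_lip x z A : A !=set0 -> `|dist_to x A - dist_to z A| <= enorm (x - z).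
Proof.
move=> A0.
have H a b : dist_to a A - enorm (a - b) <= dist_to b A.
  apply: dist_to_ge => // y Ay; rewrite lerBlDl.
  exact: le_trans (dist_to_le a Ay) (enorm_triangle _ _ _).
have := H x z; have := H z x; rewrite (enormC z x) => *.
by rewrite ler_norml; apply/andP; split; lra.
Qed.

Lemma dist_to_continuous A : A !=set0 -> continuous (fun x => dist_to x A).
Proof.
move=> A0 x; apply/(@cvgrPdist_lt _ _ _ (nbhs x)) => e e0.
apply: filterS (enorm_near x e0) => z; apply: le_lt_trans.
by rewrite distrC; exact: dist_to_lip.
Qed.

Lemma closed_sublevel (f : 'rV[R]_n -> R) c : continuous f -> closed [set y | f y <= c].
Proof.
move=> cf; apply: (preimage_closed (f := f) (D := [set t | t <= c])); last exact: closed_le.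
by move=> y _; exact: cf.
Qed.

Lemma dist_to_attained x A : closed A -> A !=set0 ->
  exists2 y, A y & enorm (x - y) = dist_to x A.
Proof.
move=> cA [a Aa].
pose K := A `&` [set y | enorm (y - x) <= enorm (a - x)].
have cont : continuous (fun y : 'rV[R]_n => enorm (y - x)).
  move=> y; apply: (continuous_comp (f := fun y => y - x)); last exact: continuous_enorm.
  apply/(@cvg_enorm _ _ _ (nbhs y)) => e e0; apply: filterS (enorm_near y e0) => z.
  by rewrite opprB addrA subrK.
have cK : compact K.
  apply: bounded_closed_compact.
    apply/bounded_enormP; exists (enorm (a - x) + enorm x) => y [_ /= yx].
    by rewrite -[y](subrK x); apply: le_trans (ler_enormD _ _) _; rewrite lerD2r.
  apply: closedI => //.
  exact: closed_sublevel.
have [|y /[!inE] -[Ay _] Hy] :=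
  @EVT_min_rV R n (fun y => enorm (y - x)) K _ cK (continuous_subspaceT cont).
  by exists a; split => //=.
exists y => //; apply/eqP; rewrite eq_le dist_to_le// andbT.
apply: dist_to_ge; first by exists a.
move=> z Az; rewrite (enormC x) (enormC x).
have [zK|] := boolP (enorm (z - x) <= enorm (a - x)).
  by apply: Hy; rewrite inE.
rewrite -ltNge => /ltW; apply: le_trans.
by apply: Hy; rewrite inE; split => //=.
Qed.

(* A nearest point of the complement; meaningful only for proper open [D]. *)
Definition foot D x : 'rV[R]_n :=
  xget 0 [set y | ~ D y /\ enorm (x - y) = dist_to x (~` D)].

Lemma footP D x : open D -> ~` D !=set0 ->
  ~ D (foot D x) /\ enorm (x - foot D x) = dist_to x (~` D).
Proof.
move=> oD D0; apply: (xgetPex 0 (P := [set y | ~ D y /\ enorm (x - y) = dist_to x (~` D)])).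
by have [y Dy E] := dist_to_attained x (open_closedC oD) D0; exists y.
Qed.

Lemma dist_to_gt0 D x : open D -> ~` D !=set0 -> D x -> 0 < dist_to x (~` D).
Proof.
move=> oD D0 Dx; have [nDy <-] := footP x oD D0.
rewrite enorm_gt0 subr_eq0; apply/eqP => xy; apply: nDy; by rewrite -xy.
Qed.

Lemma dist_to_ball D x z : enorm (z - x) < dist_to x (~` D) -> D z.
Proof.
move=> H; apply: contrapT => nDz.
by have := dist_to_le x (nDz : (~` D) z); rewrite enormC leNgt H.
Qed.

(** The points y + t (x - y) with 0 < t <= 1 lie in the open ball about x of radius |x - y|, hence
    in D, and tend to y. *)
Lemma foot_bd D x y : open D -> D x -> ~ D y ->
  enorm (x - y) = dist_to x (~` D) -> bd D y.
Proof.
move=> oD Dx nDy E; split; last by move/interior_subset.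
have d0 : 0 < enorm (x - y).
  by rewrite enorm_gt0 subr_eq0; apply/eqP => xy; apply: nDy; rewrite -xy.
apply/closureP_enorm => e e0.
pose t := Order.min 1 (e / (2 * enorm (x - y))).
have t0 : 0 < t by rewrite lt_min ltr01 divr_gt0// mulr_gt0.
have t1 : t <= 1 by rewrite ge_min lexx.
exists (y + t *: (x - y)).
  apply: (@dist_to_ball D x); rewrite -E (enormC _ x) .
  have -> : x - (y + t *: (x - y)) = (1 - t) *: (x - y).
    by rewrite scalerBl scale1r opprD addrA.
  rewrite enormZ ger0_norm ?subr_ge0// gtr_pMl//; lra.
rewrite addrAC subrr add0r enormZ (ger0_norm (ltW t0)).
apply: (@le_lt_trans _ _ (e / (2 * enorm (x - y)) * enorm (x - y))).
  by rewrite ler_wpM2r ?enorm_ge0// /t ge_min lexx orbT.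
rewrite invfM mulrA divfK ?gt_eqF//; lra.
Qed.

(* The ball around [x] of radius [|x - y|] lies in [D], so [phi] is negative on
   it, and the first-order condition at [y] forces [g] to point away from [x]. *)
Lemma foot_normal D U phi g x y : open U -> U y ->
  (forall z, U z -> (D z <-> phi z < 0)) -> sdiff phi y g -> g != 0 -> D x -> ~ D y ->
  enorm (x - y) = dist_to x (~` D) ->
  x - y = enorm (x - y) *: (- (enorm g)^-1 *: g).
Proof.
move=> oU Uy HU Hphi g0 Dx nDy E.
have [a aE] : exists a, a = x - y by exists (x - y).
rewrite -aE in E *.
have a0 : 0 < enorm a.
  by rewrite enorm_gt0 aE subr_eq0; apply/eqP => xy; apply: nDy; rewrite -xy.
have phiy : 0 <= phi y by rewrite leNgt; apply/negP => /(HU _ Uy).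
(* A direction with v.a > 0 enters the ball about x, where phi is negative, while phi y >= 0. *)
have key v : 0 < dot v a -> dot g v <= 0.
  move=> va; apply/ler_addgt0Pr => e e0; rewrite add0r.
  have v0 : 0 < 1 + enorm v by rewrite ltr_pwDl// enorm_ge0.
  have dv0 : 0 < 1 + dot v v by rewrite ltr_pwDl// dot_ge0.
  have nU : \forall z \near y, U z by exact: open_nbhs_nbhs.
  have H1 := near_pair_at (Hphi _ (divr_gt0 e0 v0)).
  have H2 := near_line v (P := fun z => U z /\ `|phi z - phi y - dot g (z - y)| <=
    e / (1 + enorm v) * enorm (z - y)) (filterI nU H1).
  have : \forall h \near (0:R)^'+, [/\ U (h *: v + y),
     `|phi (h *: v + y) - phi y - dot g (h *: v + y - y)| <= e / (1 + enorm v) *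
        enorm (h *: v + y - y), 0 < h & h * (1 + dot v v) < 2 * dot v a].
    near=> h.
    have [? ?] : U (h *: v + y) /\ `|phi (h *: v + y) - phi y - dot g (h *: v + y - y)| <=
      e / (1 + enorm v) * enorm (h *: v + y - y).
      by near: h; apply: cvg_within; exact: H2.
    split=> //.
    rewrite -ltr_pdivlMr//; near: h; apply: nbhs_right_lt.
    by rewrite divr_gt0// mulr_gt0.
  move=> /filter_ex[h [Uh]]; rewrite addrK dotZr enormZ => H h0 hv.
  have Dh : D (h *: v + y).
    apply: (@dist_to_ball D x); rewrite -E -(@ltr_pXn2r _ 2)// ?nnegrE ?enorm_ge0//.
    have -> : h *: v + y - x = h *: v - a by rewrite aE opprB addrA.
    rewrite !sqr_enorm dotBl !dotBr !dotZl !dotZr (dotC a v).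
    have : h * (h * (1 + dot v v)) < h * (2 * dot v a) by rewrite ltr_pM2l.
    by have := mulr_gt0 h0 h0; lra.
  have phih : phi (h *: v + y) < 0 by apply/HU.
  move: H; rewrite (ger0_norm (ltW h0)) ler_norml => /andP[H _].
  have H3 : h * dot g v <= h * e.
    have : e / (1 + enorm v) * (h * enorm v) <= h * e.
      by rewrite mulrAC ler_pdivrMr//; have := mulr_gt0 h0 e0; lra.
    lra.
  by rewrite ler_pM2l in H3.
(* w is the part of g orthogonal to a. It is only a limit of entering directions, so a small
   positive multiple of a is added before [key] is used; the result is |w|^2 <= 0. *)
pose w := g - (dot g a / enorm a ^+ 2) *: a.
have wa : dot w a = 0.
  by rewrite dotBl dotZl -sqr_enorm divfK ?subrr// expf_neq0// gt_eqF.
have w0 : w = 0.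
  apply: dot_eq0; apply/eqP; rewrite eq_le dot_ge0 andbT.
  have gw : dot g w = dot w w.
    by rewrite {2}/w dotBl dotZl (dotC a) wa mulr0 subr0.
  apply/ler_addgt0Pr => e e0; rewrite add0r.
  have K0 : 0 < 1 + `|dot g a| by rewrite ltr_pwDl.
  have e1 : 0 < e / (1 + `|dot g a|) by rewrite divr_gt0.
  have /key : 0 < dot (w + (e / (1 + `|dot g a|)) *: a) a.
    by rewrite dotDl wa add0r dotZl mulr_gt0// -sqr_enorm exprn_gt0.
  rewrite dotDr gw dotZr => H.
  have : `|e / (1 + `|dot g a|) * dot g a| <= e.
    rewrite normrM (ger0_norm (ltW e1)) mulrAC ler_pdivrMr// ler_pM2l// lerDr//.
  by rewrite ler_norml => /andP[? _]; lra.
pose m := dot g a / enorm a ^+ 2.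
have gE : g = m *: a by apply/eqP; rewrite -subr_eq0 -/w w0.
have m0 : m < 0.
  rewrite lt_neqAle; apply/andP; split.
    by apply: contraNneq g0 => m0; rewrite gE m0 scale0r.
  rewrite /m mulr_le0_ge0 ?invr_ge0 ?exprn_ge0 ?enorm_ge0//.
  by apply: key; rewrite -sqr_enorm exprn_gt0.
rewrite gE enormZ scalerA scalerA ltr0_norm// invfM invrN.
rewrite -[LHS]scale1r; congr (_ *: _).
by field; rewrite gt_eqF// lt_eqF.
Unshelve. all: by end_near. Qed.

End Distance.

(** * Operator bounds, and identities for the differentiation of the normal field *)

Section MatrixBounds.
Context {R : realType} {n : nat}.
Implicit Types (x y z u v w N : 'rV[R]_n) (A B : 'M[R]_n).

Lemma vdiff_lip_bound (f : 'rV[R]_n -> 'rV[R]_n) y A L : vdiff f y A ->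
  (\forall z \near y, enorm (f z - f y) <= L * enorm (z - y)) ->
  forall v, enorm (v *m A) <= L * enorm v.
Proof.
move=> HA HL v; apply/ler_addgt0Pr => e e0.
have v0 : 0 < 1 + enorm v by rewrite ltr_pwDl// enorm_ge0.
have e1 : 0 < e / (1 + enorm v) by rewrite divr_gt0.
have HH := near_line v (P := fun z => enorm (f z - f y) <= L * enorm (z - y) /\
  enorm (f z - f y - (z - y) *m A) <= e / (1 + enorm v) * enorm (z - y))
  (filterI HL (near_pair_at (HA _ e1))).
have {}HH := nbhs_dnbhs (HH _).
near (0 : R)^' => h.
have h0 : h != 0 by near: h; exact: nbhs_dnbhs_neq.
have [H1 H2] : enorm (f (h *: v + y) - f y) <= L * enorm (h *: v + y - y) /\
    enorm (f (h *: v + y) - f y - (h *: v + y - y) *m A) <=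
    e / (1 + enorm v) * enorm (h *: v + y - y) by near: h; exact: HH.
move: H1 H2; rewrite addrK -scalemxAl enormZ => H1 H2.
have nh : 0 < `|h| by rewrite normr_gt0.
rewrite -(ler_pM2l nh) -enormZ.
rewrite -[h *: (v *m A)](subKr (f (h *: v + y) - f y)).
apply: le_trans (ler_enormB _ _) _; rewrite mulrDr mulrCA; apply: lerD => //.
apply: le_trans H2 _; rewrite mulrAC ler_pdivrMr//.
by have := mulr_gt0 e0 nh; lra.
Unshelve. all: by end_near. Qed.

(** The estimate |v| <= 2 |v (1 + B)| gives both injectivity and the bound on the inverse. *)
Lemma unitmx_near1 B : (forall v, enorm (v *m B) <= 1 / 2 * enorm v) ->
  (1%:M + B) \in unitmx /\ forall v, enorm (v *m invmx (1%:M + B)) <= 2 * enorm v.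
Proof.
move=> HB.
have low v : enorm v <= 2 * enorm (v *m (1%:M + B)).
  have : enorm v <= enorm (v *m (1%:M + B)) + enorm (v *m B).
    apply: le_trans (ler_enormB _ _); rewrite mulmxDr mulmx1 addrK; exact: lexx.
  by have := HB v; lra.
have U : (1%:M + B) \in unitmx.
  rewrite -row_free_unit -kermx_eq0; apply/rowV0P => v /sub_kermxP v0.
  apply: enorm_eq0; apply/eqP; rewrite eq_le enorm_ge0 andbT.
  by have := low v; rewrite v0 enorm0 mulr0.
split=> // v; apply: le_trans (low _) _; by rewrite mulmxKV.
Qed.

Lemma mulmx_outer v N : v *m (N^T *m N) = dot v N *: N.
Proof. by rewrite mulmxA [v *m N^T]mx11_scalar mul_scalar_mx dot_mx. Qed.

Lemma enorm_proj N v : enorm N = 1 -> enorm (v - dot v N *: N) <= enorm v.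
Proof.
move=> N1; rewrite -(@ler_pXn2r _ 2)// ?nnegrE ?enorm_ge0// !sqr_enorm.
rewrite dotBl !dotBr !dotZl !dotZr (dotC N v) -(sqr_enorm N) N1 expr1n mulr1.
by have := sqr_ge0 (dot v N); rewrite expr2; lra.
Qed.

(** Used in [nrm_vdiff] with v = z - w, distances s1, s2, s3 at z, w, x, normals N' at z and N at x,
    m the increment of the normal and t = N.v. Each term on the right is o(|v|). *)
Lemma tangential_split (v m N N' : 'rV[R]_n) (t s1 s2 s3 : R) :
  v - (s1 - s2) *: N' - s2 *: m - (v - t *: N - s3 *: m) =
  - ((s1 - s2) *: (N' - N)) - (s1 - s2 - t) *: N - (s2 - s3) *: m.
Proof. by apply/rowP => i; rewrite !mxE; ring. Qed.

Lemma resolvent_split (u m : 'rV[R]_n) (P A : 'M[R]_n) (s : R) :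
  m - (u *m P - s *: m) *m A = m *m (1%:M + s *: A) - u *m (P *m A).
Proof.
by rewrite mulmxDr mulmx1 mulmxBl -scalemxAl -scalemxAr mulmxA opprB addrA.
Qed.

Lemma resolvent_eq (H P A : 'M[R]_n) (s : R) :
  H *m (1%:M + s *: A) = P *m A -> H = (P - s *: H) *m A.
Proof.
by rewrite mulmxDr mulmx1 mulmxBl -scalemxAl -scalemxAr => <-; rewrite addrK.
Qed.

(** Here a and b are the squared distances at z and w, and the upper bounds v and u come from
    exchanging the two foot points. *)
Lemma squeeze_diff (a b a' b' c t u v : R) : a = a' -> b = b' ->
  `|a' - u - c| <= t -> `|v - b' - c| <= t -> a <= v -> b <= u -> `|a - b - c| <= t.
Proof.
by move=> -> ->; rewrite !ler_norml => /andP[? ?] /andP[? ?] ? ?; apply/andP; split; lra.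
Qed.

End MatrixBounds.

(** * The distance function and its normal field near one boundary point *)

Section NearBoundary.
Context {R : realType} {n : nat}.
Implicit Types (x y z u v w : 'rV[R]_n) (A : 'M[R]_n) (D U : set 'rV[R]_n).

Definition bdist D x : R := dist_to x (~` D).

(* The gradient of [bdist D] where that function is differentiable. *)
Definition nrm D x : 'rV[R]_n := (bdist D x)^-1 *: (x - foot D x).

(* The Hessian of [bdist D] where that function is twice differentiable. *)
Definition shapeop D x : 'M[R]_n := xget 0 [set H | vdiff (nrm D) x H].

(** A point within lam of the boundary point [xs] has its foot within 2 lam, where the normal is
    L-Lipschitz. The bound lam L <= 1 / 4 lets the term d L of the foot equation be absorbed. *)
Context (D U : set 'rV[R]_n) (phi : 'rV[R]_n -> R) (xs : 'rV[R]_n) (lam L : R).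
Context (oD : open D) (D0 : ~` D !=set0) (nDxs : ~ D xs) (oU : open U).
Context (HU : forall z, U z -> (D z <-> phi z < 0)).
Context (lam0 : 0 < lam) (L0 : 0 <= L) (lamL : lam * L <= 1 / 4).
Context (ballU : forall y, enorm (y - xs) < 2 * lam -> U y).
Context (dphi : forall y, U y -> sdiff phi y (grad phi y)).
Context (gphi : forall y, U y -> grad phi y != 0).
Context (dnu : forall y, U y -> exists A, vdiff (inner_normal phi) y A).
Context (Lnu : forall y z, enorm (y - xs) < 2 * lam -> enorm (z - xs) < 2 * lam ->
  enorm (inner_normal phi y - inner_normal phi z) <= L * enorm (y - z)).

Let nu := inner_normal phi.
Let d := bdist D.
Let N := nrm D.

Lemma bdist_near_lt x : enorm (x - xs) < lam -> d x < lam.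
Proof. by move=> H; apply: le_lt_trans H; exact: dist_to_le. Qed.

Lemma foot_near x : enorm (x - xs) < lam -> enorm (foot D x - xs) < 2 * lam.
Proof.
move=> H; apply: le_lt_trans (enorm_triangle _ x _) _.
have [_ E] := footP x oD D0.
by rewrite enormC E; have := bdist_near_lt H; rewrite /d /bdist; lra.
Qed.

Lemma enorm_inner_normal y : U y -> enorm (nu y) = 1.
Proof.
move=> Uy; rewrite /nu /inner_normal enormZ normrN normfV ger0_norm ?enorm_ge0//.
by rewrite mulVf// gt_eqF// enorm_gt0 gphi.
Qed.

Lemma nrm_foot x : D x -> enorm (x - xs) < lam -> N x = nu (foot D x).
Proof.
move=> Dx xl; have [nDf E] := footP x oD D0.
have Uf : U (foot D x) by apply: ballU; exact: foot_near.
have d0 := dist_to_gt0 oD D0 Dx.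
rewrite /N /nrm (foot_normal oU Uf HU (dphi Uf) (gphi Uf) Dx nDf E) E.
by rewrite scalerA mulVf ?gt_eqF// scale1r.
Qed.

Lemma footE x : D x -> x - d x *: N x = foot D x.
Proof.
move=> Dx; have d0 := dist_to_gt0 oD D0 Dx.
by rewrite /N /nrm scalerA mulfV ?gt_eqF// scale1r subKr.
Qed.

Lemma enorm_nrm x : D x -> enorm (N x) = 1.
Proof.
move=> Dx; have d0 := dist_to_gt0 oD D0 Dx.
have [_ E] := footP x oD D0.
by rewrite /N /nrm enormZ E /bdist normfV ger0_norm ?(ltW d0)// mulVf// gt_eqF.
Qed.

Lemma foot_diff_eq z w : D z -> D w ->
  foot D z - foot D w = (z - w) - (d z - d w) *: N z - d w *: (N z - N w).
Proof.
move=> Dz Dw; rewrite -(footE Dz) -(footE Dw).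
move: (N z) (N w) (d z) (d w) => a b s t.
by apply/rowP => i; rewrite !mxE; ring.
Qed.

(** For the increment k of the foot, the equation gives |k| <= 2 |z - w| + |k| / 4, hence a factor 8
    / 3, rounded up to 4. *)
Lemma foot_lipschitz z w : D z -> D w -> enorm (z - xs) < lam -> enorm (w - xs) < lam ->
  enorm (foot D z - foot D w) <= 4 * enorm (z - w).
Proof.
move=> Dz Dw zl wl.
have H1 := foot_diff_eq Dz Dw.
have H2 : enorm (foot D z - foot D w) <=
    enorm (z - w) + `|d z - d w| * 1 + d w * (L * enorm (foot D z - foot D w)).
  rewrite {1}H1; apply: le_trans (ler_enormB _ _) _; apply: lerD.
    apply: le_trans (ler_enormB _ _) _; rewrite lerD2l// enormZ enorm_nrm//.
  rewrite enormZ ger0_norm ?dist_to_ge0// ler_wpM2l ?dist_to_ge0//.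
  by rewrite !nrm_foot//; apply: Lnu; exact: foot_near.
have H3 := dist_to_lip z w D0.
have H4 : d w * (L * enorm (foot D z - foot D w)) <= 1 / 4 * enorm (foot D z - foot D w).
  rewrite mulrA ler_wpM2r ?enorm_ge0//; apply: le_trans lamL.
  by rewrite ler_wpM2r// ltW// bdist_near_lt.
have := enorm_ge0 (z - w); rewrite /d /bdist in H2 H4; lra.
Qed.

Lemma near_inside x : D x -> enorm (x - xs) < lam ->
  \forall z \near x, D z /\ enorm (z - xs) < lam.
Proof.
move=> Dx xl; apply: filterI; first exact: open_nbhs_nbhs.
apply/nbhs_enormP; exists (lam - enorm (x - xs)); first by rewrite subr_gt0.
by move=> y yx; apply: le_lt_trans (enorm_triangle _ x _) _; lra.
Qed.

Lemma foot_continuous x : D x -> enorm (x - xs) < lam -> {for x, continuous (foot D)}.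
Proof.
move=> Dx xl; apply/(@cvg_enorm _ _ _ (nbhs x)) => e e0.
have e4 : 0 < e / 4 by rewrite divr_gt0.
apply: filterS2 (near_inside Dx xl) (enorm_near x e4) => z [Dz zl] ze.
by apply: le_lt_trans (foot_lipschitz Dz Dx zl xl) _; lra.
Qed.

(* The square of the distance is squeezed between the squared distances to the
   two fixed points [foot z] and [foot w]. *)
Lemma bdist_sdiff x : D x -> enorm (x - xs) < lam -> sdiff d x (N x).
Proof.
move=> Dx xl.
have d0 := dist_to_gt0 oD D0 Dx.
have Hsq : sdiff (fun z => d z ^+ 2) x (2 *: (x - foot D x)).
  move=> e e0.
  have cf := foot_continuous Dx xl.
  have e8 : 0 < e / 8 by rewrite divr_gt0.
  have H1 := filterI (near_pair (near_inside Dx xl)) (near_pair (enorm_near x e8)).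
  have H2 : \forall p \near (x, x), enorm (foot D p.1 - foot D x) < e / 8 /\
      enorm (foot D p.2 - foot D x) < e / 8.
    apply: (@near_pair _ _ x (fun z => enorm (foot D z - foot D x) < e / 8)).
    exact: (cf [set y | enorm (y - foot D x) < e / 8] (enorm_near _ e8)).
  apply: filterS2 (H1 _) H2 => -[z w] /= [[[Dz zl] [Dw wl]] [zx wx]] [fz fw].
  have [nDz Ez] := footP z oD D0; have [nDw Ew] := footP w oD D0.
  have sq (a b : R) : 0 <= a -> a <= b -> a ^+ 2 <= b ^+ 2.
    by move=> a0 ab; rewrite ler_pXn2r ?nnegrE// (le_trans a0).
  have up : d z ^+ 2 <= dot (z - foot D w) (z - foot D w).
    by rewrite -sqr_enorm; apply: sq; [exact: dist_to_ge0|exact: dist_to_le].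
  have lo : d w ^+ 2 <= dot (w - foot D z) (w - foot D z).
    by rewrite -sqr_enorm; apply: sq; [exact: dist_to_ge0|exact: dist_to_le].
  have dz : d z ^+ 2 = dot (z - foot D z) (z - foot D z) by rewrite -sqr_enorm Ez.
  have dw : d w ^+ 2 = dot (w - foot D w) (w - foot D w) by rewrite -sqr_enorm Ew.
  have est q : enorm (q - foot D x) < e / 8 ->
    `|dot (z - q) (z - q) - dot (w - q) (w - q) - dot (2 *: (x - foot D x)) (z - w)|
      <= e * enorm (z - w).
    move=> fq.
    have -> : dot (z - q) (z - q) - dot (w - q) (w - q) -
        dot (2 *: (x - foot D x)) (z - w) =
        dot ((z - x) + (w - x) - 2 *: (q - foot D x)) (z - w).
      rewrite !(dotDl, dotNl, dotZl, dotDr, dotNr) (dotC z q) (dotC w q) (dotC w z); ring.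
    apply: le_trans (norm_dot_le _ _) _; rewrite ler_wpM2r ?enorm_ge0//.
    apply: le_trans (ler_enormB _ _) _; have := ler_enormD (z - x) (w - x).
    by rewrite [enorm (2 *: _)]enormZ ger0_norm// => T; clear H1 up lo dz dw sq Ez Ew fz fw d0; lra.
  exact: (squeeze_diff dz dw (est _ fz) (est _ fw) up lo).
have d2 : 0 < d x ^+ 2 by rewrite exprn_gt0.
have HS : sdiff (fun z => Num.sqrt (d z ^+ 2)) x
    ((2 * Num.sqrt (d x ^+ 2))^-1 *: (2 *: (x - foot D x))).
  apply: (@sdiff_comp _ _ (@Num.sqrt R) (fun t => (2 * Num.sqrt t)^-1)) Hsq.
    have : \forall t \near d x ^+ 2, 0 < t by exact: lt_nbhsr.
    by apply: filterS => t t0; exact: is_derive1_sqrt.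
  apply: (@cvgV _ _ (nbhs (d x ^+ 2))).
    by rewrite mulf_neq0 ?pnatr_eq0// gt_eqF// sqrtr_gt0.
  by apply: cvgM; [exact: cvg_cst|exact: sqrt_continuous].
have -> : d = (fun z => Num.sqrt (d z ^+ 2)).
  by apply/funext => z; rewrite sqrtr_sqr ger0_norm// dist_to_ge0.
suff -> : N x = (2 * Num.sqrt (d x ^+ 2))^-1 *: (2 *: (x - foot D x)) by [].
rewrite sqrtr_sqr ger0_norm ?(ltW d0)// scalerA /N /nrm; congr (_ *: _).
by rewrite -/d invfM mulrAC mulVf ?mul1r// pnatr_eq0.
Qed.

(** Let m and k be the increments of N = nu o foot and of the foot, and Dl = z - w. Up to o(|Dl|), m
    = k A and k = Dl P - d m, with P the tangential projection. Eliminating k gives m (1 + d A) = Dl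
    P A, and 1 + d A is invertible because d L <= 1 / 4. *)
Lemma nrm_vdiff x A : D x -> enorm (x - xs) < lam -> vdiff nu (foot D x) A ->
  [/\ vdiff N x (shapeop D x),
      shapeop D x = (1%:M - (N x)^T *m N x - d x *: shapeop D x) *m A &
      forall v, enorm (v *m shapeop D x) <= 2 * L * enorm v].
Proof.
move=> Dx xl HA.
have d0 := dist_to_gt0 oD D0 Dx; have N1 := enorm_nrm Dx.
have fl := foot_near xl.
have Abound v : enorm (v *m A) <= L * enorm v.
  apply: (vdiff_lip_bound HA); apply/nbhs_enormP.
  exists (2 * lam - enorm (foot D x - xs)); first by rewrite subr_gt0.
  move=> y yx; apply: Lnu => //; apply: le_lt_trans (enorm_triangle _ (foot D x) _) _.
  lra.
have dL : d x * L <= 1 / 4.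
  by apply: le_trans lamL; rewrite ler_wpM2r// ltW// bdist_near_lt.
have [Uinv Binv] : (1%:M + d x *: A) \in unitmx /\
    forall v, enorm (v *m invmx (1%:M + d x *: A)) <= 2 * enorm v.
  apply: unitmx_near1 => v; rewrite -scalemxAr enormZ ger0_norm ?(ltW d0)//.
  apply: (@le_trans _ _ (d x * (L * enorm v))); first by rewrite ler_wpM2l// ltW.
  by rewrite mulrA ler_wpM2r ?enorm_ge0//; lra.
pose P : 'M[R]_n := 1%:M - (N x)^T *m N x.
have PE v : v *m P = v - dot (N x) v *: N x.
  by rewrite /P mulmxBr mulmx1 mulmx_outer (dotC (N x)).
pose H := P *m A *m invmx (1%:M + d x *: A).
have HH : vdiff N x H.
  move=> e e0.
  (* The error of k carries the factor 2 + 4 L, multiplication by A costs L, the relation m = k A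
     costs 4, and the inverse of 1 + d A costs 2. *)
  pose K := 2 * (4 + L * (2 + 4 * L)).
  have K0 : 0 < K.
    by rewrite /K mulr_gt0// ltr_pwDl// mulr_ge0// addr_ge0 ?mulr_ge0.
  have e1 : 0 < e / K by rewrite divr_gt0.
  have cf := foot_continuous Dx xl.
  have B1 := near_pair (near_inside Dx xl).
  have B2 := near_pair_comp cf (HA _ e1).
  have B3 := bdist_sdiff Dx xl e1.
  have B4 : \forall p \near (x, x),
     (enorm (N p.1 - N x) <= e / K /\ `|d p.1 - d x| <= e / K) /\
     (enorm (N p.2 - N x) <= e / K /\ `|d p.2 - d x| <= e / K).
    apply: (@near_pair _ _ x (fun z => enorm (N z - N x) <= e / K /\ `|d z - d x| <= e / K)).
    have L4 : 0 < 4 * L + 1 by rewrite ltr_wpDl ?mulr_ge0.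
    apply: filterS2 (near_inside Dx xl)
       (filterI (enorm_near x e1) (enorm_near x (divr_gt0 e1 L4))) => z [Dz zl] [z1 z2].
    split; last by apply: le_trans (dist_to_lip _ _ D0) (ltW z1).
    rewrite !nrm_foot//; apply: le_trans (Lnu (foot_near zl) fl) _.
    apply: (@le_trans _ _ (L * (4 * enorm (z - x)))).
      by rewrite ler_wpM2l// foot_lipschitz.
    rewrite ltr_pdivlMr// in z2; apply: le_trans (ltW z2).
    by rewrite mulrCA (mulrC _ (4 * L + 1)) mulrA ler_wpM2r ?enorm_ge0// lerDl.
  apply: filterS2 (filterI B1 B2) (filterI B3 B4).
  move=> -[z w] /= [[[Dz zl] [Dw wl]] b2] [b3 [[b4 b5] [b6 b7]]].
  set k := foot D z - foot D w; set m := N z - N w; set Dl := z - w.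
  rewrite -!nrm_foot// -/m -/k in b2.
  rewrite -/Dl in b3.
  have kl : enorm k <= 4 * enorm Dl by exact: foot_lipschitz.
  have ml : enorm m <= L * enorm k.
    by rewrite /m !nrm_foot//; apply: Lnu; exact: foot_near.
  have dl : `|d z - d w| <= enorm Dl by exact: dist_to_lip.
  have Dl0 := enorm_ge0 Dl.
  have kE0 : k = Dl - (d z - d w) *: N z - d w *: m := foot_diff_eq Dz Dw.
  have kE : enorm (k - (Dl *m P - d x *: m)) <= e / K * ((2 + 4 * L) * enorm Dl).
    have -> : k - (Dl *m P - d x *: m) = - ((d z - d w) *: (N z - N x)) -
        (d z - d w - dot (N x) Dl) *: N x - (d w - d x) *: m.
      rewrite kE0 PE; exact: tangential_split.
    apply: le_trans (ler_enormB _ _) _.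
    have -> : e / K * ((2 + 4 * L) * enorm Dl) =
      enorm Dl * (e / K) + e / K * enorm Dl + (e / K) * (L * (4 * enorm Dl)) by ring.
    apply: lerD.
      apply: le_trans (ler_enormB _ _) _; rewrite enormN; apply: lerD.
        by rewrite enormZ; exact: (ler_pM (normr_ge0 _) (enorm_ge0 _) dl b4).
      by rewrite enormZ N1 mulr1; exact: b3.
    rewrite enormZ; apply: (ler_pM (normr_ge0 _) (enorm_ge0 _) b7).
    exact: (le_trans ml (ler_wpM2l L0 kl)).
  have mE : enorm (m - (Dl *m P - d x *: m) *m A) <=
      e / K * ((4 + L * (2 + 4 * L)) * enorm Dl).
    have -> : m - (Dl *m P - d x *: m) *m A = (m - k *m A) +
        (k - (Dl *m P - d x *: m)) *m A by rewrite (mulmxBl k) subrKA.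
    apply: le_trans (ler_enormD _ _) _.
    have -> : e / K * ((4 + L * (2 + 4 * L)) * enorm Dl) =
      e / K * (4 * enorm Dl) + L * (e / K * ((2 + 4 * L) * enorm Dl)) by ring.
    apply: lerD.
      exact: (le_trans b2 (ler_wpM2l (ltW e1) kl)).
    exact: (le_trans (Abound _) (ler_wpM2l L0 kE)).
  have -> : m - Dl *m H = (m - (Dl *m P - d x *: m) *m A) *m invmx (1%:M + d x *: A).
    have -> : m - (Dl *m P - d x *: m) *m A = m *m (1%:M + d x *: A) - Dl *m (P *m A).
      exact: resolvent_split.
    by rewrite (mulmxBl (m *m _)) mulmxK// /H mulmxA.
  apply: le_trans (Binv _) _; apply: le_trans (ler_wpM2l _ mE) _ => //.
  rewrite -/Dl le_eqVlt; apply/orP; left; apply/eqP.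
  have -> : 2 * (e / K * ((4 + L * (2 + 4 * L)) * enorm Dl)) = e / K * K * enorm Dl.
    by rewrite /K; ring.
  by rewrite divfK// gt_eqF.
have HS : vdiff N x (shapeop D x).
  by apply: (xgetPex 0 (P := [set H | vdiff (nrm D) x H])); exists H.
(* [shapeop] is a chosen derivative; it equals H because derivatives are unique. *)
have SH : shapeop D x = H.
  apply/row_matrixP => i; rewrite !rowE.
  by rewrite -(vdiff_derive (delta_mx 0 i) HS) -(vdiff_derive (delta_mx 0 i) HH).
have rel : shapeop D x = (P - d x *: shapeop D x) *m A.
  by rewrite SH; apply: resolvent_eq; rewrite /H mulmxKV.
split=> // v.
(* Since d L <= 1 / 4, the term with the shape operator on the right is absorbed, which leaves 4 / 3
   L. *)
have : enorm (v *m shapeop D x) <= L * (enorm v + d x * enorm (v *m shapeop D x)).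
  rewrite {1}rel mulmxA; apply: le_trans (Abound _) _; rewrite ler_wpM2l//.
  rewrite mulmxBr -scalemxAr; apply: le_trans (ler_enormB _ _) _.
  rewrite enormZ ger0_norm ?(ltW d0)// lerD2r /P mulmxBr mulmx1 mulmx_outer.
  exact: enorm_proj.
have := mulr_ge0 L0 (enorm_ge0 v); have := ler_wpM2r (enorm_ge0 (v *m shapeop D x)) dL.
rewrite -mulrA mulrDr [L * (_ * _)]mulrCA; lra.
Qed.

End NearBoundary.

(** * Uniform estimates in a collar of the boundary *)

Section Collar.
Context {R : realType} {n : nat}.
Implicit Types (x y z u v w : 'rV[R]_n) (A : 'M[R]_n) (D U : set 'rV[R]_n).

(** A Lebesgue number argument in which e is both the radius and the parameter of P; halving it
    locally leaves room to move the centre. *)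
Lemma compact_uniform (K : set 'rV[R]_n) (P : R -> 'rV[R]_n -> Prop) : compact K ->
  (forall e e' x, 0 < e' -> e' <= e -> P e x -> P e' x) ->
  (forall z, K z -> exists2 e, 0 < e & forall x, enorm (x - z) < e -> P e x) ->
  exists2 e, 0 < e & forall z, K z -> forall x, enorm (x - z) < e -> P e x.
Proof.
move=> /compact_near_coveringP cK mono loc.
pose Q e z := 0 < e -> forall x, enorm (x - z) < e -> P e x.
have He : \forall e \near (0 : R)^'+, K `<=` Q e.
  apply: (cK R (0 : R)^'+ Q) => z /loc[e e0 He].
  have e2 : 0 < e / 2 by rewrite divr_gt0.
  exists ([set z' | enorm (z' - z) < e / 2], [set e' | e' < e / 2]) => /=.
    by split; [exact: enorm_near|exact: nbhs_right_lt].
  move=> [z' e'] /= [zz ee] e'0 x xz; apply: (mono e) => //; first lra.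
  by apply: He; apply: le_lt_trans (enorm_triangle _ z' _) _; lra.
near (0 : R)^'+ => e.
have e0 : 0 < e by [].
exists e => // z Kz x xz.
have H : K `<=` Q e by near: e.
exact: (H z Kz e0 x xz).
Unshelve. all: by end_near. Qed.


(* The last component gives a direction along which the distance to the
   complement grows at speed at least [1 / 2]. *)
Definition collar_point D (e : R) x : Prop :=
  [/\ sdiff (bdist D) x (nrm D x), vdiff (nrm D) x (shapeop D x),
      (forall v, enorm (v *m shapeop D x) <= e^-1 * enorm v) /\
      (forall v, bdist D x * enorm (v *m shapeop D x) <= 1 / 2 * enorm v),
      exists U phi A, [/\ local_defining_function 2 D (foot D x) U phi,
        vdiff (inner_normal phi) (foot D x) A,
        forall v, bdist D x * enorm (v *m A) <= 1 / 2 * enorm v &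
        forall x', D x' -> enorm (x' - x) <= bdist D x -> foot D x' = foot D x ->
          [/\ nrm D x' = inner_normal phi (foot D x),
              shapeop D x' =
                (1%:M - (nrm D x')^T *m nrm D x' - bdist D x' *: shapeop D x') *m A &
              vdiff (nrm D) x' (shapeop D x')]] &
      exists2 v, enorm v = 1 & forall t, 0 <= t <= e ->
        D (x + t *: v) /\ bdist D x + t / 2 <= bdist D (x + t *: v)].

Lemma local_defining_C2 r D x U phi : 2 < r ->
  local_defining_function r D x U phi -> local_defining_function 2 D x U phi.
Proof.
move=> r2 [oU Ux [Ck _] HD Hg]; split=> //; split.
  have -> : Num.truncn (2 : R) = 2%N by rewrite (@truncn_def _ _ 2)// lexx ltr_nat.
  by apply: class_C_le Ck; rewrite truncn_ge_nat ?ltW//; lra.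
by rewrite (@truncn_def _ _ 2) ?lexx ?ltr_nat// subrr ltxx.
Qed.

Lemma local_defining_class_C2 D x U phi :
  local_defining_function 2 D x U phi -> class_C 2 U phi.
Proof.
move=> [_ _ [Ck _] _ _]; move: Ck.
by rewrite (@truncn_def _ _ 2) ?lexx ?ltr_nat.
Qed.

Lemma collar_local r D xs : 2 < r -> open D -> ~` D !=set0 -> has_Cr_boundary r D ->
  bd D xs -> exists2 e, 0 < e & forall x, enorm (x - xs) < e -> D x -> collar_point D e x.
Proof.
move=> r2 oD D0 hbd bdx.
have nDxs : ~ D xs by move=> Dx; case: bdx => _; apply; move: oD; rewrite openE => /(_ _ Dx).
have [U [phi /(local_defining_C2 r2) ld]] := hbd _ bdx.
have [oU Uxs _ HU gphi] := ld.
have dphi2 := class_C2_diff oU (local_defining_class_C2 ld).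
have dphi y : U y -> sdiff phi y (grad phi y) by move=> /dphi2[].
have dnu y : U y -> exists A, vdiff (inner_normal phi) y A.
  by move=> Uy; have [_ H] := dphi2 y Uy; apply: vdiff_normalize H; exact: gphi.
have [A0 HA0] := dnu xs Uxs.
have [L L0 /near_pairP[l1 l10 Hl1]] := vdiff_lip HA0.
have [l2 l20 Hl2] := open_enormP oU Uxs.
(* The ball of radius 2 lam must lie in U and in the region where the normal is L-Lipschitz, and lam
   L must not exceed 1 / 4. *)
pose lam := Order.min (Order.min l1 l2 / 2) (1 / (4 * L)).
have L4 : 0 < 4 * L by rewrite mulr_gt0.
have l12 : 0 < Order.min l1 l2 by rewrite lt_min l10.
have lam0 : 0 < lam by rewrite lt_min divr_gt0 ?divr_gt0.
have lamL : lam * L <= 1 / 4.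
  have : lam <= 1 / (4 * L) by rewrite ge_min lexx orbT.
  by rewrite ler_pdivlMr//; lra.
have lam2 : 2 * lam <= Order.min l1 l2.
  have : lam <= Order.min l1 l2 / 2 by rewrite ge_min lexx.
  by move=> ?; lra.
have ballU y : enorm (y - xs) < 2 * lam -> U y.
  by move=> yl; apply: Hl2; apply: lt_le_trans yl (le_trans lam2 _); rewrite ge_min lexx orbT.
have Lnu y z : enorm (y - xs) < 2 * lam -> enorm (z - xs) < 2 * lam ->
    enorm (inner_normal phi y - inner_normal phi z) <= L * enorm (y - z).
  have l1m : 2 * lam <= l1 by apply: le_trans lam2 _; rewrite ge_min lexx.
  by move=> yl zl; apply: (Hl1 y z); exact: lt_le_trans l1m.
have nuE y : U y -> enorm (inner_normal phi y) = 1 by exact: enorm_inner_normal.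
(* The bound lam / 4 keeps all displaced points within lam of [xs]; the bound 1 / (2 L) turns the
   estimate 2 L of the shape operator into 1 / e. *)
pose e := Order.min (lam / 4) (2 * L)^-1.
have L2 : 0 < 2 * L by rewrite mulr_gt0.
have e0 : 0 < e by rewrite lt_min divr_gt0// invr_gt0.
have el : e <= lam / 4 by rewrite ge_min lexx.
have eL : 2 * L <= e^-1.
  by rewrite -[leLHS]invrK lef_pV2 ?posrE ?invr_gt0// ge_min lexx orbT.
exists e => // x xe Dx.
have xl : enorm (x - xs) < lam by lra.
have fl := foot_near oD D0 nDxs xl.
have Uf := ballU _ fl.
have [A HA] := dnu _ Uf.
have d0 := dist_to_gt0 oD D0 Dx.
have dl : bdist D x < lam by exact: (bdist_near_lt nDxs xl).
have [H1 H2 H3] := nrm_vdiff oD D0 nDxs oU HU (ltW L0) lamL ballU dphi gphi Lnu Dx xl HA.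
have Abound v : enorm (v *m A) <= L * enorm v.
  apply: (vdiff_lip_bound HA); apply/nbhs_enormP.
  exists (2 * lam - enorm (foot D x - xs)); first by rewrite subr_gt0.
  move=> y yx; apply: Lnu => //; apply: le_lt_trans (enorm_triangle _ (foot D x) _) _.
  by lra.
have dL : bdist D x * L <= 1 / 4.
  by apply: le_trans lamL; rewrite ler_wpM2r// ltW.
have scaled v (B : 'M[R]_n) K : enorm (v *m B) <= K * enorm v -> bdist D x * K <= 1 / 2 ->
    bdist D x * enorm (v *m B) <= 1 / 2 * enorm v.
  move=> h1 h2; apply: le_trans (ler_wpM2l (ltW d0) h1) _.
  by rewrite mulrA ler_wpM2r ?enorm_ge0.
split=> //.
- exact: bdist_sdiff oD D0 nDxs oU HU (ltW L0) lamL ballU dphi gphi Lnu x Dx xl.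
- split=> v; first by apply: le_trans (H3 v) _; rewrite ler_wpM2r ?enorm_ge0.
  by apply: scaled (H3 v) _; rewrite mulrCA mulrA -mulrA; lra.
- have ldf : local_defining_function 2 D (foot D x) U phi by case: ld.
  exists U, phi, A; split; [exact: ldf|exact: HA| |].
  + move=> v; apply: scaled (Abound v) _; lra.
  + move=> x' Dx' xx' fx'.
    have xl' : enorm (x' - xs) < lam.
      apply: le_lt_trans (enorm_triangle _ x _) _.
      have : bdist D x <= enorm (x - xs) by exact: dist_to_le.
      by lra.
    have HA' : vdiff (inner_normal phi) (foot D x') A by rewrite fx'.
    have [G1 G2 _] := nrm_vdiff oD D0 nDxs oU HU (ltW L0) lamL ballU dphi gphi Lnu Dx' xl' HA'.
    split=> //; rewrite -fx'.
    exact: (nrm_foot oD D0 nDxs oU HU ballU dphi gphi Dx' xl').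
(* The direction is the inner normal at [xs]. All normals in the 2 lam ball have inner product at
   least 1 / 2 with it. Hence phi does not increase along it, which keeps the path in D, and the
   distance grows there at speed at least 1 / 2. *)
- have [Ns NsE] : exists Ns, Ns = inner_normal phi xs by eexists.
  have Ns1 : enorm Ns = 1 by rewrite NsE; exact: nuE.
  exists Ns => // t /andP[t0 te].
  have close c : 0 <= c <= 1 -> enorm (x + c *: (t *: Ns) - xs) < lam.
    move=> /andP[c0 c1]; rewrite addrAC; apply: le_lt_trans (ler_enormD _ _) _.
    rewrite !enormZ Ns1 mulr1 !ger0_norm//.
    have : c * t <= t by rewrite ler_piMl.
    by lra.
  have dotNs z : enorm (z - xs) < 2 * lam -> 1 / 2 <= dot (inner_normal phi z) Ns.
    move=> zl; have z1 : enorm (inner_normal phi z) = 1 by apply: nuE; exact: ballU.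
    have xs0 : enorm (xs - xs) < 2 * lam by rewrite subrr enorm0 mulr_gt0.
    have : enorm (inner_normal phi z - Ns) <= 1 / 2.
      rewrite NsE; apply: le_trans (Lnu _ _ zl xs0) _.
      have := ler_wpM2r (ltW L0) (ltW zl); lra.
    move=> h; have : enorm (inner_normal phi z - Ns) ^+ 2 <= (1 / 2) ^+ 2.
      by rewrite ler_pXn2r ?nnegrE ?enorm_ge0.
    rewrite sqr_enorm dotBl !dotBr (dotC Ns) -!sqr_enorm z1 Ns1 !expr1n; lra.
  have inU z : enorm (z - xs) < lam -> enorm (z - xs) < 2 * lam by move=> ?; lra.
  have inD c : 0 <= c <= 1 -> D (x + c *: (t *: Ns)).
    move=> /andP[c0 c1].
    have sub c' : 0 <= c' <= 1 -> enorm (x + c' *: (c *: (t *: Ns)) - xs) < lam.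
      move=> /andP[c'0 c'1]; rewrite scalerA; apply: close.
      by rewrite mulr_ge0//= mulr_ile1.
    have [c' c'01|c' c'01 Ec] := @segment_MVT R n phi (grad phi) x (c *: (t *: Ns)).
      by apply: dphi; apply: ballU; apply: inU; exact: sub.
    have Uc := ballU _ (inU _ (sub _ c'01)).
    apply/HU; first by apply: ballU; apply: inU; apply: close; rewrite c0.
    have px : phi x < 0 by apply/HU => //; apply: ballU; exact: inU.
    have := dotNs _ (inU _ (sub _ c'01)).
    rewrite {1}/inner_normal dotZl mulNr => h.
    have g0 : 0 < enorm (grad phi (x + c' *: (c *: (t *: Ns)))).
      by rewrite enorm_gt0; exact: gphi.
    have : dot (grad phi (x + c' *: (c *: (t *: Ns)))) Ns <= 0.
      rewrite leNgt; apply/negP => h'.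
      have : 0 <= (enorm (grad phi (x + c' *: (c *: (t *: Ns)))))^-1 *
        dot (grad phi (x + c' *: (c *: (t *: Ns)))) Ns.
        by rewrite mulr_ge0 ?invr_ge0 ?ltW.
      lra.
    move: Ec; rewrite 2!dotZr => Ec h'.
    have : c * (t * dot (grad phi (x + c' *: (c *: (t *: Ns)))) Ns) <= 0.
      by rewrite mulrA mulr_ge0_le0// mulr_ge0.
    lra.
  split; first by have := inD 1; rewrite scale1r; apply; rewrite ler01 lexx.
  have [c c01|c c01 Ec] := @segment_MVT R n (bdist D) (nrm D) x (t *: Ns).
    exact: bdist_sdiff oD D0 nDxs oU HU (ltW L0) lamL ballU dphi gphi Lnu _ (inD _ c01) (close _ c01).
  have : t * (1 / 2) <= dot (nrm D (x + c *: (t *: Ns))) (t *: Ns).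
    rewrite dotZr ler_wpM2l//.
    rewrite (nrm_foot oD D0 nDxs oU HU ballU dphi gphi (inD _ c01) (close _ c01)).
    by apply: dotNs; apply: foot_near => //; exact: close.
  by lra.
Qed.

(** The boundary is compact, and a point of depth below e is within e of its foot, which is a
    boundary point. *)
Lemma collar_exists r D : 2 < r -> open D -> ~` D !=set0 -> bounded_set D ->
  has_Cr_boundary r D ->
  exists2 e, 0 < e & forall x, D x -> bdist D x < e -> collar_point D e x.
Proof.
move=> r2 oD D0 bD hbd.
have cK : compact (bd D).
  apply: bounded_closed_compact; last first.
    by apply: closedI; [exact: closed_closure|apply: open_closedC; exact: open_interior].
  have /bounded_enormP[M HM] := bD.
  apply/bounded_enormP; exists (M + 1) => x [/closureP_enorm/(_ 1 ltr01)[z Dz zx] _].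
  have := ler_enormD z (x - z); rewrite subrKC (enormC x); have := HM z Dz; lra.
have mono e e' x : 0 < e' -> e' <= e -> (D x -> collar_point D e x) ->
    D x -> collar_point D e' x.
  move=> e'0 ee H Dx; have [h1 h2 [h3 h3'] h4 [v v1 h5]] := H Dx.
  split=> //.
    split=> // w; apply: le_trans (h3 w) _; rewrite ler_wpM2r ?enorm_ge0//.
    by rewrite lef_pV2 ?posrE//; exact: lt_le_trans ee.
  by exists v => // t /andP[t0 te]; apply: h5; rewrite t0 (le_trans te).
have loc z : bd D z -> exists2 e, 0 < e & forall x, enorm (x - z) < e ->
    D x -> collar_point D e x by exact: (collar_local r2 oD D0 hbd).
have [e e0 He] := compact_uniform cK mono loc.
exists e => // x Dx xe.
have [nDf Ef] := footP x oD D0.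
apply: (He (foot D x)) => //; first exact: foot_bd oD Dx nDf Ef.
by rewrite Ef.
Qed.

End Collar.

(** * Orthonormalizing a frame whose Gram matrix is I + k c c^T *)

Section GramCorrection.
Context {R : realType} {n p : nat}.
Implicit Types (b : 'I_p -> 'rV[R]_n) (c : 'I_p -> R) (M : 'M[R]_n).

(** I - beta c c^T is to be the inverse square root of I + k c c^T, where s = |c|^2. On c this means
    1 - beta s = 1 / r with r = sqrt (1 + k s), whence beta = k / (r (r + 1)), which also makes
    sense for s = 0. *)
Lemma gram_beta (k s : R) : 0 < 1 + k * s ->
  exists beta, 2 * beta - beta ^+ 2 * s = k / (1 + k * s).
Proof.
move=> ks; pose r := Num.sqrt (1 + k * s).
have r0 : 0 < r by rewrite sqrtr_gt0.
have rE : r ^+ 2 = 1 + k * s by rewrite sqr_sqrtr// ltW.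
exists (k / (r * (r + 1))); rewrite -rE.
have r1 : r + 1 != 0 by rewrite gt_eqF// addr_gt0.
have rn : r != 0 by rewrite gt_eqF.
have -> : 2 * (k / (r * (r + 1))) - (k / (r * (r + 1))) ^+ 2 * s =
  k * (2 * r * (r + 1) - k * s) / (r * (r + 1)) ^+ 2 by field; rewrite rn r1.
have -> : k * s = r ^+ 2 - 1 by rewrite rE; ring.
by field; rewrite rn r1.
Qed.

(** Applied with k = 1 to frames lifted to a graph of slopes c, and with k = -1 to frames from which
    components c along a unit normal have been removed. *)
Lemma gram_correction b c (k beta : R) (i j : 'I_p) :
  let s := \sum_l c l ^+ 2 in let w := \sum_l c l *: b l in
  0 < 1 + k * s -> 2 * beta - beta ^+ 2 * s = k / (1 + k * s) ->
  (forall i j, dot (b i) (b j) = (i == j)%:R + k * (c i * c j)) ->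
  dot (b i - (beta * c i) *: w) (b j - (beta * c j) *: w) = (i == j)%:R.
Proof.
move=> s w ks hb H.
have bw l : dot (b l) w = c l * (1 + k * s).
  rewrite /w dot_sumr.
  under eq_bigr => m _ do rewrite dotZr H mulrDr.
  rewrite big_split /= (bigD1 l)//= eqxx mulr1 big1 ?addr0; last first.
    by move=> m ml; rewrite eq_sym (negPf ml) mulr0.
  rewrite mulrDr mulr1; congr (_ + _).
  rewrite /s mulrCA !big_distrr; apply: eq_bigr => m _ /=; ring.
have ww : dot w w = s * (1 + k * s).
  rewrite {1}/w dot_suml /s big_distrl; apply: eq_bigr => m _.
  by rewrite dotZl bw /= mulrA -expr2.
rewrite dotBl !dotBr !dotZl !dotZr H ww (dotC w) !bw.
have : (2 * beta - beta ^+ 2 * s) * (1 + k * s) = k by rewrite hb divfK// gt_eqF.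
move: (1 + k * s) (i == j)%:R => q e E.
have -> : e + k * (c i * c j) - beta * c j * (c i * q) -
  (beta * c i * (c j * q) - beta * c i * (beta * c j * (s * q))) =
  e + (k - (2 * beta - beta ^+ 2 * s) * q) * (c i * c j) by ring.
by rewrite E subrr mul0r addr0.
Qed.

(** All corrections are multiples of the single vector w, so the trace changes by a multiple of the
    value of the form on w. *)
Lemma gram_trace b c M (beta : R) :
  let s := \sum_l c l ^+ 2 in let w := \sum_l c l *: b l in
  \sum_i dot ((b i - (beta * c i) *: w) *m M) (b i - (beta * c i) *: w) =
  \sum_i dot (b i *m M) (b i) - (2 * beta - beta ^+ 2 * s) * dot (w *m M) w.
Proof.
move=> s w.
have E i : dot ((b i - (beta * c i) *: w) *m M) (b i - (beta * c i) *: w) =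
  dot (b i *m M) (b i) - beta * dot ((c i *: b i) *m M) w -
  beta * dot (w *m M) (c i *: b i) + beta ^+ 2 * dot (w *m M) w * c i ^+ 2.
  rewrite mulmxBl -!scalemxAl dotBl !dotBr !dotZl !dotZr; ring.
under eq_bigr => i _ do rewrite E.
rewrite big_split /= !sumrB -!big_distrr /= -dot_suml -mulmx_suml -dot_sumr.
by rewrite -/s -/w; ring.
Qed.

End GramCorrection.

(** * First- and second-order conditions at a maximum along curves *)

Section SecondOrderTest.
Context {R : realType} {n : nat}.
Implicit Types (x z u v w : 'rV[R]_n).

Lemma first_order_max (f : 'rV[R]_n -> R) z g v (s0 : R) : 0 < s0 ->
  sdiff f z g -> (forall s, 0 < s -> s < s0 -> f (z + s *: v) <= f z) -> dot g v <= 0.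
Proof.
move=> s00 Hf H; apply/ler_addgt0Pr => e e0; rewrite add0r.
have v0 : 0 < 1 + enorm v by rewrite ltr_pwDl// enorm_ge0.
have Hn := near_line v (near_pair_at (Hf _ (divr_gt0 e0 v0))).
near (0 : R)^'+ => s.
have sp : 0 < s by [].
have sl : s < s0 by near: s; exact: nbhs_right_lt.
have : `|f (s *: v + z) - f z - dot g (s *: v + z - z)| <=
    e / (1 + enorm v) * enorm (s *: v + z - z).
  by near: s; apply: cvg_within; exact: Hn.
rewrite addrK dotZr enormZ (ger0_norm (ltW sp)) ler_norml => /andP[h _].
have := H s sp sl; rewrite addrC => h2.
have h3 : e / (1 + enorm v) * (s * enorm v) <= s * e.
  by rewrite mulrAC ler_pdivrMr//; have := mulr_gt0 sp e0; lra.
have : s * dot g v <= s * e by lra.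
by rewrite ler_pM2l.
Unshelve. all: by end_near. Qed.

(** The parabola z + s w + s^2 v can follow a curved cap, on which alone maximality is known. Adding
    the inequalities for s and -s cancels the odd terms, in particular s (g z).w. *)
Lemma second_order_max (f : 'rV[R]_n -> R) z g H v w (s0 : R) : 0 < s0 ->
  (\forall x \near z, sdiff f x (g x)) -> vdiff g z H ->
  (forall s, `|s| < s0 -> f (z + (s *: w + s ^+ 2 *: v)) <= f z) ->
  dot (g z) v + dot (w *m H) w / 2 <= 0.
Proof.
move=> s00 Hf Hg Hmax; apply/ler_addgt0Pr => e e0; rewrite add0r.
pose C := (enorm w + enorm v) ^+ 2 + `|dot (v *m H) v|.
have C0 : 0 <= C by rewrite addr_ge0// sqr_ge0.
have C1 : 0 < 1 + C by rewrite ltr_pwDl.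
have e1 : 0 < e / (1 + C) by rewrite divr_gt0.
have /nbhs_enormP[r r0 Hr] := sdiff_taylor2 Hf Hg e1.
have D0 : 0 < 1 + enorm w + enorm v by have := enorm_ge0 w; have := enorm_ge0 v; lra.
near (0 : R)^'+ => s.
have sp : 0 < s by [].
have s1 : s < 1 by near: s; apply: nbhs_right_lt.
have sl : s < s0 by near: s; exact: nbhs_right_lt.
have sr : s * (1 + enorm w + enorm v) < r.
  rewrite -ltr_pdivlMr//; near: s; apply: nbhs_right_lt; exact: divr_gt0.
have se : s < e / (1 + C) by near: s; exact: nbhs_right_lt.
have ss : s ^+ 2 <= s by rewrite expr2 ler_piMl// ltW.
have sq : 0 < s ^+ 2 by rewrite exprn_gt0.
have hn (t : R) : `|t| = s -> enorm (t *: w + t ^+ 2 *: v) <= s * (enorm w + enorm v).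
  move=> ts; apply: le_trans (ler_enormD _ _) _; rewrite !enormZ normrX ts mulrDr.
  by rewrite lerD2l ler_wpM2r ?enorm_ge0.
have key (t : R) : `|t| = s ->
    t * dot (g z) w + s ^+ 2 * dot (g z) v + (s ^+ 2 * dot (w *m H) w +
     t * s ^+ 2 * (dot (w *m H) v + dot (v *m H) w) + s ^+ 2 * s ^+ 2 * dot (v *m H) v) / 2
      <= e / (1 + C) * (s ^+ 2 * (enorm w + enorm v) ^+ 2).
  move=> ts; set h := t *: w + t ^+ 2 *: v.
  have t2 : t ^+ 2 = s ^+ 2 by rewrite -ts real_normK// num_real.
  have hr : enorm (z + h - z) < r.
    rewrite addrAC subrr add0r; apply: le_lt_trans (hn t ts) _; lra.
  have := Hr _ hr; rewrite [z + h - z]addrAC subrr add0r ler_norml => /andP[h1 _].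
  have h2 : f (z + h) <= f z by apply: Hmax; rewrite ts.
  have h3 : e / (1 + C) * enorm h ^+ 2 <=
      e / (1 + C) * (s ^+ 2 * (enorm w + enorm v) ^+ 2).
    rewrite ler_pM2l// -exprMn ler_pXn2r ?nnegrE ?enorm_ge0//; first exact: hn.
    by rewrite mulr_ge0 ?(ltW sp)// addr_ge0 ?enorm_ge0.
  have E1 : dot (g z) h = t * dot (g z) w + s ^+ 2 * dot (g z) v.
    by rewrite dotDr !dotZr t2.
  have E2 : dot (h *m H) h = s ^+ 2 * dot (w *m H) w +
     t * s ^+ 2 * (dot (w *m H) v + dot (v *m H) w) + s ^+ 2 * s ^+ 2 * dot (v *m H) v.
    rewrite /h mulmxDl -!scalemxAl dotDl !dotDr !dotZl !dotZr -t2; ring.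
  rewrite E1 E2 in h1; lra.
have := key s (ger0_norm (ltW sp)).
have := key (- s); rewrite normrN (ger0_norm (ltW sp)) => /(_ erefl) k1 k2.
have k3 : s ^+ 2 * (dot (g z) v + dot (w *m H) w / 2) <=
   s ^+ 2 * (e / (1 + C) * (enorm w + enorm v) ^+ 2 - s ^+ 2 * dot (v *m H) v / 2).
  lra.
rewrite ler_pM2l// in k3; apply: le_trans k3 _.
have k4 : `|s ^+ 2 * dot (v *m H) v| <= e / (1 + C) * `|dot (v *m H) v|.
  rewrite normrM (ger0_norm (ltW sq)) ler_wpM2r//.
  exact: le_trans ss (ltW se).
have k5 : e / (1 + C) * C <= e.
  by rewrite mulrAC ler_pdivrMr// ler_pM2l// lerDr.
move: k4; rewrite ler_norml => /andP[k4 _].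
have k6 := mulr_ge0 (ltW e1) (normr_ge0 (dot (v *m H) v)).
rewrite /C mulrDr -/C in k5; lra.
Unshelve. all: by end_near. Qed.

End SecondOrderTest.

(** * Strong p-plurisubharmonicity tested on orthonormal frames *)

Section TraceOnFrames.
Context {R : realType} {n p : nat}.

Lemma orthonormal_free (b : p.-tuple 'rV[R]_n) : orthonormal_tuple b -> free b.
Proof.
move=> ob; apply/freeP => k k0 i.
have := congr1 (fun v => dot v (tnth b i)) k0; rewrite dot0l dot_suml.
under eq_bigr => j _ do rewrite dotZl -tnth_nth ob.
rewrite (bigD1 i)//= eqxx mulr1 big1 ?addr0// => j ji.
by rewrite (negPf ji) mulr0.
Qed.

Lemma psh_trace D (rho : 'rV[R]_n -> R) x (b : 'I_p -> 'rV[R]_n) :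
  strongly_p_psh p D rho -> D x -> (forall i j, dot (b i) (b j) = (i == j)%:R) ->
  0 < \sum_i dot (b i *m hessian rho x) (b i).
Proof.
move=> [_ H] Dx ob; pose t := [tuple b i | i < p].
have ot : orthonormal_tuple t by move=> i j; rewrite !tnth_mktuple.
have ft := orthonormal_free ot.
have := H x Dx <<t>>%VS; rewrite (eqP ft) size_tuple => /(_ erefl t).
rewrite basisEfree ft subvv size_tuple (eqP ft) size_tuple leqnn => /(_ isT ot).
by under eq_bigr => i _ do rewrite tnth_mktuple.
Qed.

End TraceOnFrames.

(** * Continuity of affine, linear and quadratic expressions *)

Section QuadraticContinuity.
Context {R : realType} {n : nat}.
Implicit Types (x z u v w a N : 'rV[R]_n) (M : 'M[R]_n).

Lemma vdiff_affine a M x : vdiff (fun z => (z - a) *m M) x M.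
Proof.
move=> e e0; near=> p; rewrite -!mulmxBl (_ : _ - _ - _ = 0).
  by rewrite mul0mx enorm0 mulr_ge0 ?enorm_ge0 ?(ltW e0).
by apply/rowP => i; rewrite !mxE; ring.
Unshelve. all: by end_near. Qed.

Lemma vdiff_dot_ex (F G : 'rV[R]_n -> 'rV[R]_n) x A B : vdiff F x A -> vdiff G x B ->
  exists g, sdiff (fun z => dot (F z) (G z)) x g.
Proof.
move=> HF HG; eexists; apply: sdiff_sum => i.
by apply: sdiffM; [exact: vdiff_coord HF|exact: vdiff_coord HG].
Qed.

Lemma continuous_affine_dot a M M' :
  continuous (fun z : 'rV[R]_n => dot ((z - a) *m M) ((z - a) *m M')).
Proof.
move=> x; have [g Hg] := vdiff_dot_ex (vdiff_affine a M x) (vdiff_affine a M' x).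
exact: sdiff_continuous Hg.
Qed.

Lemma continuous_affine_enorm a M : continuous (fun z : 'rV[R]_n => enorm ((z - a) *m M)).
Proof.
move=> x; apply: (continuous_comp (f := fun z => (z - a) *m M)).
  exact: vdiff_continuous (vdiff_affine a M x).
exact: continuous_enorm.
Qed.

Lemma continuous_affine_linear a N : continuous (fun z : 'rV[R]_n => dot (z - a) N).
Proof.
move=> x; apply: (@sdiff_continuous _ _ _ _ N) => e e0; near=> p.
rewrite -dotBl opprB addrA subrK (dotC N) subrr normr0.
by rewrite mulr_ge0 ?enorm_ge0 ?(ltW e0).
Unshelve. all: by end_near. Qed.

End QuadraticContinuity.

(** * Frame projections and the compact swept caps *)

Section Kontinuitaetssatz.
Context {R : realType} {n p : nat}.
Implicit Types (x z u v w N : 'rV[R]_n) (D : set 'rV[R]_n).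

Definition frame_proj (b : 'I_p -> 'rV[R]_n) : 'M[R]_n := \sum_i (b i)^T *m b i.

Lemma mul_frame_proj b v : v *m frame_proj b = \sum_i dot v (b i) *: b i.
Proof.
by rewrite /frame_proj mulmx_sumr; apply: eq_bigr => i _; rewrite mulmx_outer.
Qed.

Lemma frame_proj_mem b i : (forall i j, dot (b i) (b j) = (i == j)%:R) ->
  b i *m frame_proj b = b i.
Proof.
move=> ob; rewrite mul_frame_proj (bigD1 i)//= ob eqxx scale1r big1 ?addr0// => j ji.
by rewrite ob eq_sym (negPf ji) scale0r.
Qed.

Lemma frame_proj_normal b N : (forall i, dot (b i) N = 0) -> N *m frame_proj b = 0.
Proof.
by move=> bN; rewrite mul_frame_proj big1// => i _; rewrite dotC bN scale0r.
Qed.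

Lemma frame_proj_dot b N v : (forall i, dot (b i) N = 0) ->
  dot (v *m frame_proj b) N = 0.
Proof.
move=> bN; rewrite mul_frame_proj dot_suml big1// => i _.
by rewrite dotZl bN mulr0.
Qed.

Lemma frame_proj_idem b v : (forall i j, dot (b i) (b j) = (i == j)%:R) ->
  v *m frame_proj b *m frame_proj b = v *m frame_proj b.
Proof.
move=> ob; rewrite (mul_frame_proj b v) mulmx_suml.
by apply: eq_bigr => i _; rewrite -scalemxAl frame_proj_mem.
Qed.

(* A [p]-dimensional cap of paraboloid through [x0], bent towards [-N] by
   [- q v], swept along the segment of length [t1] in the direction [-N]. *)
Definition swept_cap (b : 'I_p -> 'rV[R]_n) x0 N (q : 'rV[R]_n -> R) (del t1 : R) :
    set 'rV[R]_n :=
  [set x | exists v t, [/\ v *m frame_proj b = v, enorm v <= del, 0 <= t <= t1 &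
                           x = x0 + v + (q v - t) *: N]].

Lemma swept_cap_coord b x0 N (q : 'rV[R]_n -> R) v (t : R) :
  (forall i, dot (b i) N = 0) -> enorm N = 1 -> v *m frame_proj b = v ->
  (x0 + v + (q v - t) *: N - x0) *m frame_proj b = v /\
  dot (x0 + v + (q v - t) *: N - x0) N = q v - t.
Proof.
move=> bN N1 vb; rewrite addrAC (addrC x0) addrK; split.
  by rewrite mulmxDl vb -scalemxAl frame_proj_normal// scaler0 addr0.
by rewrite dotDl dotZl -[dot N N]sqr_enorm N1 expr1n mulr1 -vb frame_proj_dot// add0r.
Qed.

(** The parameters v and t are recovered continuously from the point, by its projection on the frame
    and its height along N, so the cap is cut out by non-strict inequalities. *)
Lemma compact_swept_cap b x0 N M (del t1 : R) :
  (forall i j, dot (b i) (b j) = (i == j)%:R) ->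
  (forall i, dot (b i) N = 0) -> enorm N = 1 ->
  compact (swept_cap b x0 N (fun v => dot (v *m M) v / 2) del t1).
Proof.
move=> ob bN N1; set q := fun v => dot (v *m M) v / 2.
set P := frame_proj b.
have E : swept_cap b x0 N q del t1 =
    [set x | enorm ((x - x0) *m (1%:M - P - N^T *m N)) <= 0] `&`
    [set x | enorm ((x - x0) *m P) <= del] `&`
    ([set x | dot (x - x0) N - dot ((x - x0) *m (P *m M)) ((x - x0) *m P) / 2 <= 0] `&`
    [set x | dot ((x - x0) *m (P *m M)) ((x - x0) *m P) / 2 - dot (x - x0) N <= t1]).
  apply/seteqP; split=> x /=.
    move=> [v [t [vb vd /andP[t0 tt] ->]]].
    have [E1 E2] := @swept_cap_coord b x0 N q v t bN N1 vb.
    rewrite mulmxA -/P in E1 *; rewrite E1 E2 !mulmxBr mulmx1 mulmx_outer E1 E2.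
    have -> : x0 + v + (q v - t) *: N - x0 - v - (q v - t) *: N = 0.
      by rewrite (addrAC _ _ (- x0)) (addrC x0) addrK (addrC v) addrK subrr.
    by rewrite enorm0 /q; split; split=> //; lra.
  rewrite mulmxA !mulmxBr mulmx1 mulmx_outer => -[[e0 ud] [h1 h2]].
  have e1 : x - x0 - (x - x0) *m P - dot (x - x0) N *: N = 0.
    by apply: enorm_eq0; apply/eqP; rewrite eq_le e0 enorm_ge0.
  exists ((x - x0) *m P), (q ((x - x0) *m P) - dot (x - x0) N).
  split=> //; first exact: frame_proj_idem.
    by rewrite /q; apply/andP; split; lra.
  rewrite subKr; apply/eqP; rewrite -subr_eq0 -e1.
  by rewrite !opprD !addrA.
have cN := @continuous_affine_linear R n x0 N.
have cQ := @continuous_affine_dot R n x0 (P *m M) P.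
have cQ2 : continuous (fun z : 'rV[R]_n =>
   dot ((z - x0) *m (P *m M)) ((z - x0) *m P) / 2).
  move=> z; apply: (@continuousM _ _ (fun z => dot ((z - x0) *m (P *m M)) ((z - x0) *m P)) (cst 2^-1) z (cQ z)).
  exact: cst_continuous.
apply: bounded_closed_compact.
  have [C C0 HC] := mulmx_enorm_bound M.
  apply/bounded_enormP; exists (enorm x0 + del + ((C * (del * del)) / 2 + t1)).
  move=> _ [v [t [vb vd /andP[t0 tt] ->]]].
  apply: le_trans (ler_enormD _ _) _; apply: lerD.
    by apply: le_trans (ler_enormD _ _) _; rewrite lerD2l.
  rewrite enormZ N1 mulr1; apply: le_trans (ler_normB _ _) _.
  apply: lerD; last by rewrite ger0_norm.
  rewrite /q normrM [`|2^-1|]ger0_norm// ler_pM2r//.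
  apply: le_trans (norm_dot_le _ _) _.
  apply: le_trans (ler_wpM2r (enorm_ge0 v) (HC v)) _.
  by rewrite -mulrA ler_wpM2l//; apply: ler_pM; rewrite ?enorm_ge0.
rewrite E; apply: closedI; apply: closedI.
- exact/closed_sublevel/continuous_affine_enorm.
- exact/closed_sublevel/continuous_affine_enorm.
- by apply: closed_sublevel => z; exact: (continuousB (cN z) (cQ2 z)).
- by apply: closed_sublevel => z; exact: (continuousB (cQ2 z) (cN z)).
Qed.

End Kontinuitaetssatz.

(** * Nonpositive trace of the Hessian of the distance on tangent p-planes *)

Section LeviTangent.
Context {R : realType} {n p : nat}.
Implicit Types (x z u v w : 'rV[R]_n) (D : set 'rV[R]_n).

(** The height (eta |v|^2 - H(v, v)) / 2 cancels the second-order term of the distance and leaves a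
    gain eta |v|^2 / 2, of which the Taylor error takes at most half. Descending by t costs at most
    t, the distance being 1-Lipschitz. *)
Lemma cap_distance D x0 g H N M (eta : R) : ~` D !=set0 -> 0 < eta ->
  (\forall z \near x0, sdiff (bdist D) z (g z)) -> vdiff g x0 H -> g x0 = N ->
  enorm N = 1 -> N *m H = 0 -> (forall u v, dot (u *m H) v = dot (v *m H) u) ->
  M = eta%:M - H ->
  exists2 del0, 0 < del0 & forall v t, dot v N = 0 -> enorm v <= del0 -> 0 <= t ->
    bdist D x0 + eta / 4 * dot v v - t <=
    bdist D (x0 + v + (dot (v *m M) v / 2 - t) *: N).
Proof.
move=> D0 eta0 Hg HH gN N1 NH symH ME.
have [CH CH0 HCH] := mulmx_enorm_bound H.
pose c := eta + CH; have c0 : 0 < c by rewrite /c; lra.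
have e8 : 0 < eta / 8 by rewrite divr_gt0.
have /nbhs_enormP[r r0 Hr] := sdiff_taylor2 Hg HH e8.
(* The bound 1 / c gives |q| <= |v|, hence a displacement of at most 2 |v|; the bound r / 4 then
   keeps it in the Taylor neighbourhood. *)
exists (Order.min (1 / c) (r / 4)); first by rewrite lt_min !divr_gt0.
move=> v t vN; rewrite le_min => /andP[vc vr] t0.
have dvv : dot v v = enorm v ^+ 2 by rewrite sqr_enorm.
have qE : dot (v *m M) v = eta * dot v v - dot (v *m H) v.
  by rewrite ME mulmxBr mul_mx_scalar dotBl dotZl.
pose q := dot (v *m M) v / 2.
have qle : `|q| <= enorm v.
  rewrite /q normrM [`|2^-1|]ger0_norm//.
  have : `|dot (v *m M) v| <= c * enorm v * enorm v.
    rewrite qE /c mulrDl mulrDl; apply: le_trans (ler_normB _ _) _; apply: lerD.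
      by rewrite ger0_norm ?mulr_ge0 ?dot_ge0 ?(ltW eta0)// dvv expr2 mulrA.
    apply: le_trans (norm_dot_le _ _) _.
    by rewrite ler_wpM2r ?enorm_ge0.
  have : c * enorm v <= 1 by rewrite mulrC -ler_pdivlMr.
  by have := enorm_ge0 v; nra.
have qE2 : q = (eta * dot v v - dot (v *m H) v) / 2 by rewrite /q qE.
have lip : bdist D (x0 + v + q *: N) - t <= bdist D (x0 + v + (q - t) *: N).
  have := dist_to_lip (x0 + v + q *: N) (x0 + v + (q - t) *: N) D0.
  have -> : x0 + v + q *: N - (x0 + v + (q - t) *: N) = t *: N.
    by rewrite scalerBl; apply/rowP => i; rewrite !mxE; ring.
  by rewrite enormZ N1 mulr1 (ger0_norm t0) ler_norml /bdist => /andP[_ ?]; lra.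
apply: le_trans lip; rewrite lerD2r.
set h := v + q *: N.
have hE : x0 + v + q *: N = x0 + h by rewrite addrA.
have hN : dot N h = q.
  by rewrite dotDr dotZr -[dot N N]sqr_enorm N1 expr1n (dotC N) vN add0r mulr1.
have hH : dot (h *m H) h = dot (v *m H) v.
  by rewrite mulmxDl -scalemxAl NH scaler0 addr0 dotDr dotZr symH NH dot0l mulr0 addr0.
have hh : enorm h ^+ 2 <= 2 * dot v v.
  rewrite sqr_enorm dotDl !dotDr !dotZl !dotZr (dotC N) vN -[dot N N]sqr_enorm N1.
  rewrite dvv; have : q ^+ 2 <= enorm v ^+ 2.
    by rewrite -(real_normK (num_real q)) ler_pXn2r ?nnegrE ?enorm_ge0.
  lra.
have zE : x0 + h - x0 = h by rewrite addrAC subrr add0r.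
have hr : enorm (x0 + h - x0) < r.
  rewrite zE; apply: le_lt_trans (ler_enormD _ _) _.
  rewrite enormZ N1 mulr1; lra.
have := Hr _ hr; rewrite zE gN hN hH ler_norml hE => /andP[h1 _].
have := dot_ge0 v; nra.
Qed.

Lemma levi_tangent D rho x0 g H N (b : 'I_p -> 'rV[R]_n) :
  open D -> ~` D !=set0 -> strongly_p_psh p D rho -> exhaustion D rho -> D x0 ->
  (\forall z \near x0, sdiff (bdist D) z (g z)) -> vdiff g x0 H -> g x0 = N ->
  enorm N = 1 -> ~ D (x0 - bdist D x0 *: N) -> N *m H = 0 ->
  (forall u v, dot (u *m H) v = dot (v *m H) u) ->
  (forall i j, dot (b i) (b j) = (i == j)%:R) -> (forall i, dot (b i) N = 0) ->
  \sum_i dot (b i *m H) (b i) <= 0.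
Proof.
move=> oD D0 psh exh Dx0 Hg HH gN N1 nDy NH symH ob bN.
rewrite leNgt; apply/negP; set T := \sum_i _ => T0.
have [CH CH0 HCH] := mulmx_enorm_bound H.
(* Small enough for the trace p eta - T of M to be at most - T / 2. *)
pose eta := T / (2 * (p%:R + 1)).
have p1 : 0 < p%:R + 1 :> R by rewrite ltr_wpDl.
have eta0 : 0 < eta by rewrite divr_gt0// mulr_gt0.
pose c := eta + CH; have c0 : 0 < c by rewrite /c; lra.
have e4 : 0 < eta / 4 by rewrite divr_gt0.
have [M ME] : exists M, M = eta%:M - H by eexists.
have [del0 del00 Hd] := cap_distance D0 eta0 Hg HH gN N1 NH symH ME.
have qE v w : dot (v *m M) w = eta * dot v w - dot (v *m H) w.
  by rewrite ME mulmxBr mul_mx_scalar dotBl dotZl.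
have qC v : `|dot (v *m M) v| <= c * dot v v.
  rewrite qE /c mulrDl; apply: le_trans (ler_normB _ _) _; apply: lerD.
    by rewrite ger0_norm// mulr_ge0 ?dot_ge0 ?(ltW eta0).
  apply: le_trans (norm_dot_le _ _) _.
  by rewrite -sqr_enorm expr2 mulrA ler_wpM2r ?enorm_ge0.
have trM : \sum_i dot (b i *m M) (b i) <= - (T / 2).
  have -> : \sum_i dot (b i *m M) (b i) = p%:R * eta - T.
    under eq_bigr => i _ do rewrite qE ob eqxx mulr1.
    by rewrite sumrB sumr_const card_ord mulr_natl.
  have : p%:R * eta <= (p%:R + 1) * eta by rewrite ler_wpM2r ?(ltW eta0)// lerDl.
  have -> : (p%:R + 1) * eta = T / 2.
    by rewrite /eta; field; rewrite gt_eqF.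
  lra.
(* A cap of radius at most K has slopes so small that orthonormalizing the lifted frame changes the
   trace of M by at most T / 4. *)
pose K := T / (4 * (p%:R + 1) * c ^+ 3).
have K0 : 0 < K by rewrite divr_gt0// !mulr_gt0// exprn_gt0.
pose del := Order.min (Order.min 1 del0) K.
have del_gt0 : 0 < del by rewrite !lt_min ltr01 del00.
have del1 : del <= 1 by rewrite !ge_min lexx.
have deld : del <= del0 by rewrite !ge_min lexx orbT.
have delK : del <= K by rewrite ge_min lexx orbT.
pose P := frame_proj b.
have PN v : v *m P = v -> dot v N = 0 by move=> <-; exact: frame_proj_dot.
pose q v := dot (v *m M) v / 2.
pose S t1 := swept_cap b x0 N q del t1.
have cS t1 : compact (S t1) by exact: compact_swept_cap.
have Sd v (t : R) : v *m P = v -> enorm v <= del -> 0 <= t ->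
    bdist D x0 + eta / 4 * dot v v - t <= bdist D (x0 + v + (q v - t) *: N).
  by move=> vb vd t0; apply: Hd => //; [exact: PN|exact: le_trans deld].
have inD z : 0 < bdist D z -> D z.
  by move=> z0; apply: (@dist_to_ball _ _ _ z); rewrite subrr enorm0.
pose d0 := bdist D x0.
have d00 : 0 < d0 by exact: dist_to_gt0.
(* K1 is the rim |v| = del together with the top t = 0 of the full sweep. On the rim the gain eta /
   4 |v|^2 is positive and on the top the depth is at least d0, so K1 lies in D although the full
   sweep reaches the boundary. *)
pose K1 := S d0 `&` ([set x | - enorm ((x - x0) *m P) <= - del] `|`
  [set x | dot ((x - x0) *m (P *m M)) ((x - x0) *m P) / 2 - dot (x - x0) N <= 0]).
have cQ2 : continuous (fun z : 'rV[R]_n =>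
   dot ((z - x0) *m (P *m M)) ((z - x0) *m P) / 2).
  move=> z; apply: (@continuousM _ _
    (fun z => dot ((z - x0) *m (P *m M)) ((z - x0) *m P)) (cst 2^-1) z).
    exact: continuous_affine_dot.
  exact: cst_continuous.
have cK1 : compact K1.
  apply: (subclosed_compact _ (cS d0)); last by move=> z [].
  apply: closedI; first exact: (compact_closed (@norm_hausdorff _ _) (cS d0)).
  apply: closedU; apply: closed_sublevel => z.
    exact: (cvgN (@continuous_affine_enorm R n x0 P z)).
  exact: (continuousB (cQ2 z) (@continuous_affine_linear R n x0 N z)).
have coords v (t : R) : v *m P = v ->
   (x0 + v + (q v - t) *: N - x0) *m P = v /\
   dot (x0 + v + (q v - t) *: N - x0) N = q v - t.
  by move=> vb; exact: (@swept_cap_coord _ _ _ b x0 N q).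
have K1D z : K1 z -> D z.
  move=> [[v [t [vb vd /andP[t0 td] ->]]] H1]; apply: inD.
  apply: lt_le_trans (Sd v t vb vd t0).
  have [E1 E2] := coords v t vb.
  have vv0 := dot_ge0 v.
  move: H1; rewrite /= mulmxA E1 E2 -/(q v) => -[vd'|].
    have vv : 0 < dot v v.
      by rewrite -sqr_enorm exprn_gt0// (lt_le_trans del_gt0)// -lerN2.
    have := mulr_gt0 e4 vv; rewrite /d0 in td; lra.
  by rewrite opprB subrKC => t00; have := mulr_ge0 (ltW e4) vv0; rewrite /d0 in d00; lra.
(* [rho] is bounded on the sides of the swept region but blows up at the
   boundary point below [x0], so it has an interior maximum. *)
have bexh c1 : compact [set x | D x /\ rho x <= c1] by exact: exh.
have rhoC z : D z -> {for z, continuous rho}.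
  by move=> Dz; case: psh => cl _; have [] := cl [::] isT z Dz.
have [c1 Hc1] : exists c1, forall z, K1 z -> rho z <= c1.
  have [K1n|K1n] := pselect (K1 !=set0); last first.
    by exists 0 => z K1z; exfalso; apply: K1n; exists z.
  have [|z /[!inE] _ Hz] := @EVT_max_rV R n rho K1 K1n cK1.
    apply: continuous_in_subspaceT => z /[!inE] K1z; exact/rhoC/K1D.
  by exists (rho z) => w K1w; apply: Hz; rewrite inE.
have clS : closed [set x | D x /\ rho x <= c1].
  exact: (compact_closed (@norm_hausdorff _ _) (bexh c1)).
have [r r0 Hr] : exists2 r, 0 < r & forall z, enorm (z - (x0 - d0 *: N)) < r ->
    ~ (D z /\ rho z <= c1).
  by apply: open_enormP (closed_openC clS) _ => -[].
(* The sweep stops before the boundary, but so near to it that the vertex lies where rho exceeds its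
   bound c1 on K1. *)
pose t1 := d0 - Order.min (r / 2) (d0 / 2).
have mr : Order.min (r / 2) (d0 / 2) < r by rewrite gt_min; apply/orP; left; lra.
have md : Order.min (r / 2) (d0 / 2) <= d0 / 2 by rewrite ge_min lexx orbT.
have m0 : 0 < Order.min (r / 2) (d0 / 2) by rewrite lt_min !divr_gt0.
have t1d : t1 < d0 by rewrite /t1; lra.
have t10 : 0 < t1 by rewrite /t1; lra.
have SD z : S t1 z -> D z.
  move=> [v [t [vb vd /andP[t0 td] ->]]]; apply: inD.
  apply: lt_le_trans (Sd v t vb vd t0).
  have := mulr_ge0 (ltW e4) (dot_ge0 v); rewrite -/d0; lra.
pose x1 := x0 + 0 + (q 0 - t1) *: N.
have q0 : q 0 = 0 by rewrite /q mul0mx dot0l mul0r.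
have Sx1 : S t1 x1.
  by exists 0, t1; split; rewrite ?mul0mx ?enorm0 ?(ltW del_gt0) ?(ltW t10) ?lexx.
have rx1 : c1 < rho x1.
  rewrite ltNge; apply/negP => rc; apply: (Hr x1); last by split => //; exact: SD.
  rewrite /x1 q0 sub0r addr0.
  have -> : x0 + - t1 *: N - (x0 - d0 *: N) = (d0 - t1) *: N.
    by apply/rowP => i; rewrite !mxE; ring.
  by rewrite enormZ N1 mulr1 ger0_norm /t1; lra.
have [||z /[!inE] Sz Hz] := @EVT_max_rV R n rho (S t1) _ (cS t1).
- by exists x1.
- apply: continuous_in_subspaceT => z /[!inE] Sz; exact/rhoC/SD.
have {}Hz w : S t1 w -> rho w <= rho z by move=> Sw; apply: Hz; rewrite inE.
have Dz := SD z Sz.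
have nK1 : ~ K1 z.
  by move=> /Hc1; have := Hz _ Sx1; lra.
move: Sz => [us [ts [ub ud /andP[ts0 tst] zE]]].
have [E1 E2] := coords us ts ub; rewrite -zE in E1 E2.
have Sz0 : S d0 z.
  by exists us, ts; split=> //; rewrite ts0 (le_trans tst (ltW t1d)).
have uslt : enorm us < del.
  rewrite ltNge; apply/negP => h; apply: nK1; split=> //; left.
  by rewrite /= E1 lerN2.
have tspos : 0 < ts.
  rewrite ltNge; apply/negP => h; apply: nK1; split=> //; right.
  by rewrite /= mulmxA E1 E2 -/(q us) opprB subrKC.
have [Hs1 Hs2] := class_C2_diff oD (proj1 psh) Dz.
have Hs1n : \forall y \near z, sdiff rho y (grad rho y).
  have : \forall y \near z, D y by exact: open_nbhs_nbhs.
  by apply: filterS => y Dy; have [] := class_C2_diff oD (proj1 psh) Dy.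
pose gam := dot (grad rho z) N.
(* As ts > 0, the point can be moved in the direction N without leaving the sweep. *)
have gam0 : gam <= 0.
  apply: (first_order_max tspos Hs1) => s s0 sts; apply: Hz.
  exists us, (ts - s); split=> //; first by rewrite subr_ge0 (ltW sts) (le_trans _ tst)// gerBl ltW.
  by rewrite zE opprB addrA addrAC [in RHS]scalerDl addrA.
have symM u v : dot (u *m M) v = dot (v *m M) u by rewrite !qE symH (dotC u).
pose Rr := hessian rho z.
(* The curve s |-> us + s w is lifted to the leaf t = ts through z; its velocity is w + (us M).w N
   and its acceleration is a multiple of N. *)
have key w : w *m P = w ->
    gam * (dot (w *m M) w / 2) + dot ((w + dot (us *m M) w *: N) *m Rr)
      (w + dot (us *m M) w *: N) / 2 <= 0.
  move=> wP; have w1 : 0 < 1 + enorm w by rewrite ltr_pwDl// enorm_ge0.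
  have s00 : 0 < (del - enorm us) / (1 + enorm w) by rewrite divr_gt0// subr_gt0.
  have -> : gam * (dot (w *m M) w / 2) = dot (grad rho z) ((dot (w *m M) w / 2) *: N).
    by rewrite dotZr mulrC.
  apply: (second_order_max s00 Hs1n Hs2) => s sl; apply: Hz.
  exists (us + s *: w), ts; split; last 2 first.
  - by rewrite ts0.
  - have -> : q (us + s *: w) = q us + s * dot (us *m M) w + s ^+ 2 * (dot (w *m M) w / 2).
      by rewrite /q mulmxDl -scalemxAl dotDl !dotDr !dotZl !dotZr (symM w us); field.
    rewrite {1}zE; move: (q us) (dot (us *m M) w) (dot _ _ / 2) => A B C.
    by apply/rowP => i; rewrite !mxE; ring.
  - by rewrite mulmxDl ub -scalemxAl wP.
  - apply: le_trans (ler_enormD _ _) _; rewrite enormZ.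
    move: sl; rewrite ltr_pdivlMr// mulrDr mulr1 => sl; have := normr_ge0 s; lra.
(* These are the slopes of the leaf at z: b i lifts to b i + cc i N, and the lifted frame has Gram
   matrix I + cc cc^T. *)
pose cc i := dot (us *m M) (b i).
pose sig := \sum_l cc l ^+ 2.
have enb i : enorm (b i) = 1 by rewrite /enorm ob eqxx sqrtr1.
have usM : enorm (us *m M) <= c * del.
  apply: (@le_trans _ _ (c * enorm us)); last by rewrite ler_pM2l// ltW.
  rewrite ME mulmxBr mul_mx_scalar /c mulrDl; apply: le_trans (ler_enormB _ _) _.
  by apply: lerD => //; rewrite enormZ ger0_norm// ltW.
have cdel : 0 < c * del by rewrite mulr_gt0.
have sig0 : 0 <= sig by apply: sumr_ge0 => l _; rewrite sqr_ge0.
have sigle : sig <= p%:R * (c * del) ^+ 2.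
  have -> : p%:R * (c * del) ^+ 2 = \sum_(l < p) (c * del) ^+ 2.
    by rewrite sumr_const card_ord mulr_natl.
  apply: ler_sum => l _; rewrite -(real_normK (num_real (cc l))).
  rewrite ler_pXn2r ?nnegrE ?(ltW cdel)//.
  by apply: le_trans (norm_dot_le _ _) _; rewrite enb mulr1.
have csig : c * sig <= T / 4.
  have h1 : c * sig <= c * (p%:R * (c * del) ^+ 2) by rewrite ler_pM2l.
  apply: le_trans h1 _.
  have c3 : 0 < c ^+ 3 by rewrite exprn_gt0.
  apply: (@le_trans _ _ ((p%:R + 1) * c ^+ 3 * del)).
    have -> : c * (p%:R * (c * del) ^+ 2) = p%:R * (c ^+ 3 * (del * del)) by ring.
    have dd : 0 <= del * del by rewrite mulr_ge0// ltW.
    rewrite -mulrA; apply: (ler_pM (ler0n _ _) (mulr_ge0 (ltW c3) dd)).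
      by rewrite lerDl.
    by rewrite ler_pM2l// ler_piMl// ltW.
  apply: (@le_trans _ _ ((p%:R + 1) * c ^+ 3 * K)).
    by rewrite ler_pM2l// mulr_gt0.
  by rewrite /K le_eqVlt; apply/orP; left; apply/eqP; field; rewrite gt_eqF//= gt_eqF.
have s1 : 0 < 1 + 1 * sig by rewrite mul1r ltr_pwDl.
have [beta hbeta] := gram_beta s1.
pose w0 := \sum_l cc l *: b l.
pose w_ i := b i - (beta * cc i) *: w0.
pose BW i := b i + cc i *: N.
(* W_ is an orthonormal frame tangent to the leaf at z, and w_ is its horizontal part. *)
pose W_ i := BW i - (beta * cc i) *: \sum_l cc l *: BW l.
have oW i j : dot (W_ i) (W_ j) = (i == j)%:R.
  apply: (gram_correction i j s1 hbeta) => k l.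
  rewrite /BW dotDl !dotDr !dotZl !dotZr ob bN (dotC N) bN -[dot N N]sqr_enorm N1.
  by rewrite expr1n mulr1 !mulr0 add0r addr0 mul1r.
have lin (u v : 'rV[R]_n) (a e s : R) :
    u + a *: N - s *: (v + e *: N) = u - s *: v + (a - s * e) *: N.
  by apply/rowP => k; rewrite !mxE; ring.
have WE i : W_ i = w_ i + dot (us *m M) (w_ i) *: N.
  have -> : dot (us *m M) (w_ i) = cc i - beta * cc i * sig.
    rewrite /w_ dotBr dotZr /w0 dot_sumr; congr (_ - _ * _).
    by apply: eq_bigr => l _; rewrite dotZr -expr2.
  have -> : W_ i = BW i - (beta * cc i) *: (w0 + sig *: N).
    congr (_ - _ *: _); rewrite /w0 /sig scaler_suml -big_split; apply: eq_bigr => l _ /=.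
    by rewrite scalerDr scalerA -expr2.
  exact: lin.
have wP i : w_ i *m P = w_ i.
  rewrite /w_ mulmxBl -scalemxAl frame_proj_mem//; congr (_ - _ *: _).
  rewrite /w0 mulmx_suml; apply: eq_bigr => l _.
  by rewrite -scalemxAl frame_proj_mem.
have trW : 0 < \sum_i dot (W_ i *m Rr) (W_ i) by exact: (psh_trace psh Dz oW).
(* The trace of M on the frame b is at most - T / 2, and the correction is at most c sig <= T /
   4. *)
have trw : \sum_i dot (w_ i *m M) (w_ i) <= 0.
  rewrite (gram_trace b cc M beta) -/sig -/w0 hbeta.
  have w0w0 : dot w0 w0 = sig.
    rewrite {1}/w0 dot_suml; apply: eq_bigr => l _.
    rewrite dotZl /w0 dot_sumr (bigD1 l)//= dotZr ob eqxx mulr1 big1 ?addr0 ?expr2//.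
    by move=> k kl; rewrite dotZr ob eq_sym (negPf kl) mulr0.
  have h1 : `|1 / (1 + 1 * sig) * dot (w0 *m M) w0| <= c * sig.
    rewrite mul1r normrM ger0_norm ?invr_ge0 ?(ltW s1)//.
    rewrite mulrC ler_pdivrMr//; apply: le_trans (qC w0) _; rewrite w0w0.
    by rewrite mul1r mulrDr mulr1 lerDl !mulr_ge0// ltW.
  have {h1} [h1 _] := andP (etrans (esym (ler_norml _ _)) h1).
  lra.
(* Summing [key] gives the contradiction: gam and the trace of M are both nonpositive, so their
   product is nonnegative, while the Hessian trace of rho is positive. *)
have sumkey : \sum_i (gam * (dot (w_ i *m M) (w_ i) / 2) +
    dot (W_ i *m Rr) (W_ i) / 2) <= 0.
  by apply: sumr_le0 => i _; rewrite WE; exact: key.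
rewrite big_split /= -big_distrr /= -!big_distrl /= in sumkey.
have : 0 <= gam * (\sum_i dot (w_ i *m M) (w_ i) / 2).
  by rewrite mulr_le0 // -big_distrl /= pmulr_lle0.
rewrite -big_distrl /=; lra.
Qed.

End LeviTangent.

(** * From tangent frames to arbitrary orthonormal frames *)

Section GeneralFrames.
Context {R : realType} {n p : nat}.
Implicit Types (x z u v w N : 'rV[R]_n) (H : 'M[R]_n) (b : 'I_p -> 'rV[R]_n).

(* A frame making a small angle with the tangent space is rotated into it; for
   a large angle the right-hand side dominates trivially. *)
Lemma levi_general N H (C : R) : enorm N = 1 -> N *m H = 0 -> 0 <= C ->
  (forall u v, dot (u *m H) v = dot (v *m H) u) ->
  (forall v, enorm (v *m H) <= C * enorm v) ->
  (forall b, (forall i j, dot (b i) (b j) = (i == j)%:R) ->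
    (forall i, dot (b i) N = 0) -> \sum_i dot (b i *m H) (b i) <= 0) ->
  forall b, (forall i j, dot (b i) (b j) = (i == j)%:R) ->
    \sum_i dot (b i *m H) (b i) <= (2 * p%:R + 1) * C * \sum_i dot (b i) N ^+ 2.
Proof.
move=> N1 NH C0 symH HC tang b ob.
pose c i := dot (b i) N; pose s := \sum_i c i ^+ 2.
have s0 : 0 <= s by apply: sumr_ge0 => i _; exact: sqr_ge0.
have enb i : enorm (b i) = 1 by rewrite /enorm ob eqxx sqrtr1.
have p0 : 0 <= p%:R :> R by [].
have pCs : 0 <= p%:R * C * s by rewrite !mulr_ge0.
have [s2|s2] := leP (1 / 2) s.
  have h1 : \sum_i dot (b i *m H) (b i) <= p%:R * C.
    have -> : p%:R * C = \sum_(i < p) C by rewrite sumr_const card_ord mulr_natl.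
    apply: ler_sum => i _; apply: le_trans (dot_le_enorm _ _) _.
    by have := HC (b i); rewrite enb !mulr1.
  have h2 : p%:R * C * (1 / 2) <= p%:R * C * s by rewrite ler_wpM2l// mulr_ge0.
  have h3 : 0 <= C * s by rewrite mulr_ge0.
  rewrite -/s; lra.
(* Removing the components along N leaves the values of H unchanged since N H = 0. The new Gram
   matrix is I - c c^T, which is invertible because |c|^2 < 1 / 2. *)
pose b' i := b i - c i *: N.
have ob' i j : dot (b' i) (b' j) = (i == j)%:R + -1 * (c i * c j).
  rewrite /b' dotBl !dotBr !dotZl !dotZr ob (dotC N) -/(c i) -/(c j).
  by rewrite -[dot N N]sqr_enorm N1 expr1n; ring.
have b'N i : dot (b' i) N = 0.
  by rewrite /b' dotBl dotZl -[dot N N]sqr_enorm N1 expr1n mulr1 subrr.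
have b'H i : dot (b' i *m H) (b' i) = dot (b i *m H) (b i).
  have -> : b' i *m H = b i *m H.
    by rewrite /b' mulmxBl -(scalemxAl (c i) N) NH scaler0 subr0.
  by rewrite /b' dotBr dotZr (symH (b i) N) NH dot0l mulr0 subr0.
have ks : 0 < 1 + -1 * s by lra.
have [beta hb] := gram_beta ks.
pose w := \sum_l c l *: b' l.
have tN i : dot (b' i - (beta * c i) *: w) N = 0.
  rewrite dotBl dotZl b'N dot_suml big1 ?mulr0 ?subr0// => l _.
  by rewrite dotZl b'N mulr0.
have h1 := tang _ (fun i j => gram_correction i j ks hb ob') tN.
rewrite (gram_trace b' c H beta) -/s -/w hb in h1.
have ww : dot w w = s * (1 + -1 * s).
  have wN l : dot w (b' l) = c l * (1 + -1 * s).
    rewrite /w dot_suml (bigD1 l)//= dotZl ob' eqxx.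
    under eq_bigr => i il do rewrite dotZl ob' (negPf il) add0r.
    have -> : \sum_(i < p | i != l) c i * (-1 * (c i * c l)) =
       - c l * (s - c l ^+ 2).
      have -> : s = c l ^+ 2 + \sum_(i < p | i != l) c i ^+ 2 by rewrite /s (bigD1 l).
      rewrite addrAC subrr add0r big_distrr /=.
      by apply: eq_bigr => i _; ring.
    by rewrite /= mulr1n; ring.
  rewrite {2}/w dot_sumr; under eq_bigr => l _ do rewrite dotZr wN mulrA -expr2.
  by rewrite -big_distrl.
have wH : - (C * (s * (1 + -1 * s))) <= dot (w *m H) w.
  rewrite -ww -sqr_enorm; have := norm_dot_le (w *m H) w.
  rewrite ler_norml => /andP[h _]; apply: le_trans h; rewrite lerN2 expr2 mulrA.
  by rewrite ler_wpM2r ?enorm_ge0.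
have h2 : - (C * s) <= (1 + -1 * s)^-1 * dot (w *m H) w.
  by rewrite -ler_pdivrMl ?invr_gt0// invrK mulrC; move: wH; lra.
have E : \sum_i dot (b i *m H) (b i) = \sum_i dot (b' i *m H) (b' i).
  by apply: eq_bigr => i _; rewrite b'H.
rewrite E -/s; move: h1; rewrite mulN1r mulNr opprK; lra.
Qed.

End GeneralFrames.

(** * Rules for assembling the exhaustion function; powers of the positive part *)

Section Exhaustion.
Context {R : realType} {n : nat}.
Implicit Types (x z u v w N : 'rV[R]_n) (f : 'rV[R]_n -> R).

Lemma sdiff_near_eq f f' x g : (\forall z \near x, f z = f' z) ->
  sdiff f x g -> sdiff f' x g.
Proof.
move=> E H e e0; apply: filterS2 (near_pair E) (H e e0) => p [E1 E2].
by rewrite E1 E2.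
Qed.

Lemma vdiff_near_eq (f f' : 'rV[R]_n -> 'rV[R]_n) x A : (\forall z \near x, f z = f' z) ->
  vdiff f x A -> vdiff f' x A.
Proof.
move=> E H e e0; apply: filterS2 (near_pair E) (H e e0) => p [E1 E2].
by rewrite E1 E2.
Qed.

Lemma sdiffD f f' x g g' : sdiff f x g -> sdiff f' x g' ->
  sdiff (fun z => f z + f' z) x (g + g').
Proof.
move=> H1 H2 e e0; have e2 : 0 < e / 2 by rewrite divr_gt0.
apply: filterS2 (H1 _ e2) (H2 _ e2) => p h1 h2.
rewrite dotDl [X in _ <= X * _](splitr e) mulrDl.
apply: le_trans (lerD h1 h2); apply: le_trans (ler_normD _ _).
by rewrite le_eqVlt; apply/orP; left; apply/eqP; congr (`|_|); ring.
Qed.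

Lemma vdiffD (f f' : 'rV[R]_n -> 'rV[R]_n) x A B : vdiff f x A -> vdiff f' x B ->
  vdiff (fun z => f z + f' z) x (A + B).
Proof.
move=> H1 H2 e e0; have e2 : 0 < e / 2 by rewrite divr_gt0.
apply: filterS2 (H1 _ e2) (H2 _ e2) => p h1 h2.
rewrite mulmxDr [X in _ <= X * _](splitr e) mulrDl.
apply: le_trans (lerD h1 h2); apply: le_trans (ler_enormD _ _).
rewrite le_eqVlt; apply/orP; left; apply/eqP; congr enorm.
by move: (_ *m A) (_ *m B) => a b; apply/rowP => i; rewrite !mxE; ring.
Qed.

Lemma vdiff_scale (k : 'rV[R]_n -> R) (f : 'rV[R]_n -> 'rV[R]_n) x gk A :
  sdiff k x gk -> vdiff f x A ->
  vdiff (fun z => k z *: f z) x (gk^T *m f x + k x *: A).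
Proof.
move=> Hk Hf; apply: coord_vdiff => j.
have -> : (fun z => (k z *: f z) 0 j) = (fun z => k z * f z 0 j).
  by apply/funext => z; rewrite mxE.
have -> : \row_i (gk^T *m f x + k x *: A) i j = k x *: (\row_i A i j) + f x 0 j *: gk.
  apply/rowP => i; rewrite !mxE big_ord_recl big_ord0 addr0 !mxE.
  by rewrite addrC [gk _ _ * _]mulrC (ord1 ord0).
by apply: sdiffM => //; exact: vdiff_coord.
Qed.

Lemma sdiff_sqr x : sdiff (fun z => dot z z) x (2 *: x).
Proof.
move=> e e0; have e2 : 0 < e / 2 by rewrite divr_gt0.
apply: filterS (near_pair (enorm_near x e2)) => -[z w] /= [zx wx].
have -> : dot z z - dot w w - dot (2 *: x) (z - w) = dot ((z - x) + (w - x)) (z - w).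
  by rewrite !(dotDl, dotNl, dotZl, dotDr, dotNr) (dotC w z); ring.
apply: le_trans (norm_dot_le _ _) _; rewrite ler_wpM2r ?enorm_ge0//.
by have := ler_enormD (z - x) (w - x); lra.
Qed.

Lemma vdiff_double x : vdiff (fun z => 2 *: z) x (2%:M).
Proof.
move=> e e0; near=> q; rewrite mul_mx_scalar -scalerBr subrr enorm0.
by rewrite mulr_ge0 ?enorm_ge0 ?(ltW e0).
Unshelve. all: by end_near. Qed.

Definition pos (y : R) : R := Num.max y 0.

Lemma pos_ge0 y : 0 <= pos y.
Proof. by rewrite /pos le_max lexx orbT. Qed.

Lemma pos_continuous : continuous pos.
Proof.
move=> y; apply/(@cvgrPdist_lt _ _ _ (nbhs y)) => e e0.
have : \forall z \near y, `|y - z| < e.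
  by apply/nbhs_ballP; exists e.
apply: filterS => z; apply: le_lt_trans.
have pE t : pos t = (t + `|t|) / 2.
  rewrite /pos; case: (leP t 0) => t0; first by rewrite ler0_norm ?subrr ?mul0r.
  by rewrite gtr0_norm//; lra.
have -> : pos y - pos z = ((y - z) + (`|y| - `|z|)) / 2 by rewrite !pE; lra.
rewrite normrM [`|2^-1|]ger0_norm// ler_pdivrMr//.
apply: le_trans (ler_normD _ _) _; have := ler_dist_dist y z; lra.
Qed.

Lemma is_derive_pos (k : nat) (y : R) :
  is_derive y 1 (fun t => pos t ^+ k.+2) (k.+2%:R * pos y ^+ k.+1).
Proof.
have [y0|y0|->] := ltrgtP y 0.
- have -> : k.+2%:R * pos y ^+ k.+1 = 0 by rewrite /pos max_r ?ltW// expr0n mulr0.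
  apply: (@near_eq_is_derive R R R (cst (0 : R)) _ y 1).
  have : \forall t \near y, t < 0 by exact: lt_nbhsl.
  by apply: filterS => t t0; rewrite /pos max_r ?ltW// expr0n.
- have -> : k.+2%:R * pos y ^+ k.+1 = (k.+2%:R *: y ^+ k.+1) *: (1 : R).
    by rewrite /pos max_l ?ltW// -[RHS]/(_ * _ * _) mulr1.
  apply: (@near_eq_is_derive R R R (fun t : R => t ^+ k.+2) _ y 1).
    have : \forall t \near y, 0 < t by exact: lt_nbhsr.
    by apply: filterS => t t0; rewrite /pos max_l ?ltW.
  by apply: DeriveDef; [exact: exprn_derivable|rewrite exp_derive].
have -> : k.+2%:R * pos 0 ^+ k.+1 = 0 by rewrite /pos maxxx expr0n mulr0.
suff Hc : (fun h => h^-1 *: (pos (h *: 1 + 0) ^+ k.+2 - pos 0 ^+ k.+2)) @ (0 : R)^' --> (0 : R).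
  by apply: DeriveDef; [apply/cvg_ex; exists 0|exact: cvg_lim].
apply/cvgrPdist_le => e e0; near=> h.
have h0 : h != 0 by near: h; exact: nbhs_dnbhs_neq.
have h1 : `|h| < Num.min 1 e.
  near: h; apply: dnbhs0_lt; by rewrite lt_min ltr01.
rewrite sub0r normrN [h *: 1]mulr1 addr0 {2}/pos maxxx expr0n subr0.
rewrite -[_ *: _]/(_ * _) normrM normfV ler_pdivrMl ?normr_gt0//.
have ph : `|pos h| <= `|h|.
  by rewrite ger0_norm ?pos_ge0// /pos ge_max ler_norm normr_ge0.
rewrite normrX exprS; apply: ler_pM => //.
apply: (@le_trans _ _ (`|h| ^+ 1)).
  apply: (@le_trans _ _ (`|h| ^+ k.+1)); first by rewrite ler_pXn2r// nnegrE.
  by rewrite ler_wiXn2l//; move: h1; rewrite lt_min => /andP[/ltW].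
by rewrite expr1; move: h1; rewrite lt_min => /andP[_ /ltW].
Unshelve. all: by end_near. Qed.

End Exhaustion.

(** * The one-variable barrier and its derivatives *)

Section Barrier.
Context {R : realType}.
Implicit Types (m s u : R).

(* [barrier m s] is C^2 on ]s, +oo[, tends to infinity at [s], vanishes beyond
   [s + m], and its second derivative dominates the first one by the factor
   [2 / m]. *)
Definition barrier m s u : R := pos (m * (u - s)^-1 - 1) ^+ 3.

Definition dbarrier m s u : R := - (3 * m) * (pos (m * (u - s)^-1 - 1) ^+ 2 * (u - s)^-1 ^+ 2).

Definition ddbarrier m s u : R :=
  6 * m ^+ 2 * (pos (m * (u - s)^-1 - 1) * (u - s)^-1 ^+ 4) +
  6 * m * (pos (m * (u - s)^-1 - 1) ^+ 2 * (u - s)^-1 ^+ 3).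

Lemma is_derive_invB s u : s < u -> is_derive u 1 (fun t => (t - s)^-1) (- (u - s)^-1 ^+ 2).
Proof.
move=> su; have us0 : u - s != 0 by rewrite subr_eq0 gt_eqF.
have -> : - (u - s)^-1 ^+ 2 = - (u - s) ^- 2 *: (1 : R).
  by rewrite -[RHS]/(_ * 1) mulr1 exprVn.
apply: (@is_deriveV R (fun t => t - s)) => //.
have -> : (fun t => t - s) = (id - cst s :> (R -> R)) by apply/funext.
by apply: is_derive_eq; rewrite subr0.
Qed.

Lemma is_derive_height m s u : s < u ->
  is_derive u 1 (fun t => m * (t - s)^-1 - 1) (- m * (u - s)^-1 ^+ 2).
Proof.
move=> su; have H := is_derive_invB su.
have -> : (fun t => m * (t - s)^-1 - 1) = (cst m * (fun t => (t - s)^-1) - cst 1 :> (R -> R)).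
  by apply/funext.
apply: is_derive_eq.
by rewrite scaler0 addr0 subr0 -[_ *: _]/(_ * _); rewrite /=; ring.
Qed.

Lemma is_derive_barrier m s u : s < u -> is_derive u 1 (barrier m s) (dbarrier m s u).
Proof.
move=> su.
have := @is_derive1_comp R (fun t => pos t ^+ 3) (fun t => m * (t - s)^-1 - 1) u _ _
  (is_derive_pos 1 (m * (u - s)^-1 - 1)) (is_derive_height m su).
have -> : 3%:R * pos (m * (u - s)^-1 - 1) ^+ 2 * (- m * (u - s)^-1 ^+ 2) = dbarrier m s u.
  by rewrite /dbarrier; ring.
by [].
Qed.

Lemma is_derive_dbarrier m s u : s < u ->
  is_derive u 1 (dbarrier m s) (ddbarrier m s u).
Proof.
move=> su.
have H1 := @is_derive1_comp R (fun t => pos t ^+ 2) (fun t => m * (t - s)^-1 - 1) u _ _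
  (is_derive_pos 0 (m * (u - s)^-1 - 1)) (is_derive_height m su).
have H2 := is_derive_invB su.
have -> : dbarrier m s = (cst (- (3 * m)) *
   (((fun t => pos t ^+ 2) \o (fun t => m * (t - s)^-1 - 1)) *
    ((fun t => (t - s)^-1) * (fun t => (t - s)^-1))) :> (R -> R)).
  by apply/funext => t; rewrite /dbarrier /= expr2.
apply: is_derive_eq.
rewrite scaler0 addr0 /ddbarrier.
rewrite -[LHS]/(- (3 * m) * (pos (m * (u - s)^-1 - 1) ^+ 2 *
  ((u - s)^-1 * - (u - s)^-1 ^+ 2 + (u - s)^-1 * - (u - s)^-1 ^+ 2) +
  (u - s)^-1 * (u - s)^-1 * (2 * pos (m * (u - s)^-1 - 1) ^+ 1 * (- m * (u - s)^-1 ^+ 2)))).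
by set W := (u - s)^-1; set q := pos _; ring.
Qed.

Lemma ddbarrier_continuous m s u : s < u -> {for u, continuous (ddbarrier m s)}.
Proof.
move=> su.
have H2 : {for u, continuous (fun t => (t - s)^-1)}.
  have [/derivable1_diffP/differentiable_continuous] := is_derive_invB su.
  by [].
have H1 : {for u, continuous (fun t => pos (m * (t - s)^-1 - 1))}.
  apply: (@continuous_comp _ _ _ (fun t => m * (t - s)^-1 - 1) pos).
    have [/derivable1_diffP/differentiable_continuous] := is_derive_height m su.
    by [].
  exact: pos_continuous.
have X (f : R -> R) k : {for u, continuous f} -> {for u, continuous (fun t => f t ^+ k)}.
  move=> cf; elim: k => [|k IH]; first exact: cst_continuous.
  have -> : (fun t => f t ^+ k.+1) = (fun t => f t * f t ^+ k).
    by apply/funext => t; rewrite exprS.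
  exact: (continuousM cf IH).
have C (f : R -> R) c : {for u, continuous f} -> {for u, continuous (fun t => c * f t)}.
  move=> cf; exact: (continuousM (@cst_continuous _ _ c u) cf).
apply: (continuousD (f := fun t => 6 * m ^+ 2 * (pos (m * (t - s)^-1 - 1) * (t - s)^-1 ^+ 4))
  (g := fun t => 6 * m * (pos (m * (t - s)^-1 - 1) ^+ 2 * (t - s)^-1 ^+ 3))).
  by apply: C; exact: (continuousM H1 (X _ 4 H2)).
by apply: C; exact: (continuousM (X _ 2 H1) (X _ 3 H2)).
Qed.

Lemma dbarrier_continuous m s u : s < u -> {for u, continuous (dbarrier m s)}.
Proof.
by move=> /(is_derive_dbarrier m)[/derivable1_diffP/differentiable_continuous].
Qed.

(** The second term of [ddbarrier] is - 2 / (u - s) times [dbarrier], and where the barrier is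
    nonzero u - s < m, so that 2 / (u - s) >= 2 / m >= C. *)
Lemma barrier_dominates m s u C : 0 < m -> s < u -> C * m <= 2 ->
  dbarrier m s u <= 0 /\ 0 <= ddbarrier m s u + C * dbarrier m s u.
Proof.
move=> m0 su Cm; rewrite /dbarrier /ddbarrier.
have W0 : 0 < (u - s)^-1 by rewrite invr_gt0 subr_gt0.
move: (u - s)^-1 W0 => W W0.
have p0 := pos_ge0 (m * W - 1).
split; first by rewrite mulNr oppr_le0 !mulr_ge0 ?exprn_ge0 ?(ltW m0) ?(ltW W0).
have [h|h] := leP (m * W - 1) 0.
  have -> : pos (m * W - 1) = 0 by rewrite /pos max_r.
  by rewrite !expr0n !mul0r !mulr0 addr0.
have hW : C <= 2 * W.
  have : C * m <= 2 * W * m by lra.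
  by rewrite ler_pM2r.
move: (pos _) p0 => q q0.
have -> : 6 * m ^+ 2 * (q * W ^+ 4) + 6 * m * (q ^+ 2 * W ^+ 3) +
   C * (- (3 * m) * (q ^+ 2 * W ^+ 2)) =
   6 * m ^+ 2 * (q * W ^+ 4) + 3 * m * (q ^+ 2 * W ^+ 2) * (2 * W - C) by ring.
by rewrite addr_ge0 ?mulr_ge0 ?exprn_ge0 ?subr_ge0 ?(ltW m0) ?(ltW W0).
Qed.

Lemma barrier_far m s u : 0 < m -> s + m <= u ->
  [/\ barrier m s u = 0, dbarrier m s u = 0 & ddbarrier m s u = 0].
Proof.
move=> m0 su.
have us : 0 < u - s by lra.
have E : pos (m * (u - s)^-1 - 1) = 0.
  by rewrite /pos max_r// subr_le0 ler_pdivrMr// mul1r; lra.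
by rewrite /barrier /dbarrier /ddbarrier E !expr0n /= !mul0r !mulr0 addr0.
Qed.

(** If u - s < m / (2 + |c|), the base of the cube exceeds 1 + |c|, hence so does the cube. *)
Lemma barrier_sublevel m s u c : 0 < m -> s < u -> barrier m s u <= c ->
  s + m / (2 + `|c|) <= u.
Proof.
move=> m0 su; rewrite /barrier.
have us : 0 < u - s by lra.
have c2 : 0 < 2 + `|c| by rewrite ltr_wpDr.
rewrite leNgt => h; rewrite leNgt; apply: contraNN h => h.
have h1 : 1 + `|c| < m * (u - s)^-1 - 1.
  rewrite ltrBrDr ltr_pdivlMr//.
  have : u - s < m / (2 + `|c|) by lra.
  by rewrite ltr_pdivlMr// mulrC; lra.
have c0 := normr_ge0 c.
rewrite /pos max_l; last by lra.
apply: (@lt_le_trans _ _ (1 + `|c|)); first by have := ler_norm c; lra.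
apply: le_trans (ltW h1) _; rewrite exprS ler_peMr ?exprn_ege1//; lra.
Qed.

End Barrier.

(** * Symmetry and kernel of the shape operator; superlevel sets of the distance *)

Section CollarGeometry.
Context {R : realType} {n : nat}.
Implicit Types (x z u v w : 'rV[R]_n) (D : set 'rV[R]_n).

Lemma vdiff_dot (F G : 'rV[R]_n -> 'rV[R]_n) x A B : vdiff F x A -> vdiff G x B ->
  sdiff (fun z => dot (F z) (G z)) x (G x *m A^T + F x *m B^T).
Proof.
move=> HF HG.
have -> : G x *m A^T + F x *m B^T =
    \sum_i (F x 0 i *: (\row_k B k i) + G x 0 i *: (\row_k A k i)).
  apply/rowP => k; rewrite summxE !mxE -big_split; apply: eq_bigr => i _ /=.
  by rewrite !mxE addrC.
apply: sdiff_sum => i.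
by apply: sdiffM; [exact: vdiff_coord HF|exact: vdiff_coord HG].
Qed.

Lemma sdiff_unique (f : 'rV[R]_n -> R) x g g' : sdiff f x g -> sdiff f x g' -> g = g'.
Proof.
move=> H H'; apply/rowP => i; rewrite -!dot_ebase.
by rewrite -(sdiff_derive _ H) (sdiff_derive _ H').
Qed.

Lemma sdiff_cst (a : R) x : sdiff (fun=> a) x 0.
Proof.
move=> e e0; near=> q; rewrite dot0l !subrr normr0.
by rewrite mulr_ge0 ?enorm_ge0 ?(ltW e0).
Unshelve. all: by end_near. Qed.

Context (D : set 'rV[R]_n) (e : R).
Context (oD : open D) (D0 : ~` D !=set0).
Context (hc : forall x, D x -> bdist D x < e -> collar_point D e x).

Lemma collar_near x : D x -> bdist D x < e -> \forall z \near x, D z /\ bdist D z < e.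
Proof.
move=> Dx xe; apply: filterI; first exact: open_nbhs_nbhs.
have := @dist_to_continuous R n (~` D) D0 x.
by move=> /(_ [set t | t < e]); apply; exact: lt_nbhsl.
Qed.

Lemma collar_sdiff_near x : D x -> bdist D x < e ->
  \forall z \near x, sdiff (bdist D) z (nrm D z).
Proof.
by move=> Dx xe; apply: filterS (collar_near Dx xe) => z [Dz ze]; have [] := hc Dz ze.
Qed.

Lemma collar_symmetric x : D x -> bdist D x < e ->
  forall u v, dot (u *m shapeop D x) v = dot (v *m shapeop D x) u.
Proof.
move=> Dx xe; have [_ H _ _ _] := hc Dx xe.
exact: hessian_symmetric (collar_sdiff_near Dx xe) H.
Qed.

(** Differentiating |N|^2 = 1 gives N S^T = 0 for the shape operator S, which is symmetric as a
    Hessian. *)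
Lemma collar_normal x : D x -> bdist D x < e -> nrm D x *m shapeop D x = 0.
Proof.
move=> Dx xe; have [_ H _ _ _] := hc Dx xe.
have E := vdiff_dot H H.
have E1 : sdiff (fun z => dot (nrm D z) (nrm D z)) x 0.
  apply: sdiff_near_eq (sdiff_cst 1 x).
  apply: filterS (collar_near Dx xe) => z [Dz _].
  by rewrite -sqr_enorm enorm_nrm// expr1n.
have := sdiff_unique E E1 => /= E2.
have {}E2 : nrm D x *m (shapeop D x)^T = 0.
  have : 2 *: (nrm D x *m (shapeop D x)^T) = 0 by rewrite scaler_nat mulr2n.
  by move/eqP; rewrite scaler_eq0 pnatr_eq0 /= => /eqP.
apply: dot_eq0; rewrite collar_symmetric// dot_mulmx_tr E2.
by rewrite dot0r.
Qed.

Lemma sublevelE t : t < 0 -> sublevel_domain D t = [set x | - t < bdist D x].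
Proof.
move=> t0; apply/seteqP; split=> x /=; rewrite /sublevel_domain /signed_dist /bdist.
  by move=> [Dx]; rewrite dist_to_mem// sub0r ltrNl.
move=> h; have Dx : D x.
  apply: (@dist_to_ball _ _ D x); rewrite subrr enorm0; lra.
by split=> //; rewrite dist_to_mem// sub0r ltrNl.
Qed.

Lemma open_level s : open [set x | s < bdist D x].
Proof.
apply: (open_comp (f := bdist D) (D := [set t | s < t])); last exact: open_gt.
by move=> x _; exact: dist_to_continuous.
Qed.

Lemma bdist_in x : 0 < bdist D x -> D x.
Proof. by move=> h; apply: (@dist_to_ball _ _ D x); rewrite subrr enorm0. Qed.

End CollarGeometry.

(** * The exhaustion function of a superlevel set of the distance *)

Section PshExhaustion.
Context {R : realType} {n p : nat}.
Implicit Types (x z u v w : 'rV[R]_n) (D : set 'rV[R]_n).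

Lemma collar_levi D rho e x (b : 'I_p -> 'rV[R]_n) : open D -> ~` D !=set0 ->
  (forall x, D x -> bdist D x < e -> collar_point D e x) ->
  strongly_p_psh p D rho -> exhaustion D rho -> D x -> bdist D x < e ->
  (forall i j, dot (b i) (b j) = (i == j)%:R) -> (forall i, dot (b i) (nrm D x) = 0) ->
  \sum_i dot (b i *m shapeop D x) (b i) <= 0.
Proof.
move=> oD D0 hc psh exh Dx xe ob bN; have [_ H _ _ _] := hc x Dx xe.
apply: (levi_tangent (g := nrm D) oD D0 psh exh Dx _ H erefl _ _ _ _ ob bN).
- exact: (collar_sdiff_near oD D0 hc Dx xe).
- exact: enorm_nrm.
- rewrite footE//; by have [] := footP x oD D0.
- exact: (collar_normal oD D0 hc Dx xe).
- exact: (collar_symmetric oD D0 hc Dx xe).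
Qed.

Lemma psh_exhaustion D rho (e m s : R) : open D -> ~` D !=set0 -> bounded_set D ->
  (0 < p)%N -> 0 < e -> (forall x, D x -> bdist D x < e -> collar_point D e x) ->
  strongly_p_psh p D rho -> exhaustion D rho ->
  0 < s -> 0 < m -> (2 * p%:R + 1) * e^-1 * m <= 2 -> s + m < e ->
  exists rho', strongly_p_psh p [set x | s < bdist D x] rho' /\
    exhaustion [set x | s < bdist D x] rho'.
Proof.
move=> oD D0 bD p0 e0 hc psh exh s0 m0 Cm sm.
set E := [set x | s < bdist D x]; pose d := bdist D.
have oE : open E by exact: open_level.
have ED x : E x -> D x by move=> Ex; apply: bdist_in; exact: lt_trans s0 Ex.
pose F x := barrier m s (d x) + dot x x.
pose g x := dbarrier m s (d x) *: nrm D x + 2 *: x.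
pose H x : 'M[R]_n := ((ddbarrier m s (d x) *: nrm D x)^T *m nrm D x +
  dbarrier m s (d x) *: shapeop D x) + 2%:M.
have far x : s + m < d x -> \forall z \near x, s + m < d z.
  move=> xe; have := @dist_to_continuous R n (~` D) D0 x.
  by move=> /(_ [set t | s + m < t]); apply; exact: lt_nbhsr.
have dif x : E x -> sdiff F x (g x) /\ vdiff g x (H x).
  move=> Ex; have Dx := ED x Ex; have sx : s < d x by [].
  have nsx : \forall t \near d x, s < t by exact: lt_nbhsr.
  (* At depth e or more the distance may fail to be differentiable, but there the barrier vanishes
     in a neighbourhood because s + m < e. *)
  have [xe|xe] := ltP (d x) e.
    have [h1 h2 _ _ _] := hc x Dx xe.
    split.
      apply: sdiffD; last exact: sdiff_sqr.
      apply: sdiff_comp h1; last exact: dbarrier_continuous.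
      by apply: filterS nsx => t; exact: is_derive_barrier.
    apply: vdiffD; last exact: vdiff_double.
    apply: vdiff_scale h2; apply: sdiff_comp h1; last exact: ddbarrier_continuous.
    by apply: filterS nsx => t; exact: is_derive_dbarrier.
  have xsm : s + m < d x by exact: lt_le_trans xe.
  have [E0 E1 E2] := barrier_far m0 (ltW xsm).
  have gx : g x = 2 *: x by rewrite /g E1 scale0r add0r.
  have Hx : H x = 2%:M by rewrite /H E1 E2 !scale0r trmx0 mul0mx !add0r.
  rewrite gx Hx; split.
    apply: sdiff_near_eq (sdiff_sqr x); apply: filterS (far x xsm) => z zs.
    by rewrite /F; have [-> _ _] := barrier_far m0 (ltW zs); rewrite add0r.
  apply: vdiff_near_eq (vdiff_double x); apply: filterS (far x xsm) => z zs.
  by rewrite /g; have [_ -> _] := barrier_far m0 (ltW zs); rewrite scale0r add0r.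
have [cF gH] := diff_class_C2 oE dif.
exists F; split.
  split=> // x Ex L _ b _ ob; have [_ ->] := gH x Ex; have Dx := ED x Ex.
  pose b' i := tnth b i.
  have ob' i j : dot (b' i) (b' j) = (i == j)%:R by exact: ob.
  have bE i : dot (b' i *m H x) (b' i) = ddbarrier m s (d x) * dot (b' i) (nrm D x) ^+ 2 +
      dbarrier m s (d x) * dot (b' i *m shapeop D x) (b' i) + 2.
    have T (k : R) (v : 'rV[R]_n) : (k *: v)^T = k *: v^T.
      by apply/colP => j; rewrite !mxE.
    rewrite /H; move: (nrm D x) (shapeop D x) => N S.
    rewrite T -scalemxAl !mulmxDr -!scalemxAr mulmx_outer mul_mx_scalar.
    by rewrite !dotDl !dotZl ob' eqxx mulr1 (dotC N) expr2.
  under eq_bigr => i _ do rewrite -/(b' i) bE.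
  rewrite !big_split /= -!big_distrr /= sumr_const card_ord.
  have p2 : 0 < p%:R + p%:R :> R by rewrite addr_gt0 ?ltr0n.
  have [xe|xe] := ltP (d x) e; last first.
    have [_ -> ->] := barrier_far m0 (ltW (lt_le_trans sm xe)).
    by rewrite !mul0r !add0r.
  have [dneg ddom] := barrier_dominates m0 (Ex : s < d x) Cm.
  have [_ _ [bnd _] _ _] := hc x Dx xe.
  have ei : 0 <= e^-1 by rewrite invr_ge0 ltW.
  (* With S the sum of the squares (b i).N, the trace is at least (G'' + C G') S + 2 p, because G'
     <= 0 multiplies a trace that is at most C S. *)
  have lev := levi_general (enorm_nrm oD D0 Dx) (collar_normal oD D0 hc Dx xe)
    ei (collar_symmetric oD D0 hc Dx xe) bnd
    (fun b ob bN => collar_levi oD D0 hc psh exh Dx xe ob bN) ob'.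
  have S0 : 0 <= \sum_i dot (b' i) (nrm D x) ^+ 2.
    by apply: sumr_ge0 => i _; exact: sqr_ge0.
  have h1 := ler_wnM2l dneg lev.
  have h2 := mulr_ge0 ddom S0.
  lra.
move=> c.
pose h := m / (2 + `|c|).
have h0 : 0 < h by rewrite divr_gt0// ltr_wpDr.
have sub x : E x -> F x <= c -> s + h <= d x.
  move=> Ex Fc; apply: barrier_sublevel => //.
  by apply: le_trans Fc; rewrite lerDl dot_ge0.
apply: bounded_closed_compact.
  have /bounded_enormP[M HM] := bD.
  by apply/bounded_enormP; exists M => x [Ex _]; apply/HM/ED.
have cd : closed [set x | s + h <= d x].
  have -> : [set x | s + h <= d x] = [set x | - d x <= - (s + h)].
    by apply/seteqP; split=> x /=; rewrite lerN2.
  by apply: closed_sublevel => x; exact: (cvgN (@dist_to_continuous R n (~` D) D0 x)).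
move=> x clx.
(* The sublevel set keeps depth at least s + h, so its limit points stay in E, where F is
   continuous. *)
have dx : s + h <= d x.
  apply: cd; apply: closureS clx => z [Ez Fz]; exact: sub.
have Ex : E x by rewrite /E /=; rewrite /d in dx; lra.
split=> //; rewrite leNgt; apply/negP => cF'.
have [sF _] := dif x Ex.
have nF : \forall z \near x, c < F z.
  by have := sdiff_continuous sF; move=> /(_ [set t | c < t]); apply; exact: lt_nbhsr.
have [z [[Ez Fz] /=]] := clx _ nF; lra.
Qed.

End PshExhaustion.

(** * Superlevel sets at small depth are connected *)

Section Connectivity.
Context {R : realType} {n : nat}.
Implicit Types (x z u v w a : 'rV[R]_n) (D : set 'rV[R]_n).

Definition seg x v : set 'rV[R]_n := [set x + t *: v | t in `[0, 1]%classic].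

Lemma seg_connected x v : connected (seg x v).
Proof.
apply: connected_continuous_connected; first exact/connected_intervalP/interval_is_interval.
apply: continuous_subspaceT => t.
apply/(@cvg_enorm _ _ _ (nbhs t)) => e e0.
have v0 : 0 < 1 + enorm v by rewrite ltr_pwDl// enorm_ge0.
have : \forall s \near t, `|t - s| < e / (1 + enorm v).
  by apply/nbhs_ballP; exists (e / (1 + enorm v)) => //=; rewrite divr_gt0.
apply: filterS => s; rewrite distrC ltr_pdivlMr// => H.
have -> : x + s *: v - (x + t *: v) = (s - t) *: v.
  by apply/rowP => i; rewrite !mxE; ring.
rewrite enormZ; apply: le_lt_trans H; rewrite mulrDr lerDr mulr1 normr_ge0.
by [].
Qed.

Lemma seg_start x v : seg x v x.
Proof. by exists 0; [rewrite /= in_itv /= lexx ler01|rewrite scale0r addr0]. Qed.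

Lemma seg_end x v : seg x v (x + v).
Proof. by exists 1; [rewrite /= in_itv /= lexx ler01|rewrite scale1r]. Qed.

Definition joined D a (s : R) z : Prop := exists C : set 'rV[R]_n,
  [/\ C a, C z, connected C & C `<=` [set x | s < bdist D x]].

Lemma joined_mono D a s s' z : s' <= s -> joined D a s z -> joined D a s' z.
Proof.
move=> ss [C [Ca Cz cC sC]]; exists C; split=> // x /sC /=; exact: le_lt_trans.
Qed.

Lemma joined_seg D a s z v y y' : seg z v y -> seg z v y' ->
  (forall x, seg z v x -> s < bdist D x) -> joined D a s y -> joined D a s y'.
Proof.
move=> zy zy' H [C [Ca Cy cC sC]]; exists (C `|` seg z v); split.
- by left.
- by right.
- by apply: connectedU => //; [exists y|exact: seg_connected].
- by move=> x [/sC|/H].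
Qed.

(** By a clopen argument in D, every point is joined to a at some positive depth. Compactness makes
    this depth uniform on the points of depth at least e / 2, and collar points are pushed inward to
    these without losing depth. *)
Lemma level_connected D e : open D -> ~` D !=set0 -> connected D -> D !=set0 ->
  bounded_set D -> 0 < e -> (forall x, D x -> bdist D x < e -> collar_point D e x) ->
  exists2 s0, 0 < s0 & forall s, 0 < s -> s < s0 ->
    connected [set x | s < bdist D x] /\ [set x | s < bdist D x] !=set0.
Proof.
move=> oD D0 cD [a Da] bD e0 hc.
have da : 0 < bdist D a by exact: dist_to_gt0.
have lip z x : bdist D z - enorm (x - z) <= bdist D x.
  have := dist_to_lip x z D0; rewrite ler_norml /bdist => /andP[? _]; lra.
have ball z x : D z -> enorm (x - z) < bdist D z / 2 ->
    forall y, seg z (x - z) y -> bdist D z / 4 < bdist D y.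
  move=> Dz xz y [t /= /[!in_itv]/= /andP[t0 t1] <-].
  have := lip z (z + t *: (x - z)); rewrite addrAC subrr add0r enormZ ger0_norm//.
  have : t * enorm (x - z) <= enorm (x - z) by rewrite ler_piMl ?enorm_ge0.
  have := enorm_ge0 (x - z); lra.
have fwd z x s : D z -> enorm (x - z) < bdist D z / 2 ->
    joined D a s z -> joined D a (Order.min s (bdist D z / 4)) x.
  move=> Dz xz Qz; have E : x = z + (x - z) by rewrite subrKC.
  apply: (@joined_seg _ _ _ z (x - z) z); [exact: seg_start|by rewrite {2}E; exact: seg_end| |].
    by move=> y /(ball z x Dz xz); apply: le_lt_trans; rewrite ge_min lexx orbT.
  by apply: joined_mono Qz; rewrite ge_min lexx.
have bwd z x s : D z -> enorm (x - z) < bdist D z / 2 ->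
    joined D a s x -> joined D a (Order.min s (bdist D z / 4)) z.
  move=> Dz xz Qz; have E : x = z + (x - z) by rewrite subrKC.
  apply: (@joined_seg _ _ _ z (x - z) x); [by rewrite {2}E; exact: seg_end|exact: seg_start| |].
    by move=> y /(ball z x Dz xz); apply: le_lt_trans; rewrite ge_min lexx orbT.
  by apply: joined_mono Qz; rewrite ge_min lexx.
have pos z : D z -> 0 < bdist D z by move=> Dz; exact: dist_to_gt0.
pose B := [set z | D z /\ exists2 s, 0 < s & joined D a s z].
have BD : B = D.
  have inball z x : D z -> enorm (x - z) < bdist D z / 2 -> D x.
    move=> Dz xz; apply: (@dist_to_ball _ _ D z); have := pos z Dz.
    by rewrite /bdist in xz *; lra.
  have oB : open B.
    apply: enorm_openP => z [Dz [s s0 Qz]]; have dz := pos z Dz.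
    exists (bdist D z / 2); first by rewrite divr_gt0.
    move=> x xz; split; first exact: inball xz.
    exists (Order.min s (bdist D z / 4)); first by rewrite lt_min s0 divr_gt0.
    exact: fwd.
  have oDB : open (D `\` B).
    apply: enorm_openP => z [Dz nBz]; have dz := pos z Dz.
    exists (bdist D z / 2); first by rewrite divr_gt0.
    move=> x xz; split; first exact: inball xz.
    move=> [_ [s s0 Qx]]; apply: nBz; split=> //.
    exists (Order.min s (bdist D z / 4)); first by rewrite lt_min s0 divr_gt0.
    exact: bwd Qx.
  apply: cD.
  - exists a; split=> //; exists (bdist D a / 2); first by rewrite divr_gt0.
    exists [set a]; split=> //; first exact: connected1.
    by move=> x /= ->; lra.
  - exists B => //; apply/seteqP; split=> x; first by move=> Bx; split=> //; case: Bx.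
    by case.
  - exists (~` (D `\` B)); first exact: open_closedC.
    apply/seteqP; split=> x; first by move=> [Dx Qx]; split=> // -[_]; apply.
    by move=> [Dx]; apply: contra_notP => nB; split.
pose K := [set z | e / 2 <= bdist D z].
have KD z : K z -> D z.
  by move=> Kz; apply: bdist_in; apply: lt_le_trans Kz; rewrite divr_gt0.
have cK : compact K.
  apply: bounded_closed_compact.
    have /bounded_enormP[M HM] := bD.
    by apply/bounded_enormP; exists M => x /KD/HM.
  have -> : K = [set x | - bdist D x <= - (e / 2)].
    by apply/seteqP; split=> x /=; rewrite lerN2.
  by apply: closed_sublevel => x; exact: (cvgN (@dist_to_continuous R n (~` D) D0 x)).
have [s1 s10 Hs1] : exists2 s, 0 < s & forall z, K z -> forall x, enorm (x - z) < s ->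
    joined D a s x.
  apply: (compact_uniform cK) => [s s' x _|z Kz]; first exact: joined_mono.
  have Dz := KD z Kz; have dz := pos z Dz.
  have [_ [s s0 Qz]] : B z by rewrite BD.
  exists (Order.min s (bdist D z / 4)); first by rewrite lt_min s0 divr_gt0.
  move=> x; rewrite lt_min => /andP[_ xz]; apply: fwd => //; lra.
exists (Order.min s1 (bdist D a)); first by rewrite lt_min s10.
move=> s s0; rewrite lt_min => /andP[ss1 sa].
have Ea : [set x | s < bdist D x] a by [].
split; last by exists a.
suff -> : [set x | s < bdist D x] = connected_component [set x | s < bdist D x] a.
  exact: component_connected.
apply/seteqP; split; last first.
  by move=> x [C [_ sC _] Cx]; exact: sC.
move=> x sx.
suff [C [Ca Cx cC sC]] : joined D a s x by exists C.
have KJ y : K y -> joined D a s y.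
  move=> Ky; apply: joined_mono (ltW ss1) _; apply: (Hs1 y Ky).
  by rewrite subrr enorm0.
have [xe|xe] := leP (e / 2) (bdist D x); first exact: KJ.
have Dx : D x by apply: bdist_in; exact: lt_trans s0 sx.
have xe' : bdist D x < e by lra.
have [_ _ _ _ [v v1 Hv]] := hc x Dx xe'.
(* Moving by e along the collar direction gains depth at least e / 2, so the segment ends in K. *)
apply: (@joined_seg D a s x (e *: v) (x + e *: v) x).
- exact: seg_end.
- exact: seg_start.
- move=> y [t /= /[!in_itv]/= /andP[t0 t1] <-]; rewrite scalerA.
  have te : 0 <= t * e <= e by rewrite mulr_ge0 ?(ltW e0)//= ler_piMl// ltW.
  have [_ h] := Hv _ te; apply: lt_le_trans sx (le_trans _ h).
  by rewrite lerDl divr_ge0// mulr_ge0// ltW.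
- apply: KJ; rewrite /K /=.
  have [_ h] := Hv e (introT andP (conj (ltW e0) (lexx e))).
  have := pos x Dx; lra.
Qed.

End Connectivity.

(** * Ordered orthonormal eigenvectors of a symmetric form on the tangent space *)

Section Spectral.
Context {R : realType} {n : nat}.
Implicit Types (u v w N : 'rV[R]_n) (H : 'M[R]_n).

Lemma exists_orthogonal_unit k (c : 'I_k -> 'rV[R]_n) : (k < n)%N ->
  exists2 u, dot u u = 1 & forall i, dot u (c i) = 0.
Proof.
move=> kn; pose C : 'M[R]_(n, k) := \matrix_(j, i) c i 0 j.
have : kermx C != 0.
  rewrite kermx_eq0 /row_free neq_ltn (leq_ltn_trans (rank_leq_col C) kn).
  by [].
move=> /rowV0Pn[v /sub_kermxP vC v0].
have ev : 0 < enorm v by rewrite enorm_gt0.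
exists ((enorm v)^-1 *: v).
  by rewrite dotZl dotZr -sqr_enorm expr2 mulKf ?gt_eqF// mulVf ?gt_eqF.
move=> i; rewrite dotZl; have -> : dot v (c i) = (v *m C) 0 i.
  by rewrite mxE; apply: eq_bigr => j _; rewrite mxE.
by rewrite vC mxE mulr0.
Qed.

(** For small negative t, here - c / (|X| + 1), the linear term dominates. *)
Lemma quadratic_neg (c X : R) : 0 < c -> ~ (forall t, 0 <= 2 * t * c + t ^+ 2 * X).
Proof.
move=> c0 /(_ (- (c / (`|X| + 1)))); rewrite sqrrN => h.
have K0 := normr_ge0 X; have K1 : 0 < `|X| + 1 by lra.
have t0 : 0 < c / (`|X| + 1) by rewrite divr_gt0.
have tK : c / (`|X| + 1) * (`|X| + 1) = c by rewrite divfK// gt_eqF.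
move: (c / (`|X| + 1)) t0 tK h => t t0 tK h.
have h1 : t ^+ 2 * X <= t ^+ 2 * `|X| by rewrite ler_wpM2l ?sqr_ge0// ler_norm.
have t2 : 0 < t * t by rewrite mulr_gt0.
have h2 := mulr_ge0 (ltW t2) K0.
rewrite -tK in h; rewrite expr2 in h h1; lra.
Qed.

(* Minimizing the Rayleigh quotient on the orthogonal complement of eigenvectors
   that are already known yields one more eigenvector. *)
Lemma rayleigh_step H k (c : 'I_k -> 'rV[R]_n) (mu : 'I_k -> R) : (k < n)%N ->
  (forall u v, dot (u *m H) v = dot (v *m H) u) ->
  (forall i, c i *m H = mu i *: c i) ->
  exists u, [/\ dot u u = 1, forall i, dot u (c i) = 0,
    u *m H = dot (u *m H) u *: u &
    forall w, (forall i, dot w (c i) = 0) ->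
      dot (u *m H) u * dot w w <= dot (w *m H) w].
Proof.
move=> kn symH ceig.
pose P : 'M[R]_n := \sum_i (c i)^T *m c i.
have PE w : dot (w *m P) w = \sum_i dot w (c i) ^+ 2.
  rewrite /P mulmx_sumr dot_suml; apply: eq_bigr => i _.
  by rewrite mulmx_outer dotZl (dotC (c i)) expr2.
have P0 w : dot (w *m P) w <= 0 <-> forall i, dot w (c i) = 0.
  rewrite PE; split=> [h i|h]; last by rewrite big1// => i _; rewrite h expr0n.
  have /psumr_eq0P h0 : \sum_i dot w (c i) ^+ 2 = 0.
    by apply/eqP; rewrite eq_le h sumr_ge0// => j _; exact: sqr_ge0.
  by apply/eqP; rewrite -sqrf_eq0 h0// => j _; exact: sqr_ge0.
pose S := [set w : 'rV[R]_n | dot ((w - 0) *m 1%:M) ((w - 0) *m 1%:M) <= 1] `&`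
  [set w | - dot ((w - 0) *m 1%:M) ((w - 0) *m 1%:M) <= -1] `&`
  [set w | dot ((w - 0) *m P) ((w - 0) *m 1%:M) <= 0].
have SE w : S w <-> dot w w = 1 /\ forall i, dot w (c i) = 0.
  rewrite /S /= subr0 !mulmx1; split.
    move=> [[h1 h2] /P0 h3]; split=> //; apply/eqP; rewrite eq_le h1.
    by rewrite -lerN2.
  by move=> [-> /P0 h]; split=> //; split.
have cS : compact S.
  apply: bounded_closed_compact.
    apply/bounded_enormP; exists 1 => w /SE[w1 _].
    by rewrite /enorm w1 sqrtr1.
  apply: closedI; first apply: closedI.
  - exact/closed_sublevel/continuous_affine_dot.
  - by apply: closed_sublevel => w; exact: (cvgN (@continuous_affine_dot R n 0 1%:M 1%:M w)).
  - exact/closed_sublevel/continuous_affine_dot.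
have S0 : S !=set0.
  by have [u u1 uc] := exists_orthogonal_unit c kn; exists u; apply/SE.
have cQ : continuous (fun w => dot ((w - 0) *m H) ((w - 0) *m 1%:M)).
  exact: continuous_affine_dot.
have [u /[!inE] /SE[u1 uc] Hu] := @EVT_min_rV R n _ S S0 cS (continuous_subspaceT cQ).
pose m := dot (u *m H) u.
have min w : (forall i, dot w (c i) = 0) -> m * dot w w <= dot (w *m H) w.
  move=> wc; have [->|w0] := eqVneq w 0; first by rewrite !dot0r mulr0.
  have ew : 0 < enorm w by rewrite enorm_gt0.
  have Sw : S ((enorm w)^-1 *: w).
    apply/SE; split=> [|i]; last by rewrite dotZl wc mulr0.
    by rewrite dotZl dotZr -sqr_enorm expr2 mulKf ?gt_eqF// mulVf ?gt_eqF.
  have := Hu _ (mem_set Sw); rewrite !subr0 !mulmx1 -scalemxAl dotZl dotZr mulrA.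
  by rewrite -/m -invfM -expr2 sqr_enorm ler_pdivlMl -?sqr_enorm ?exprn_gt0// mulrC.
exists u; split=> //.
(* The residual r is orthogonal to u and to all c i, so u + t r is an admissible competitor;
   minimality gives a nonnegative quadratic in t with linear coefficient 2 |r|^2. *)
have [r rdef] : exists r, r = u *m H - m *: u by eexists.
have rE : u *m H = m *: u + r by rewrite rdef addrC subrK.
have ru : dot r u = 0 by rewrite rdef dotBl dotZl u1 mulr1 subrr.
have rc i : dot r (c i) = 0.
  by rewrite rdef dotBl dotZl uc mulr0 subr0 symH ceig dotZl (dotC _ u) uc mulr0.
suff r0 : r = 0 by rewrite [LHS]rE r0 addr0.
have key t : 0 <= 2 * t * dot r r + t ^+ 2 * (dot (r *m H) r - m * dot r r).
  have wc i : dot (u + t *: r) (c i) = 0 by rewrite dotDl dotZl uc rc mulr0 addr0.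
  have := min _ wc.
  rewrite mulmxDl -scalemxAl !dotDl !dotDr !dotZl !dotZr (symH r u) -/m u1 (dotC u r) ru.
  have -> : dot (u *m H) r = dot r r by rewrite rE dotDl dotZl (dotC u r) ru mulr0 add0r.
  lra.
apply: dot_eq0; apply/eqP; rewrite eq_le dot_ge0 andbT leNgt; apply/negP => rr.
exact: (quadratic_neg rr key).
Qed.

(** N is placed before the known eigenvectors, with eigenvalue 0, so all new ones are tangent. The
    last clause, minimality on the remaining complement, is carried through the induction because it
    yields the order of the eigenvalues. *)
Lemma tangent_eigenbasis H N k : (k < n)%N ->
  (forall u v, dot (u *m H) v = dot (v *m H) u) -> N *m H = 0 ->
  exists b : nat -> 'rV[R]_n, [/\
    forall i j, (i < k)%N -> (j < k)%N -> dot (b i) (b j) = (i == j)%:R,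
    forall i, (i < k)%N -> dot (b i) N = 0 /\
      b i *m H = dot (b i *m H) (b i) *: b i,
    forall i j, (i <= j)%N -> (j < k)%N ->
      dot (b i *m H) (b i) <= dot (b j *m H) (b j) &
    forall i w, (i < k)%N -> dot w N = 0 -> (forall j, (j < k)%N -> dot w (b j) = 0) ->
      dot (b i *m H) (b i) * dot w w <= dot (w *m H) w].
Proof.
move=> + symH NH; elim: k => [|k IH] kn; first by exists (fun=> 0); split.
have [b [ob eb sb mb]] := IH (ltnW kn).
pose c (i : 'I_k.+1) := if (i : nat) is i'.+1 then b i' else N.
pose mu (i : 'I_k.+1) := if (i : nat) is i'.+1 then dot (b i' *m H) (b i') else 0.
have ceig i : c i *m H = mu i *: c i.
  case: i => -[|i] ik; rewrite /c /mu /=; first by rewrite NH scale0r.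
  by have [_] := eb i ik.
have [u [u1 uc ueig umin]] := rayleigh_step kn symH ceig.
have uN : dot u N = 0 by exact: (uc ord0).
have ub i : (i < k)%N -> dot u (b i) = 0.
  by move=> ik; have := uc (Ordinal (ik : (i.+1 < k.+1)%N)).
pose b' i := if (i < k)%N then b i else u.
have b'k : b' k = u by rewrite /b' ltnn.
have b'i i : (i < k)%N -> b' i = b i by rewrite /b' => ->.
have cases i : (i < k.+1)%N -> i = k \/ (i < k)%N.
  by rewrite ltnS leq_eqVlt => /orP[/eqP|]; [left|right].
exists b'; split.
- move=> i j /cases[->|ik] /cases[->|jk]; rewrite ?b'k ?b'i//.
  + by rewrite u1 eqxx.
  + by rewrite ub// gtn_eqF.
  + by rewrite dotC ub// ltn_eqF.
  + exact: ob.
- by move=> i /cases[->|ik]; rewrite ?b'k ?b'i//; exact: eb.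
- move=> i j ij /cases[jk|jk].
    have /cases[->|ik] : (i < k.+1)%N by rewrite ltnS -jk.
      by rewrite jk.
    rewrite jk b'k b'i//; have := mb i u ik uN ub; by rewrite u1 mulr1.
  by rewrite !b'i//; [exact: sb|exact: leq_ltn_trans jk].
- move=> i w ik wN wb; have wb' j : (j < k)%N -> dot w (b j) = 0.
    by move=> jk; rewrite -b'i// wb// ltnW.
  have [->|ik'] := cases i ik; last by rewrite b'i//; exact: mb.
  rewrite b'k; apply: umin => -[[|j] jk]; rewrite /c //=.
  exact: wb'.
Qed.

End Spectral.

(** * Principal curvatures read off from an eigenbasis *)

Section PrincipalCurvatures.
Context {R : realType} {n : nat}.
Implicit Types (x z u v w : 'rV[R]_n) (D : set 'rV[R]_n).

Lemma char_poly_diag k (nu : nat -> R) (M : 'M[R]_k) :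
  (forall i j, M i j = nu i * (i == j)%:R) ->
  char_poly M = \prod_(a <- mkseq nu k) ('X - a%:P).
Proof.
move=> ME; rewrite char_poly_trig; last first.
  apply/is_trig_mxP => i j ij; rewrite ME.
  by have /negPf -> : i != j by [rewrite -(inj_eq val_inj) /= ltn_eqF]; rewrite mulr0.
rewrite (eq_bigr (fun i : 'I_k => 'X - (nu i)%:P)); last first.
  by move=> i _; rewrite ME eqxx mulr1.
by rewrite /mkseq big_map -(big_mkord xpredT (fun i => 'X - (nu i)%:P)) /index_iota subn0.
Qed.

Lemma principal_curvatures_eigen D x U phi A (b : nat -> 'rV[R]_n) (nu : nat -> R) :
  local_defining_function 2 D x U phi -> vdiff (inner_normal phi) x A ->
  (forall i j, (i < n.-1)%N -> (j < n.-1)%N -> dot (b i) (b j) = (i == j)%:R) ->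
  (forall i, (i < n.-1)%N -> dot (b i) (inner_normal phi x) = 0) ->
  (forall i, (i < n.-1)%N -> b i *m A = - nu i *: b i) ->
  (forall i j, (i <= j)%N -> (j < n.-1)%N -> nu i <= nu j) ->
  principal_curvatures D x [tuple of mkseq nu n.-1].
Proof.
move=> ld HA ob bN bA smon; split.
  apply/(sortedP 0) => i /=; rewrite size_mkseq => ik.
  by rewrite !nth_mkseq// ?smon// ltnW.
exists U, phi, [tuple of mkseq b n.-1]; split=> //.
- by move=> i j; rewrite !(tnth_nth 0) /= !nth_mkseq//; apply: ob.
- by move=> i; rewrite (tnth_nth 0) /= nth_mkseq//; apply: bN.
- apply: char_poly_diag => i j; rewrite mxE !(tnth_nth 0) /= !nth_mkseq//.
  rewrite /second_fundamental_form (vdiff_derive _ HA) bA// dotZl ob//.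
  by rewrite mulNr opprK.
Qed.

End PrincipalCurvatures.

(** * Curvatures along a normal, and strict p-convexity without p-flat points *)

Section StrongConvexity.
Context {R : realType} {n p : nat}.
Implicit Types (x z u v w : 'rV[R]_n) (D : set 'rV[R]_n).

(** The gradient of s - bdist has norm one throughout the collar, so its inner normal is [nrm] on a
    whole neighbourhood and [shapeop] is the derivative of that normal. *)
Lemma level_defining D e s x : open D -> ~` D !=set0 ->
  (forall x, D x -> bdist D x < e -> collar_point D e x) ->
  0 < s -> D x -> bdist D x < e ->
  let U := [set z | D z /\ bdist D z < e] in let phi := fun z => s - bdist D z in
  [/\ local_defining_function 2 [set z | s < bdist D z] x U phi,
      inner_normal phi x = nrm D x & vdiff (inner_normal phi) x (shapeop D x)].
Proof.
move=> oD D0 hc s0 Dx xe U phi.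
have oU : open U.
  apply: openI => //.
  apply: (open_comp (f := bdist D) (D := [set t | t < e])); last exact: open_lt.
  by move=> z _; exact: dist_to_continuous.
have dif z : U z -> sdiff phi z (- nrm D z) /\ vdiff (fun z => - nrm D z) z (- shapeop D z).
  move=> [Dz ze]; have [h1 h2 _ _ _] := hc z Dz ze; split.
    move=> eps eps0; apply: filterS (h1 eps eps0) => q; rewrite dotNl /phi => h.
    by rewrite (_ : _ - _ - _ = - (bdist D q.1 - bdist D q.2 - dot (nrm D z) (q.1 - q.2))) ?normrN//; ring.
  move=> eps eps0; apply: filterS (h2 eps eps0) => q; rewrite mulmxN => h.
  rewrite (_ : _ - _ - _ = - (nrm D q.1 - nrm D q.2 - (q.1 - q.2) *m shapeop D z)) ?enormN//.
  by move: (_ *m _) (nrm D q.1) (nrm D q.2) => a b c; apply/rowP => i; rewrite !mxE; ring.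
have [cl gh] := diff_class_C2 oU dif.
have nuE z : U z -> inner_normal phi z = nrm D z.
  move=> Uz; rewrite /inner_normal; have [-> _] := gh z Uz; case: Uz => Dz _.
  by rewrite enormN enorm_nrm// invr1 scaleN1r opprK.
have Ux : U x by [].
split; last 2 first.
- exact: nuE.
- have [_ h2 _ _ _] := hc x Dx xe; apply: vdiff_near_eq h2.
  have : \forall z \near x, U z by exact: open_nbhs_nbhs.
  by apply: filterS => z Uz; rewrite nuE.
split=> //.
- by split; rewrite (@truncn_def _ _ 2) ?lexx ?ltr_nat// subrr ltxx.
- by move=> z _; rewrite /phi subr_lt0.
- move=> z Uz; have [-> _] := gh z Uz; case: Uz => Dz _.
  by rewrite oppr_eq0 -enorm_gt0 enorm_nrm.
Qed.

Lemma bd_level D s x : ~` D !=set0 -> bd [set z | s < bdist D z] x -> bdist D x = s.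
Proof.
move=> D0 [cx nx].
have cb := @dist_to_continuous R n (~` D) D0 x.
apply/eqP; rewrite eq_le; apply/andP; split; rewrite leNgt; apply/negP => h.
  apply: nx; have := @open_level R n D D0 s; rewrite openE => /(_ x h).
  by [].
have H : \forall z \near x, bdist D z < s.
  by move: cb => /(_ [set t | t < s]); apply; exact: lt_nbhsl.
by have [z [/= Ez Hz]] := cx _ H; lra.
Qed.

Lemma parallelogram u v :
  dot (u - v) (u - v) = 2 * dot u u + 2 * dot v v - dot (u + v) (u + v).
Proof. by rewrite !(dotDl, dotNl, dotDr, dotNr); ring. Qed.

Lemma halves_eq (t u : R) : t <= t / 2 + u -> u <= t / 2 -> u = t / 2.
Proof. by move=> *; lra. Qed.

Lemma half_square_le (t q : R) :
  t ^+ 2 <= q -> 2 * (t / 2) ^+ 2 + 2 * (t / 2) ^+ 2 - q <= 0.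
Proof. by rewrite !expr2; lra. Qed.

Lemma contraction_zero (t a c : R) : t * c <= 1 / 2 * a -> 0 <= a ->
  a = t / 2 * c -> a <= 0.
Proof. by move=> *; lra. Qed.

(** The difference is t k^2 / (1 + t k); its strict positivity for k != 0 is where p-flatness
    enters. *)
Lemma curvature_mono (t k : R) : 0 < t -> 0 < 1 + t * k ->
  k / (1 + t * k) <= k /\ (k != 0 -> k / (1 + t * k) < k).
Proof.
move=> t0 h; have E : k - k / (1 + t * k) = t * k ^+ 2 / (1 + t * k).
  by field; rewrite gt_eqF.
split; first by rewrite -subr_ge0 E divr_ge0 ?(ltW h)// mulr_ge0 ?sqr_ge0// ltW.
by move=> k0; rewrite -subr_gt0 E divr_gt0// mulr_gt0// exprn_even_gt0.
Qed.

(* Moving half-way towards the boundary keeps the foot point: equality in the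
   triangle inequality forces any other nearest point to coincide with it. *)
Lemma foot_halfway D x : open D -> ~` D !=set0 -> D x ->
  let x' := x - (bdist D x / 2) *: nrm D x in
  [/\ D x', bdist D x' = bdist D x / 2 & foot D x' = foot D x].
Proof.
move=> oD D0 Dx x'; have d0 := dist_to_gt0 oD D0 Dx.
have N1 := enorm_nrm oD D0 Dx.
have xx' : enorm (x - x') = bdist D x / 2.
  by rewrite /x' subKr enormZ N1 mulr1 ger0_norm// divr_ge0// ltW.
have x'f : x' - foot D x = (bdist D x / 2) *: nrm D x.
  rewrite -(footE oD D0 Dx) /x'; move: (bdist D x) (nrm D x) => t N.
  by apply/rowP => i; rewrite !mxE; field.
have [nDf Ef] := footP x oD D0.
have Dx' : D x'.
  by apply: (@dist_to_ball _ _ D x); rewrite enormC xx' /bdist; rewrite /bdist in d0; lra.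
have [nDf' Ef'] := footP x' oD D0.
have le1 : bdist D x' <= bdist D x / 2.
  have := dist_to_le x' (nDf : (~` D) _); rewrite x'f enormZ N1 mulr1.
  by rewrite ger0_norm// divr_ge0// ltW.
have le2 : bdist D x <= enorm (x - foot D x') by exact: dist_to_le.
have le3 : bdist D x <= bdist D x / 2 + bdist D x'.
  by apply: le_trans le2 _; rewrite -xx' /bdist -Ef'; exact: enorm_triangle.
have e1 := halves_eq le3 le1.
split=> //.
have E : enorm (x' - foot D x') = bdist D x / 2 by rewrite Ef'.
pose a := (bdist D x / 2) *: nrm D x.
have aE : x - x' = a by rewrite /x' subKr.
have sq1 : dot a a = (bdist D x / 2) ^+ 2 by rewrite -aE -sqr_enorm xx'.
pose c := x' - foot D x'.
have sq2 : dot c c = (bdist D x / 2) ^+ 2 by rewrite -sqr_enorm E.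
have sq3 : bdist D x ^+ 2 <= dot (a + c) (a + c).
  rewrite -aE subrKA -sqr_enorm ler_pXn2r ?nnegrE ?enorm_ge0//.
  exact: ltW.
have ac : a - c = 0.
  apply: dot_eq0; apply/eqP; rewrite eq_le dot_ge0 andbT.
  by rewrite parallelogram sq1 sq2; exact: half_square_le.
have : c = a by apply/eqP; rewrite -subr_eq0 -opprB ac oppr0.
by rewrite /a -x'f /c => /addrI/oppr_inj.
Qed.

Lemma level_strongly_convex D rho e s : open D -> ~` D !=set0 -> (p < n)%N ->
  (forall x, D x -> bdist D x < e -> collar_point D e x) ->
  strongly_p_psh p D rho -> exhaustion D rho -> 0 < s -> s < e ->
  (forall x, bd D x -> ~ p_flat p D x) ->
  strongly_p_convex p [set x | s < bdist D x].
Proof.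
move=> oD D0 pn hc psh exh s0 se nflat.
have inb x : bd [set z | s < bdist D z] x -> D x /\ bdist D x = s.
  move=> /(bd_level D0) dx; split=> //; apply: bdist_in; by rewrite dx.
split.
  move=> x /inb[Dx dx]; have xe : bdist D x < e by rewrite dx.
  have [ld _ _] := level_defining oD D0 hc s0 Dx xe.
  by eexists; eexists; exact: ld.
move=> x /inb[Dx dx]; have xe : bdist D x < e by rewrite dx.
have [ld nE vE] := level_defining oD D0 hc s0 Dx xe.
have [_ _ [_ Hs] [U [phi [A [ldf HA Asm Hfoot]]]] _] := hc x Dx xe.
have symS u v : dot (u *m - shapeop D x) v = dot (v *m - shapeop D x) u.
  by rewrite !mulmxN !dotNl (collar_symmetric oD D0 hc Dx xe).
have NS : nrm D x *m - shapeop D x = 0.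
  by rewrite mulmxN (collar_normal oD D0 hc Dx xe) oppr0.
have n1n : (n.-1 < n)%N by rewrite ltn_predL; exact: leq_ltn_trans pn.
have [b [ob eb sb _]] := tangent_eigenbasis n1n symS NS.
have [k kE] : exists k : nat -> R, forall i, dot (b i *m - shapeop D x) (b i) = k i.
  by exists (fun i => dot (b i *m - shapeop D x) (b i)).
have pn1 : (p <= n.-1)%N by rewrite -ltnS prednK//; exact: leq_ltn_trans pn.
have bk i : (i < n.-1)%N -> b i *m shapeop D x = - k i *: b i.
  move=> ik; have [_] := eb i ik; rewrite kE mulmxN => E.
  by rewrite scaleNr -E opprK.
have enb i : (i < n.-1)%N -> enorm (b i) = 1 by move=> ik; rewrite /enorm ob// eqxx sqrtr1.
(* The scaled bound of [collar_point] on the shape operator keeps all denominators 1 + s k at least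
   1 / 2. *)
have ksm i : (i < n.-1)%N -> s * `|k i| <= 1 / 2.
  move=> ik; have := Hs (b i); rewrite dx bk// enormZ normrN enb//.
  by rewrite !mulr1.
have kpos i : (i < n.-1)%N -> 1 / 2 <= 1 + s * k i.
  move=> ik; have := ksm i ik; have := ler_norm (- k i); rewrite normrN => h1 h2.
  have := ler_wpM2l (ltW s0) h1; lra.
have h12 : 0 < 1 / 2 :> R by [].
have knz i : (i < n.-1)%N -> 1 + s * k i != 0.
  by move=> ik; rewrite (gt_eqF (lt_le_trans h12 (kpos i ik))).
exists [tuple of mkseq k n.-1]; split.
  apply: (principal_curvatures_eigen (b := b) (nu := k) ld vE ob _ bk).
  - by move=> i ik; rewrite nE; have [] := eb i ik.
  - by move=> i j ij jk; rewrite -!kE; exact: sb.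
(* The curvatures [k i] at depth [s] come from [k i / (1 + s * k i)] at the foot
   point and from [k i / (1 + s / 2 * k i)] at depth [s / 2], where their sum is
   already known to be nonnegative. *)
have N1 := enorm_nrm oD D0 Dx.
have outer v : dot v (nrm D x) = 0 -> v *m (1%:M - (nrm D x)^T *m nrm D x) = v.
  by move=> vN; rewrite mulmxBr mulmx1 mulmx_outer vN scale0r subr0.
have xx0 : enorm (x - x) <= bdist D x by rewrite subrr enorm0 dist_to_ge0.
have [nx Hx _] := Hfoot x Dx xx0 erefl.
(* On b i the relation between the shape operator at x and A reads - k b = (1 + s k) b A, so - nu is
   the eigenvalue of A at the foot. *)
pose nu i := k i / (1 + s * k i).
have bA i : (i < n.-1)%N -> b i *m A = - nu i *: b i.
  move=> ik; have [bN _] := eb i ik; have kn := knz i ik.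
  have : b i *m shapeop D x = (1 + s * k i) *: (b i *m A).
    rewrite Hx mulmxA mulmxBr (outer _ bN) -scalemxAr (bk i ik) dx scalerA mulrN scaleNr opprK.
    by rewrite -{1}[b i]scale1r -scalerDl scalemxAl.
  rewrite (bk i ik) => E; apply: (scalerI kn); rewrite -E scalerA; congr (_ *: _).
  by rewrite /nu; field.
have [Dx' dx' fx'] := foot_halfway oD D0 Dx.
set x' := x - _ in Dx' dx' fx'; rewrite dx in dx'.
have s20 : 0 < s / 2 by rewrite divr_gt0.
have xx' : enorm (x' - x) <= bdist D x.
  rewrite enormC /x' subKr enormZ N1 mulr1 dx ger0_norm; last by rewrite divr_ge0// ltW.
  lra.
have [nx' Hx' _] := Hfoot x' Dx' xx' fx'.
have nn : nrm D x' = nrm D x by rewrite nx nx'.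
pose k' i := k i / (1 + s / 2 * k i).
have k2 i : (i < n.-1)%N -> 0 < 1 + s / 2 * k i by move=> ik; have := kpos i ik; lra.
have bk' i : (i < n.-1)%N -> b i *m shapeop D x' = - k' i *: b i.
  move=> ik; have [bN _] := eb i ik; have kn := knz i ik.
  have kn2 : 1 + s / 2 * k i != 0 by rewrite (gt_eqF (k2 i ik)).
  have [r rdef] : exists r, r = b i *m shapeop D x' by eexists.
  have rE : r = - nu i *: b i - (s / 2) *: (r *m A).
    rewrite {1}rdef Hx' nn mulmxA mulmxBr (outer _ bN) -scalemxAr dx' -rdef mulmxBl (bA i ik).
    by rewrite -scalemxAl.
  (* The relation for the shape operator at x' is implicit. The deviation q from the expected value
     satisfies q = - (s / 2) q A, and s |q A| <= |q| / 2 forces q = 0. *)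
  have [q qdef] : exists q, q = r + k' i *: b i by eexists.
  have qE : q = - (s / 2) *: (q *m A).
    rewrite {1}qdef {1}rE qdef mulmxDl -scalemxAl (bA i ik).
    have V (u w : 'rV[R]_n) (c h v : R) :
        (c * (h * v)) *: w - c *: u = - c *: (u + h *: (- v *: w)).
      by apply/rowP => l; rewrite !mxE; ring.
    have E : k' i - nu i = s / 2 * (k' i * nu i).
      have h1 : k' i * (1 + s / 2 * k i) = k i by rewrite /k' divfK.
      have h2 : nu i * (1 + s * k i) = k i by rewrite /nu divfK.
      apply: (mulIf kn2); apply: (mulIf kn); rewrite !mulrBl h1.
      have -> : s / 2 * (k' i * nu i) * (1 + s / 2 * k i) * (1 + s * k i) =
        s / 2 * (k' i * (1 + s / 2 * k i)) * (nu i * (1 + s * k i)) by ring.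
      have -> : nu i * (1 + s / 2 * k i) * (1 + s * k i) =
        nu i * (1 + s * k i) * (1 + s / 2 * k i) by ring.
      by rewrite h1 h2; field.
    have -> : - nu i *: b i - s / 2 *: (r *m A) + k' i *: b i =
      (k' i - nu i) *: b i - s / 2 *: (r *m A).
      by rewrite scalerBl scaleNr addrC addrA.
    rewrite E; exact: V.
  have q0 : q = 0.
    apply: enorm_eq0; apply/eqP; rewrite eq_le enorm_ge0 andbT.
    have := Asm q; rewrite dx => h.
    have : enorm q = s / 2 * enorm (q *m A).
      by rewrite {1}qE enormZ normrN (gtr0_norm s20).
    by have := enorm_ge0 q; move: (enorm q) (enorm (q *m A)) h => a c; exact: contraction_zero.
  by rewrite -rdef scaleNr; apply/eqP; rewrite -addr_eq0 -qdef q0.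
have levi : 0 <= \sum_(i < p) k' i.
  have ob' (i j : 'I_p) : dot (b i) (b j) = (i == j)%:R.
    by apply: ob; apply: leq_trans pn1.
  have bN' (i : 'I_p) : dot (b i) (nrm D x') = 0.
    by rewrite nn; case: (eb i (leq_trans (ltn_ord i) pn1)).
  have xe' : bdist D x' < e by rewrite dx'; lra.
  have := collar_levi oD D0 hc psh exh Dx' xe' ob' bN'.
  rewrite (eq_bigr (fun i : 'I_p => - k' i)); last first.
    move=> i _; have ip : (i < n.-1)%N by exact: leq_trans pn1.
    by rewrite (bk' i ip) dotZl ob' eqxx mulr1.
  by rewrite sumrN oppr_le0.
have kk i : (i < n.-1)%N -> k' i <= k i /\ (k i != 0 -> k' i < k i).
  by move=> ip; exact: (curvature_mono s20 (k2 i ip)).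
have sumE : \sum_(i < p) [tuple of mkseq k n.-1]`_i = \sum_(i < p) k i.
  by apply: eq_bigr => i _; rewrite (nth_mkseq _ _ (leq_trans (ltn_ord i) pn1)).
rewrite sumE.
(* If k i = 0 for all i < p, then nu i = 0 as well and the foot of x is p-flat. *)
have [nz|az] := pselect (exists2 i : 'I_p, true & k i != 0); last first.
  exfalso; apply: (nflat (foot D x)).
    by have [nDf Ef] := footP x oD D0; exact: foot_bd oD Dx nDf Ef.
  exists [tuple of mkseq nu n.-1]; split.
    apply: (principal_curvatures_eigen (b := b) (nu := nu) ldf HA ob _ bA).
      by move=> i ik; rewrite -nx; have [] := eb i ik.
    move=> i j ij jk; have ik := leq_ltn_trans ij jk; rewrite /nu.
    have ki := kpos i ik; have kj := kpos j jk; have kij := sb i j ij jk.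
    rewrite ler_pdivrMr; last by lra.
    rewrite mulrAC ler_pdivlMr; last by lra.
    rewrite !kE in kij; lra.
  move=> i ip; rewrite nth_mkseq; last exact: leq_trans pn1.
  rewrite /nu; have -> : k i = 0; last by rewrite mul0r.
  by apply/eqP/negPn/negP => ki; apply: az; exists (Ordinal ip).
case: nz => i0 _ ki0; apply: le_lt_trans levi _.
rewrite (bigD1 i0 (erefl true)) [ltRHS](bigD1 i0 (erefl true)); apply: ltr_leD.
  by have [_] := kk i0 (leq_trans (ltn_ord i0) pn1); apply.
by apply: ler_sum => i _; have [] := kk i (leq_trans (ltn_ord i) pn1).
Qed.

End StrongConvexity.

Theorem corollary1p6 (R : realType) (n p : nat) (r : R) (D : set 'rV[R]_n)
    (hn : (3 <= n)%N) (hp : (2 <= p < n)%N) (hr : 2 < r)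
    (hbdd : bounded_set D) (hconv : p_convex_domain p D)
    (hbd : has_Cr_boundary r D) :
  exists2 t0 : R, t0 < 0 & forall t : R, t0 < t -> t < 0 ->
    p_convex_domain p (sublevel_domain D t) /\
    ((forall x, bd D x -> ~ p_flat p D x) ->
      strongly_p_convex p (sublevel_domain D t)).
Proof.
have /andP[p2 pn] := hp.
have [[oD cD neD] [rho [psh exh]]] := hconv.
have D0 : ~` D !=set0.
  have /bounded_enormP[M HM] := hbdd.
  pose i0 := Ordinal (leq_ltn_trans (leq0n 2) hn : (0 < n)%N).
  exists ((`|M| + 1) *: ebase i0) => /HM.
  have e1 : enorm (ebase i0 : 'rV[R]_n) = 1.
    by rewrite /enorm dot_ebase mxE !eqxx sqrtr1.
  rewrite enormZ e1 mulr1 ger0_norm ?addr_ge0//.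
  by have := ler_norm M; lra.
have [e e0 hc] := collar_exists hr oD D0 hbdd hbd.
have [s1 s10 Hconn] := level_connected oD D0 cD neD hbdd e0 hc.
pose K := (2 * p%:R + 1) * e^-1.
have K0 : 0 < K by rewrite mulr_gt0 ?invr_gt0// ltr_wpDl// mulr_ge0.
(* The bound 2 / K lets the barrier dominate the trace estimate, and e / 2 gives s + m < e for every
   s < e / 2. *)
pose m := Order.min (e / 2) (2 / K).
have m0 : 0 < m by rewrite lt_min !divr_gt0.
have me : m <= e / 2 by rewrite ge_min lexx.
have Km : K * m <= 2 by rewrite mulrC -ler_pdivlMr// ge_min lexx orbT.
exists (- Order.min s1 (e / 2)); first by rewrite oppr_lt0 lt_min s10 divr_gt0.
move=> t; rewrite ltrNl lt_min => /andP[ts1 te] t0.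
have s0 : 0 < - t by rewrite oppr_gt0.
have [cE nE] := Hconn _ s0 ts1.
rewrite sublevelE//; split.
  split; first by split => //; exact: open_level.
  apply: (psh_exhaustion oD D0 hbdd _ e0 hc psh exh s0 m0 Km); first exact: leq_trans p2.
  by lra.
move=> nf; apply: (level_strongly_convex oD D0 pn hc psh exh s0 _ nf); lra.
Qed.
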